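(* Let $n\ge 1$ and $r\ge 1$ be integers, let $A:\mathbb{R}^+\to\mathcal{M}_n(\mathbb{R})$ be continuous with $\sup_{s\in\mathbb{R}^+}\|A(s)\|=M<+\infty$ for some $M>1$, and let $f:\mathbb{R}^+\times\mathbb{R}^n\to\mathbb{R}^n$. Let $\Phi(t,s)$ be the transition matrix of the linear system $x'=A(t)x$ (with $\Phi(s,s)=I_n$). Assume: (P1) there are constants $K\ge 0$, $\alpha>0$ with $\|\Phi(t,s)\|\le Ke^{-\alpha(t-s)}$ for all $t\ge s\ge 0$; (P2) $f$ is continuous in $(t,y)$ and there is $\gamma\ge 0$ such that $|f(t,y)-f(t,\bar y)|\le\gamma|y-\bar y|$ for all $t\ge 0$ and $y,\bar y\in\mathbb{R}^n$; (P3) there is $\mu\ge 0$ with $\sup_{t\ge 0}|f(t,0)|\le\mu$, and for every $x\in\mathbb{R}^n$ the function $t\mapsto f(t,x)$ is bounded on $\mathbb{R}^+$; (P4) for every fixed $t\ge 0$, $|f(t,x)|\to+\infty$ as $|x|\to+\infty$; (P5) $f(t,x)$ and its derivatives with respect to $x$ up to order $r$ are continuous functions of $(t,x)$; (N) for every $j\in\mathbb{N}$ and every fixed $s,t\in\mathbb{R}^+$, $|x(s,t,\xi)+z_j^*(s;(t,\xi))|\to\infty$ as $|\xi|\to\infty$, where $x(s,t,\xi)=\Phi(s,t)\xi$ and the functions $z_j^*$ are defined in the context; and $K\gamma<\alpha$. Then the systems $x'=A(t)x$ and $y'=A(t)y+f(t,y)$ are $C^r$-continuously topologically equivalent on $\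mathbb{R}^+$.
   Context: Notation: $\mathbb{R}^+=[0,+\infty)$; $|\cdot|$ and $\|\cdot\|$ are vector and matrix norms; $\mathbb{N}=\{1,2,\dots\}$. The two systems are the linear system (L): $x'=A(t)x$ and the nonlinear system (NL): $y'=A(t)y+f(t,y)$ on $\mathbb{R}^+$. The solution of (L) passing through $\xi$ at time $\tau$ is $t\mapsto x(t,\tau,\xi)=\Phi(t,\tau)\xi$. The functions $z_j^*$: for $(t,\xi)\in\mathbb{R}^+\times\mathbb{R}^n$ and $s\in\mathbb{R}^+$, $$z_0^*(s;(t,\xi))=\int_0^s\Phi(s,r)f(r,x(r,t,\xi))\,dr,$$ $$z_{j+1}^*(s;(t,\xi))=\int_0^s\Phi(s,r)f\big(r,x(r,t,\xi)+z_j^*(r;(t,\xi))\big)\,dr,\quad j\ge 0.$$ Definition ($\mathbb{R}^+$-continuous topological equivalence). (L) and (NL) are $\mathbb{R}^+$-continuously topologically equivalent if there is a function $H:\mathbb{R}^+\times\mathbb{R}^n\to\mathbb{R}^n$ such that: (i) if $x(t)$ is a solution of (L), then $H[t,x(t)]$ is a solution of (NL); (ii) $H(t,x)\to H(t,x_0)$ as $x\to x_0$, uniformly with respect to $t$; (iii) $|H(t,x)|\to+\infty$ as $|x|\to+\infty$, uniformly with respect to $t$; (iv) for each fixed $t\in\mathbb{R}^+$, $u\mapsto H(t,u)$ is a homeomorphism of $\mathbb{R}^n$; (v) $H$ is continuous at every $(t,u)\in\mathbb{R}^+\times\mathbb{R}^n$. In addition, the function $G(t,u)=H^{-1}(t,u)$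 (the inverse of $H(t,\cdot)$ evaluated at $u$) has properties (ii)--(v) and maps solutions of (NL) into solutions of (L). Definition ($C^r$-continuous topological equivalence on $\mathbb{R}^+$). (L) and (NL) are $C^r$-continuously topologically equivalent on $\mathbb{R}^+$ if: (a) they are $\mathbb{R}^+$-continuously topologically equivalent (through $H$ and $G$); (b) for any fixed $t\in\mathbb{R}^+$ the map $u\mapsto H(t,u)$ is a $C^r$-diffeomorphism of $\mathbb{R}^n$; (c) the partial derivatives of $H$ and $G$ up to order $r$ with respect to $u$ are continuous functions of $(t,u)\in\mathbb{R}^+\times\mathbb{R}^n$. *)

(* Defs.v *)
From HB Require Import structures.
From mathcomp Require Import all_boot all_order all_algebra.
From mathcomp Require Import all_classical all_reals all_analysis.

Set Implicit Arguments.
Unset Strict Implicit.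
Unset Printing Implicit Defensive.

Import Order.TTheory GRing.Theory Num.Theory.
Import numFieldNormedType.Exports.

Local Open Scope classical_set_scope.
Local Open Scope ring_scope.

(** Functions of time are total functions on [R], but only their values at
    times [t >= 0] are ever constrained or used. *)
Definition Rplus (R : realType) : set R := [set t | 0 <= t].
Arguments Rplus {R}.

(** The norms |.| on R^n and ||.|| on M_n(R) are arbitrary, as long as they are
    compatible.  They need not be the max norm carried by the library type
    of matrices, which is used only as a source of the usual topology.
    Nonnegativity and [N 0 = 0] follow from the three clauses. *)
Record is_norm (R : realType) (V : lmodType R) (N : V -> R) : Prop := IsNorm {
  norm_eq0 : forall x, N x = 0 -> x = 0;
  norm_scale : forall (a : R) x, N (a *: x) = `|a| * N x;
  norm_triangle : forall x y, N (x + y) <= N x + N y }.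

Definition compatible_norms (R : realType) (n : nat)
    (N : 'cV[R]_n -> R) (mN : 'M[R]_n -> R) : Prop :=
  forall (B : 'M[R]_n) (x : 'cV[R]_n), N (B *m x) <= mN B * N x.

(** Derivative relative to the half-line: two-sided at [t > 0], and the right
    derivative at [t = 0]. *)
Definition has_deriv_Rplus (R : realType) (V : normedModType R)
    (x : R -> V) (t : R) (v : V) : Prop :=
  (fun h : R => h^-1 *: (x (t + h) - x t))
    @ within [set h | 0 <= t + h] (0 : R)^' --> v.

Definition solution (R : realType) (n : nat)
    (F : R -> 'cV[R]_n -> 'cV[R]_n) (x : R -> 'cV[R]_n) : Prop :=
  forall t, 0 <= t -> has_deriv_Rplus x t (F t (x t)).

Definition linear_system (R : realType) (n : nat) (A : R -> 'M[R]_n) :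
    R -> 'cV[R]_n -> 'cV[R]_n :=
  fun t x => A t *m x.

Definition nonlinear_system (R : realType) (n : nat) (A : R -> 'M[R]_n)
    (f : R -> 'cV[R]_n -> 'cV[R]_n) : R -> 'cV[R]_n -> 'cV[R]_n :=
  fun t y => A t *m y + f t y.

(** [Phi t s] is Phi(t,s), for [t] and [s] in either order. *)
Definition transition_matrix (R : realType) (n : nat)
    (A : R -> 'M[R]_n) (Phi : R -> R -> 'M[R]_n) : Prop :=
  forall s, 0 <= s -> Phi s s = 1%:M /\
    forall t, 0 <= t -> has_deriv_Rplus (fun u => Phi u s) t (A t *m Phi t s).

Definition vec_integral (R : realType) (n : nat) (a b : R)
    (g : R -> 'cV[R]_n) : 'cV[R]_n :=
  \col_i (\int[lebesgue_measure]_(u in `[a, b]) g u i 0).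

(** [zstar Phi f j t xi s] is z_j^*(s;(t,xi)). *)
Fixpoint zstar (R : realType) (n : nat) (Phi : R -> R -> 'M[R]_n)
    (f : R -> 'cV[R]_n -> 'cV[R]_n) (j : nat) (t : R) (xi : 'cV[R]_n) (s : R) :
    'cV[R]_n :=
  match j with
  | 0%N => vec_integral 0 s (fun u => Phi s u *m f u (Phi u t *m xi))
  | k.+1 => vec_integral 0 s
      (fun u => Phi s u *m f u (Phi u t *m xi + zstar Phi f k t xi u))
  end.

Definition tends_to_infinity (R : realType) (n : nat) (N : 'cV[R]_n -> R)
    (g : 'cV[R]_n -> 'cV[R]_n) : Prop :=
  forall B : R, exists rho : R, forall x, rho < N x -> B < N (g x).

Definition jointly_continuous (R : realType) (n : nat)
    (F : R -> 'cV[R]_n -> 'cV[R]_n) : Prop :=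
  {within [set p : R * 'cV[R]_n | 0 <= p.1],
    continuous (fun p : R * 'cV[R]_n => F p.1 p.2)}.

(** Iterated partial derivatives: [partials [:: j1; ...; jk] g] is
    d/dx_j1 (... (d/dx_jk g)). *)
Fixpoint partials (R : realType) (n : nat) (js : seq 'I_n)
    (g : 'cV[R]_n -> 'cV[R]_n) : 'cV[R]_n -> 'cV[R]_n :=
  match js with
  | [::] => g
  | j :: js' => fun x => 'D_(delta_mx j 0) (partials js' g) x
  end.

(** The derivability clause is needed because ['D_v g x] is total. *)
Definition class_C (R : realType) (n r : nat)
    (g : 'cV[R]_n -> 'cV[R]_n) : Prop :=
  (forall js : seq 'I_n, (size js < r)%N ->
     forall (j : 'I_n) x, derivable (partials js g) x (delta_mx j 0)) /\
  (forall js : seq 'I_n, (size js <= r)%N -> continuous (partials js g)).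

Definition jointly_continuous_partials (R : realType) (n r : nat)
    (F : R -> 'cV[R]_n -> 'cV[R]_n) : Prop :=
  forall js : seq 'I_n, (size js <= r)%N ->
    jointly_continuous (fun t => partials js (F t)).

Definition homeomorphism (R : realType) (n : nat)
    (h : 'cV[R]_n -> 'cV[R]_n) : Prop :=
  exists g : 'cV[R]_n -> 'cV[R]_n,
    [/\ cancel h g, cancel g h, continuous h & continuous g].

Definition diffeomorphism (R : realType) (n r : nat)
    (h : 'cV[R]_n -> 'cV[R]_n) : Prop :=
  exists g : 'cV[R]_n -> 'cV[R]_n,
    [/\ cancel h g, cancel g h, class_C r h & class_C r g].

Definition maps_solutions (R : realType) (n : nat)
    (F1 F2 H : R -> 'cV[R]_n -> 'cV[R]_n) : Prop :=
  forall x, solution F1 x -> solution F2 (fun t => H t (x t)).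

Record equivalence_map (R : realType) (n : nat) (N : 'cV[R]_n -> R)
    (H : R -> 'cV[R]_n -> 'cV[R]_n) : Prop := EquivalenceMap {
  uniformly_continuous_at_each_point :
    forall (x0 : 'cV[R]_n) (e : R), 0 < e -> exists2 d : R, 0 < d &
      forall x, N (x - x0) < d ->
      forall t, 0 <= t -> N (H t x - H t x0) < e;
  uniformly_tends_to_infinity :
    forall B : R, exists rho : R, forall x, rho < N x ->
      forall t, 0 <= t -> B < N (H t x);
  homeomorphism_at_each_time : forall t, 0 <= t -> homeomorphism (H t);
  continuous_in_time_and_space : jointly_continuous H }.

Record topologically_equivalent_through (R : realType) (n : nat)
    (N : 'cV[R]_n -> R) (F1 F2 H G : R -> 'cV[R]_n -> 'cV[R]_n) : Prop :=
  TopologicallyEquivalentThrough {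
  direct_map : equivalence_map N H;
  direct_solutions : maps_solutions F1 F2 H;
  inverse_maps : forall t, 0 <= t -> cancel (H t) (G t) /\ cancel (G t) (H t);
  inverse_map : equivalence_map N G;
  inverse_solutions : maps_solutions F2 F1 G }.

Definition Cr_topologically_equivalent (R : realType) (n r : nat)
    (N : 'cV[R]_n -> R) (F1 F2 : R -> 'cV[R]_n -> 'cV[R]_n) : Prop :=
  exists H G : R -> 'cV[R]_n -> 'cV[R]_n,
    [/\ topologically_equivalent_through N F1 F2 H G,
        forall t, 0 <= t -> diffeomorphism r (H t),
        jointly_continuous_partials r H &
        jointly_continuous_partials r G].

(* Main.v *)
(** Write X_t, Y_t for the solution maps from time 0 of the linear and of the
    nonlinear system.  The homeomorphism that pairs solutions with equal
    initial values, Y_t o X_t^-1, is in general not equicontinuous in t: for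
    f(t,y) = gamma y with A = -alpha it is multiplication by e^(gamma t).
    Instead H(t,.) = Y_t o h o X_t^-1 with h constructed as follows.

    Let f1 = chi f, where chi is a C^r cutoff equal to 1 on a large ball, with
    compact support and with a logarithmically slow slope, so that f1 is
    bounded and has a Lipschitz constant gamma1 with K gamma1 < alpha.  Let
    Y1_t be the solution map of x' = A x + f1.  All three flows contract
    distances up to the factor K, and all trajectories enter the ball on which
    f1 = f after a time controlled by their size.

    - Corresponding trajectories of X and Y1 stay at bounded distance, since
      f1 is bounded; restarting at time t - l and using the contraction on
      [t - l, t] shows that Y1_t o X_t^-1 and its inverse are equicontinuous.
    - The trajectories of Y1 and Y eventually satisfy the same equation, so
      h = Y_T^-1 o Y1_T does not depend on T as long as T is large, and h
      pairs trajectories that eventually coincide.  On a ball of radius C the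
      map Y_t o h o Y1_t^-1 only involves the flows on [t, t + c(C)], hence it
      is Lipschitz there, uniformly in t.

    Locally h is a composition of solution maps, so smoothness reduces to the
    C^r dependence of solutions on initial values. *)

Require Import Defs.
From HB Require Import structures.
From mathcomp Require Import all_boot all_order all_algebra.
From mathcomp Require Import all_classical all_reals all_analysis.
From mathcomp Require Import ring lra.

Set Implicit Arguments.
Unset Strict Implicit.
Unset Printing Implicit Defensive.

Import Order.TTheory GRing.Theory Num.Theory.
Import numFieldNormedType.Exports.

Local Open Scope classical_set_scope.
Local Open Scope ring_scope.

(** * Calculus preliminaries *)

(** The intermediate system is there because neither comparison relates X to Y directly: f grows, so
    X- and Y-trajectories may drift apart without bound, and f need not vanish near the origin, so
    they need not eventually coincide. f1 is bounded, which makes it comparable with 0, and it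
    equals f where all trajectories end, which makes it comparable with f.

    The slope of chi must be logarithmically slow because the Lipschitz constant of chi f exceeds
    gamma by about |slope| |f|, and |f| may grow linearly. A slope d / (1 + |y|) keeps the excess of
    order d, and since its integral diverges it still takes chi from 1 to 0 within a finite radius.

    The fields are frozen at their time-0 value for t < 0, so that flows live on the whole line with
    two-sided derivatives. Solutions in the sense of the statement meet these flows only through
    uniqueness on the half-line.

    Smooth dependence is obtained without total derivatives: completed difference quotients in one
    coordinate at a time are continuous and give exact linear identities. *)

Section Basics.
Variable R : realType.

Lemma is_deriveP (V W : normedModType R) (x v : V) (f : V -> W) (df : W) :
  is_derive x v f df <->
  h^-1 *: (f (h *: v + x) - f x) @[h --> (0 : R)^'] --> df.
Proof.
split=> [[fx <-]|fdf]; first exact: fx.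
by apply: DeriveDef; [apply/cvg_ex; exists df | apply/cvg_lim].
Qed.

Lemma is_derive_unique (V W : normedModType R) (x v : V) (f : V -> W) (a b : W) :
  is_derive x v f a -> is_derive x v f b -> a = b.
Proof. by move=> [_ <-] [_ <-]. Qed.

Lemma is_derive_mxP (V : normedModType R) (m n : nat) (x v : V)
    (f : V -> 'M[R]_(m, n)) (df : 'M[R]_(m, n)) :
  is_derive x v f df <->
  forall i j, is_derive x v (fun y => f y i j) (df i j).
Proof.
split=> [[fx <-] i j|fij].
  by rewrite derive_mx// mxE; apply/derivableP; have /derivable_mxP := fx; apply.
have fx : derivable f x v by apply/derivable_mxP => i j; case: (fij i j).
apply: DeriveDef => //; rewrite derive_mx//.
by apply/matrixP => i j; rewrite mxE; case: (fij i j).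
Qed.

Lemma mx_norm_leP (m n : nat) (A : 'M[R]_(m, n)) (e : R) : 0 <= e ->
  (forall i j, `|A i j| <= e) <-> `|A| <= e.
Proof.
move=> e0; rewrite [`|A|]/Num.Def.normr/= mx_normrE; split=> [Ae|/bigmax_leP[_ Ae] i j].
  by apply: bigmax_le => // -[i j] _; exact: Ae.
exact: (Ae (i, j)).
Qed.

Lemma coord_le_norm (m n : nat) (A : 'M[R]_(m, n)) i j : `|A i j| <= `|A|.
Proof. exact: (mx_norm_leP A (normr_ge0 A)).2. Qed.

Lemma cvg_mxP (T : Type) (F : set_system T) (FF : Filter F) (m n : nat)
    (f : T -> 'M[R]_(m, n)) (l : 'M[R]_(m, n)) :
  f x @[x --> F] --> l <-> forall i j, f x i j @[x --> F] --> l i j.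
Proof.
split=> [fl i j|fl].
  by apply: (cvg_comp f (fun A : 'M[R]_(m, n) => A i j) fl); exact: coord_continuous.
apply/cvgrPdist_le => /= e e0.
have : \forall x \near F, forall ij : 'I_m * 'I_n, `|l ij.1 ij.2 - f x ij.1 ij.2| <= e.
  by apply: filter_forall => -[i j] /=; move/cvgrPdist_le : (fl i j); apply.
apply: filterS => x H; apply/mx_norm_leP; first exact: ltW.
by move=> i j; rewrite !mxE; exact: (H (i, j)).
Qed.

Lemma continuous_mxP (T : topologicalType) (m n : nat) (f : T -> 'M[R]_(m, n)) :
  continuous f <-> forall i j, continuous (fun x => f x i j).
Proof.
split=> [cf i j x|cf x]; first by have /cvg_mxP := cf x; apply.
by apply/cvg_mxP => i j; exact: cf.
Qed.

Lemma continuous_sum (T : topologicalType) (I : finType) (f : I -> T -> R) :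
  (forall i, continuous (f i)) -> continuous (fun x => \sum_i f i x).
Proof. by move=> cf x; apply: cvg_big => [|i _]; [exact: add_continuous|exact: cf]. Qed.

Lemma is_derive_affine (V W : normedModType R) (f : V -> W) (df : W)
    (x v : V) (a b s : R) :
  is_derive (x + (a * s + b) *: v) v f df ->
  is_derive s 1 (fun s => f (x + (a * s + b) *: v)) (a *: df).
Proof.
(* For [a = 0] the substitution of [a * h] for [h] leaves the punctured neighbourhood, but the curve
   is then constant. *)
have [->|a0] := eqVneq a 0.
  move=> _; rewrite scale0r.
  have -> : (fun s : R => f (x + (0 * s + b) *: v)) = cst (f (x + b *: v)).
    by apply/funext => u /=; rewrite mul0r add0r.
  exact: is_derive_cst.
move=> /is_deriveP H; apply/is_deriveP.
have cv : (a * h) @[h --> (0 : R)^'] --> (0 : R)^'.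
  move=> A [e/= e0 eA]; exists (e / `|a|) => /=.
    by rewrite divr_gt0// normr_gt0.
  move=> h /=; rewrite sub0r normrN ltr_pdivlMr ?normr_gt0// => he h0.
  apply: eA; last by rewrite mulf_neq0.
  by rewrite /= sub0r normrN normrM mulrC.
have {}H := cvg_comp _ _ cv H.
have {}H : (a *: ((a * h)^-1 *: (f ((a * h) *: v + (x + (a * s + b) *: v)) -
    f (x + (a * s + b) *: v)))) @[h --> (0 : R)^'] --> a *: df.
  by apply: cvgZ; [exact: cvg_cst|exact: H].
apply: cvg_trans H.
apply: near_eq_cvg; near=> h => /=.
have h0 : h != 0 by near: h; exact: nbhs_dnbhs_neq.
rewrite scalerA invfM mulrA mulfV// mul1r; congr (_ *: (f _ - _)).
rewrite [h *: 1]mulr1 mulrDr [_ *: v + (x + _)]addrCA -scalerDl.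
by congr (_ + _ *: _); rewrite addrA.
Unshelve. all: by end_near. Qed.

Lemma is_derive_reparam (W : normedModType R) (f : R -> W) (df : W) (a b s : R) :
  is_derive (a * s + b) 1 f df -> is_derive s 1 (fun s => f (a * s + b)) (a *: df).
Proof.
move=> H; have := @is_derive_affine _ _ f df 0 1 a b s.
rewrite add0r [_ *: 1]mulr1 => /(_ H).
by congr is_derive; apply/funext => u; rewrite add0r [_ *: 1]mulr1.
Qed.

Lemma is_derive_continuous (W : normedModType R) (f : R -> W) (s : R) (df : W) :
  is_derive s 1 f df -> {for s, continuous f}.
Proof. by move=> [fs _]; apply: differentiable_continuous; exact/derivable1_diffP. Qed.

(** Compactness of the segment: the product neighbourhoods around the points (x0, s) yield a single
    neighbourhood of [x0] that serves all [s]. *)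
Lemma tube (X : topologicalType) (x0 : X) (a b : R) (P : X -> R -> Prop) :
  (forall s, a <= s <= b -> \forall q \near (x0, s), P q.1 q.2) ->
  \forall x \near x0, forall s, a <= s <= b -> P x s.
Proof.
move=> H; have /compact_near_coveringP cK : compact `[a, b]%classic by exact: segment_compact.
have := cK X (nbhs x0) P _ _; apply.
move=> s; rewrite /= in_itv/= => /H [[A B] [A0 B0] AB].
exists (B, A) => //= -[y x] [/= By Ax]; exact: (AB (x, y)).
Qed.

End Basics.

(** * Continuity rules and a tactic that applies them *)

Section Cont.
Variable R : realType.

Lemma continuous_compT (X Y Z : topologicalType) (g : Y -> Z) (f : X -> Y) :
  continuous g -> continuous f -> continuous (fun x => g (f x)).
Proof. by move=> cg cf x; apply: (@continuous_comp _ _ _ f g); [exact: cf|exact: cg]. Qed.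

Lemma continuous_pair (X Y Z : topologicalType) (f : X -> Y) (g : X -> Z) :
  continuous f -> continuous g -> continuous (fun x => (f x, g x)).
Proof. by move=> cf cg x; apply: cvg_pair; [exact: cf|exact: cg]. Qed.

Lemma continuous_app2 (X Y Z W : topologicalType) (F : Y -> Z -> W)
    (f : X -> Y) (g : X -> Z) : continuous (fun q : Y * Z => F q.1 q.2) ->
  continuous f -> continuous g -> continuous (fun x => F (f x) (g x)).
Proof.
move=> cF cf cg; apply: (continuous_compT cF (f := fun x => (f x, g x))).
exact: continuous_pair.
Qed.

Lemma continuous_fst (X Y Z : topologicalType) (f : X -> Y * Z) :
  continuous f -> continuous (fun x => (f x).1).
Proof. by apply: continuous_compT => q; exact: cvg_fst. Qed.

Lemma continuous_snd (X Y Z : topologicalType) (f : X -> Y * Z) :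
  continuous f -> continuous (fun x => (f x).2).
Proof. by apply: continuous_compT => q; exact: cvg_snd. Qed.

Lemma continuous_coord (X : topologicalType) m n (f : X -> 'M[R]_(m, n)) i j :
  continuous f -> continuous (fun x => f x i j).
Proof. by move=> /continuous_mxP; exact. Qed.

Lemma continuous_add (X : topologicalType) (V : normedModType R) (f g : X -> V) :
  continuous f -> continuous g -> continuous (fun x => f x + g x).
Proof. by move=> cf cg x; apply: cvgD; [exact: cf|exact: cg]. Qed.

Lemma continuous_opp (X : topologicalType) (V : normedModType R) (f : X -> V) :
  continuous f -> continuous (fun x => - f x).
Proof. by move=> cf x; apply: cvgN; exact: cf. Qed.

Lemma continuous_mul (X : topologicalType) (f g : X -> R) :
  continuous f -> continuous g -> continuous (fun x => f x * g x).
Proof. by move=> cf cg x; apply: cvgM; [exact: cf|exact: cg]. Qed.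

Lemma continuous_scale (X : topologicalType) (V : normedModType R) (f : X -> R) (g : X -> V) :
  continuous f -> continuous g -> continuous (fun x => f x *: g x).
Proof. by move=> cf cg x; apply: cvgZ; [exact: cf|exact: cg]. Qed.

Lemma continuous_norm (X : topologicalType) (V : normedModType R) (f : X -> V) :
  continuous f -> continuous (fun x => `|f x|).
Proof. by move=> cf x; apply: cvg_norm; exact: cf. Qed.

Lemma continuous_id (X : topologicalType) : continuous (fun x : X => x).
Proof. by move=> x; exact: cvg_id. Qed.

Lemma continuous_mulmx (X : topologicalType) m n p (A : X -> 'M[R]_(m, n)) (B : X -> 'M[R]_(n, p)) :
  continuous A -> continuous B -> continuous (fun x => A x *m B x).
Proof.
move=> cA cB; apply/continuous_mxP => i j; under eq_fun do rewrite mxE.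
by apply: continuous_sum => k; apply: continuous_mul; exact: continuous_coord.
Qed.

End Cont.

(** Dispatches on the head symbol of the body by second-order patterns. The bare [fst], [snd] and
    [pair c] are eta-contracted forms that those patterns would miss. *)
Ltac continuity_step := lazymatch goal with
  | |- forall _, continuous_at _ (fun x => x) => exact: continuous_id
  | |- forall _, continuous_at _ fst => exact: (continuous_fst (@continuous_id _))
  | |- forall _, continuous_at _ (pair ?c) =>
      apply: (@continuous_pair _ _ _ (fun=> c) (fun x => x))
  | |- forall _, continuous_at _ snd => exact: (continuous_snd (@continuous_id _))
  | |- forall _, continuous_at _ (fun x => fst (@?f x)) => apply: (@continuous_fst _ _ _ f)
  | |- forall _, continuous_at _ (fun x => snd (@?f x)) => apply: (@continuous_snd _ _ _ f)
  | |- forall _, continuous_at _ (fun x => pair (@?f x) (@?g x)) => apply: (@continuous_pair _ _ _ f g)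
  | |- forall _, continuous_at _ (fun x => Algebra.add (@?f x) (@?g x)) => apply: (@continuous_add _ _ _ f g)
  | |- forall _, continuous_at _ (fun x => Algebra.opp (@?f x)) => apply: (@continuous_opp _ _ _ f)
  | |- forall _, continuous_at _ (fun x => GRing.mul (@?f x) (@?g x)) => apply: (@continuous_mul _ _ f g)
  | |- forall _, continuous_at _ (fun x => GRing.scale (@?f x) (@?g x)) => apply: (@continuous_scale _ _ _ f g)
  | |- forall _, continuous_at _ (fun x => Num.norm (@?f x)) => apply: (@continuous_norm _ _ _ f)
  | |- forall _, continuous_at _ (fun x => mulmx (@?f x) (@?g x)) => apply: (@continuous_mulmx _ _ _ _ _ f g)
  | |- forall _, continuous_at _ (fun x => fun_of_matrix (@?f x) ?i ?j) => apply: (@continuous_coord _ _ _ _ f i j)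
  | |- forall _, continuous_at _ (fun x => ?c) => exact: cst_continuous
  end.
Ltac cont := repeat first [continuity_step | assumption].

(** * Parametrised C^k functions *)

Section JointCk.
Variable R : realType.

(* The parameter [t] only enters continuously.  Unrolling one derivative at a
   time is what makes the inductions on [k] below go through. *)
Fixpoint joint_Ck (T : topologicalType) (n k : nat) (F : T -> 'cV[R]_n -> R) : Prop :=
  continuous (fun q : T * 'cV[R]_n => F q.1 q.2) /\
  if k is k'.+1 then
    forall j, exists2 G : T -> 'cV[R]_n -> R,
      (forall t x, is_derive x (delta_mx j 0) (F t) (G t x)) & joint_Ck k' G
  else True.

Lemma joint_Ck_continuous (T : topologicalType) n k (F : T -> 'cV[R]_n -> R) :
  joint_Ck k F -> continuous (fun q : T * 'cV[R]_n => F q.1 q.2).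
Proof. by case: k => [|k] []. Qed.

Lemma joint_Ck_le (T : topologicalType) n k l (F : T -> 'cV[R]_n -> R) : (l <= k)%N -> joint_Ck k F -> joint_Ck l F.
Proof.
elim: l k F => [|l IH] [|k] F //; first by move=> _ [].
rewrite ltnS => lk [cF dF]; split=> // j.
by have [G dG /(IH _ _ lk) JG] := dF j; exists G.
Qed.

Lemma joint_Ck_time (T : topologicalType) n k (g : T -> R) : continuous g ->
  joint_Ck k (fun t (_ : 'cV[R]_n) => g t).
Proof.
elim: k g => [|k IH] g cg.
  split=> // q; apply: (@continuous_comp _ _ _ fst g); first exact: cvg_fst.
  exact: cg.
split=> [|j].
  move=> q; apply: (@continuous_comp _ _ _ fst g); first exact: cvg_fst.
  exact: cg.
exists (fun _ _ => 0); last by apply: IH; exact: cst_continuous.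
by move=> t x; exact: is_derive_cst.
Qed.

Lemma joint_Ck_cst (T : topologicalType) n k (c : R) :
  joint_Ck k (fun (_ : T) (_ : 'cV[R]_n) => c).
Proof. by apply: joint_Ck_time; exact: cst_continuous. Qed.

Lemma is_derive_coord n (x v : 'cV[R]_n) i :
  is_derive x v (fun y : 'cV[R]_n => y i 0) (v i 0).
Proof.
have /is_derive_mxP := is_derive_id x v; exact.
Qed.

Lemma joint_Ck_coord (T : topologicalType) n k i :
  joint_Ck k (fun (_ : T) (x : 'cV[R]_n) => x i 0).
Proof.
have cF : continuous (fun q : T * 'cV[R]_n => q.2 i 0).
  move=> q; apply: (@continuous_comp _ _ _ snd (fun x : 'cV[R]_n => x i 0)).
    exact: cvg_snd.
  exact: coord_continuous.
case: k => [|k]; split=> // j.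
exists (fun _ _ => delta_mx j (0 : 'I_1) i 0); last exact: joint_Ck_cst.
by move=> t x; exact: is_derive_coord.
Qed.

Lemma joint_Ck_add (T : topologicalType) n k (F G : T -> 'cV[R]_n -> R) :
  joint_Ck k F -> joint_Ck k G -> joint_Ck k (fun t x => F t x + G t x).
Proof.
elim: k F G => [|k IH] F G [cF dF] [cG dG].
  by split=> // q; apply: cvgD; [exact: cF|exact: cG].
split=> [q|j]; first by apply: cvgD; [exact: cF|exact: cG].
have [F' dF' JF] := dF j; have [G' dG' JG] := dG j.
exists (fun t x => F' t x + G' t x); last exact: IH.
by move=> t x; exact: is_deriveD.
Qed.

Lemma joint_Ck_mul (T : topologicalType) n k (F G : T -> 'cV[R]_n -> R) :
  joint_Ck k F -> joint_Ck k G -> joint_Ck k (fun t x => F t x * G t x).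
Proof.
elim: k F G => [|k IH] F G JF JG; have cF := joint_Ck_continuous JF;
  have cG := joint_Ck_continuous JG.
  by split=> // q; apply: cvgM; [exact: cF|exact: cG].
split=> [q|j]; first by apply: cvgM; [exact: cF|exact: cG].
have [F' dF' JF'] := JF.2 j; have [G' dG' JG'] := JG.2 j.
exists (fun t x => F t x * G' t x + G t x * F' t x).
  by move=> t x; exact: is_deriveM.
by apply: joint_Ck_add; apply: IH => //; exact: joint_Ck_le (leqnSn _) _.
Qed.

Lemma joint_Ck_sum (T : topologicalType) n k (I : Type) (r : seq I) (F : I -> T -> 'cV[R]_n -> R) :
  (forall i, joint_Ck k (F i)) -> joint_Ck k (fun t x => \sum_(i <- r) F i t x).
Proof.
move=> JF; elim: r => [|i r IH].
  by under eq_fun do under eq_fun do rewrite big_nil; exact: joint_Ck_cst.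
by under eq_fun do under eq_fun do rewrite big_cons; exact: joint_Ck_add.
Qed.

Lemma joint_Ck_opp (T : topologicalType) n k (F : T -> 'cV[R]_n -> R) :
  joint_Ck k F -> joint_Ck k (fun t x => - F t x).
Proof.
move=> JF; have := joint_Ck_mul (joint_Ck_cst T n k (-1)) JF.
by congr joint_Ck; apply/funext => t; apply/funext => x; rewrite mulN1r.
Qed.

Lemma joint_Ck_reparam (T T' : topologicalType) n k (F : T -> 'cV[R]_n -> R)
  (phi : T' -> T) : continuous phi -> joint_Ck k F -> joint_Ck k (fun t x => F (phi t) x).
Proof.
move=> cphi; elim: k F => [|k IH] F [cF dF].
  split=> //; apply: (continuous_app2 (F := F)) cF _ _; last by cont.
  by apply: continuous_compT => //; cont.
split=> [|j].
  apply: (continuous_app2 (F := F)) cF _ _; last by cont.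
  by apply: continuous_compT => //; cont.
by have [G dG /IH JG] := dF j; exists (fun t x => G (phi t) x).
Qed.

(** The difference quotient in direction [j], completed at [h = 0] by the candidate derivative [G].
    Its joint continuity, including at [h = 0], replaces the total differential in all that
    follows. *)
Definition dq (T : topologicalType) n (j : 'I_n) (g G : T -> 'cV[R]_n -> R)
    (t : T) (x : 'cV[R]_n) (h : R) : R :=
  if h == 0 then G t x else h^-1 * (g t (x + h *: delta_mx j 0) - g t x).

Lemma dq_mvt (T : topologicalType) n (j : 'I_n) (g G : T -> 'cV[R]_n -> R) t x h :
  (forall x, is_derive x (delta_mx j 0) (g t) (G t x)) ->
  exists2 s, 0 <= s <= 1 & dq j g G t x h = G t (x + (s * h) *: delta_mx j 0).
Proof.
move=> dg; rewrite /dq; case: eqVneq => [->|h0].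
  by exists 0; [rewrite lexx ler01|rewrite mul0r scale0r addr0].
pose f s := g t (x + (s * h) *: delta_mx j 0).
have df (s : R) : is_derive s 1 f (h * G t (x + (s * h) *: delta_mx j 0)).
  have := @is_derive_affine _ _ _ (g t) _ x (delta_mx j 0) h 0 s (dg _).
  rewrite addr0 (mulrC h s); congr is_derive.
  by apply/funext => u; rewrite /f addr0 (mulrC h u).
have [s] := @MVT R f _ 0 1 ltr01 (fun s _ => df s)
  (continuous_subspaceT (fun s => is_derive_continuous (df s))).
rewrite in_itv/= => /andP[s0 s1]; rewrite subr0 mulr1 /f mul0r scale0r addr0 mul1r.
by move=> ->; exists s; [rewrite !ltW|rewrite mulKf].
Qed.

(** Away from [h = 0] the quotient is an algebraic expression in continuous functions. At [h = 0]
    the mean value theorem turns it into a value of [G] at an unknown point of a short segment, and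
    [tube] controls [G] along the whole segment. *)
Lemma dq_continuous (T : topologicalType) n (j : 'I_n) (g G : T -> 'cV[R]_n -> R) :
  continuous (fun q : T * 'cV[R]_n => g q.1 q.2) ->
  continuous (fun q : T * 'cV[R]_n => G q.1 q.2) ->
  (forall t x, is_derive x (delta_mx j 0) (g t) (G t x)) ->
  continuous (fun q : T * 'cV[R]_n * R => dq j g G q.1.1 q.1.2 q.2).
Proof.
move=> cg cG dg -[[t0 x0] h0].
have [->|h00] := eqVneq h0 0; last first.
  have : (q.2^-1 * (g q.1.1 (q.1.2 + q.2 *: delta_mx j 0) - g q.1.1 q.1.2))
      @[q --> ((t0, x0), h0)] --> dq j g G t0 x0 h0.
    rewrite /dq (negbTE h00); apply: cvgM.
      by apply: cvgV => //; apply: cvg_snd.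
    suff H : continuous (fun q : T * 'cV[R]_n * R => g q.1.1
      (q.1.2 + q.2 *: delta_mx j 0) - g q.1.1 q.1.2) by exact: (H ((t0, x0), h0)).
    apply: continuous_add.
      by apply: (continuous_app2 (F := g)); cont.
    by apply: continuous_opp; apply: (continuous_app2 (F := g)); cont.
  apply: cvg_trans; apply: near_eq_cvg; near=> q.
  rewrite /dq ifN//; near: q.
  have nh0 : nbhs h0 [set h : R | h != 0].
    by apply: open_nbhs_nbhs; split => //; exact: open_neq.
  by exists (setT, [set h | h != 0]); [split => //; exact: filterT|move=> [? ?] []].
apply/cvgrPdist_lt => e e0.
pose P (q : T * 'cV[R]_n * R) (s : R) :=
  `|G t0 x0 - G q.1.1 (q.1.2 + (s * q.2) *: delta_mx j 0)| < e.
have H (s : R) : 0 <= s <= 1 -> \forall q \near ((t0, x0, 0 : R), s), P q.1 q.2.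
  move=> _; have : continuous (fun q : T * 'cV[R]_n * R * R =>
     G q.1.1.1 (q.1.1.2 + (q.2 * q.1.2) *: delta_mx j 0)).
    by apply: (continuous_app2 (F := G)); cont.
  move/(_ (t0, x0, 0, s))/cvgrPdist_lt/(_ _ e0).
  by rewrite /= mulr0 scale0r addr0.
have := @tube R (T * 'cV[R]_n * R)%type (t0, x0, 0) 0 1 P H; apply: filterS => -[[t x] h] /= {}H.
have [s s01 ->] := dq_mvt x h (dg t).
by rewrite {1}/dq eqxx; exact: H.
Unshelve. all: by end_near. Qed.

(** Local derivatives are glued by evaluating at [x] the one chosen for the base point [x] itself.
    By uniqueness of derivatives this diagonal function agrees near [x0] with the one chosen for
    [x0]. *)
Lemma joint_Ck_local (T : topologicalType) n k (F : T -> 'cV[R]_n -> R) :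
  (forall x0 : 'cV[R]_n, exists2 g, joint_Ck k g & \forall x \near x0, forall t, F t x = g t x) ->
  joint_Ck k F.
Proof.
have cont0 (F' : T -> 'cV[R]_n -> R) :
  (forall x0 : 'cV[R]_n, exists2 g, continuous (fun q : T * 'cV[R]_n => g q.1 q.2) &
     \forall x \near x0, forall t, F' t x = g t x) ->
  continuous (fun q : T * 'cV[R]_n => F' q.1 q.2).
  move=> HF [t0 x0]; have [g cg gF] := HF x0.
  have := cg (t0, x0); rewrite /continuous_at /= -(nbhs_singleton gF); apply: cvg_trans.
  apply: near_eq_cvg; exists (setT, [set x | forall t, F' t x = g t x]) => /=.
    by split; [exact: filterT|].
  by move=> [t x] /= [_ ->].
elim: k F => [|k IH] F HF.
  by split=> //; apply: cont0 => x0; have [g [cg _] gF] := HF x0; exists g.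
split=> [|j].
  by apply: cont0 => x0; have [g [cg _] gF] := HF x0; exists g.
have H (x0 : 'cV[R]_n) : exists G : T -> 'cV[R]_n -> R, joint_Ck k G /\
    \forall x \near x0, forall t, is_derive x (delta_mx j 0) (F t) (G t x).
  have [g [_ /(_ j)[G dG JG]] gF] := HF x0; exists G; split=> //.
  (* Differentiating at a nearby [x] needs equality on a neighbourhood of that [x], hence the
     interior. *)
  have {}gF := nbhs_interior gF.
  apply: filterS gF => x gF t; apply: (near_eq_is_derive (f := g t) _ (dG t x)).
  by apply: filterS gF => y /(_ t).
have {H} [G HG] : exists G : 'cV[R]_n -> T -> 'cV[R]_n -> R, forall x0 : 'cV[R]_n, joint_Ck k (G x0) /\
    \forall x \near x0, forall t, is_derive x (delta_mx j 0) (F t) (G x0 t x).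
  by exists (fun x0 => sval (cid (H x0))) => x0; case: (cid (H x0)).
exists (fun t x => G x t x) => [t x|].
  by have [_ /nbhs_singleton] := HG x; apply.
apply: IH => x0; exists (G x0); first by case: (HG x0).
have [_ ] := HG x0; apply: filterS => x dF t.
have [_ /nbhs_singleton/(_ t) dF'] := HG x.
exact: is_derive_unique dF' (dF t).
Qed.

Lemma dqM (T : topologicalType) n (j : 'I_n) (g G : T -> 'cV[R]_n -> R) t x h :
  dq j g G t x h * h = g t (x + h *: delta_mx j 0) - g t x.
Proof.
rewrite /dq; case: eqVneq => [->|h0]; first by rewrite mulr0 scale0r addr0 subrr.
by rewrite mulrAC mulVf// mul1r.
Qed.

(* Goes from [a] to [b] by changing one coordinate at a time. *)
Definition mixcol n (l : nat) (a b : 'cV[R]_n) : 'cV[R]_n :=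
  \col_i (if (i < l)%N then b i 0 else a i 0).

Lemma mixcolS n (l : 'I_n) (a b : 'cV[R]_n) :
  mixcol l.+1 a b = mixcol l a b + (b l 0 - a l 0) *: delta_mx l 0.
Proof.
apply/matrixP => i c; rewrite !mxE ltnS leq_eqVlt !ord1 eqxx andbT.
have [/val_inj ->|il] := eqVneq (i : nat) l.
  by rewrite ltnn eqxx /= mulr1 addrC subrK.
by rewrite /= (_ : i == l = false) ?mulr0 ?addr0//; exact/negbTE.
Qed.

(** Hadamard's lemma as a telescoping sum over the coordinates. The increment of [F] becomes linear
    in [b - a] with coefficients that stay continuous at [a = b]; this is what turns differences of
    solutions of a nonlinear equation into solutions of a linear one. *)
Lemma hadamard (T : topologicalType) n (F : T -> 'cV[R]_n -> R)
    (G : 'I_n -> T -> 'cV[R]_n -> R) t a b :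
  F t b - F t a = \sum_l dq l F (G l) t (mixcol l a b) (b l 0 - a l 0) * (b l 0 - a l 0).
Proof.
under eq_bigr => l _ do rewrite dqM -mixcolS.
rewrite -(big_mkord xpredT (fun l => F t (mixcol l.+1 a b) - F t (mixcol l a b))).
rewrite telescope_sumr//; congr (F t _ - F t _); apply/matrixP => i c; rewrite !mxE ord1.
  by rewrite ltn_ord.
by rewrite ltn0.
Qed.

Lemma mixcol_id n l (a : 'cV[R]_n) : mixcol l a a = a.
Proof. by apply/matrixP => i c; rewrite !mxE ord1; case: ifP. Qed.

Lemma continuous_mixcol (X : topologicalType) n l (a b : X -> 'cV[R]_n) :
  continuous a -> continuous b -> continuous (fun x => mixcol l (a x) (b x)).
Proof.
move=> ca cb; apply/continuous_mxP => i c; under eq_fun do rewrite mxE.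
by case: (i < l)%N; exact: continuous_coord.
Qed.

Lemma continuous_dq_mixcol (X T : topologicalType) n (l : 'I_n) (F G : T -> 'cV[R]_n -> R)
    (t : X -> T) (a b : X -> 'cV[R]_n) :
  continuous (fun q : T * 'cV[R]_n => F q.1 q.2) ->
  continuous (fun q : T * 'cV[R]_n => G q.1 q.2) ->
  (forall t x, is_derive x (delta_mx l 0) (F t) (G t x)) ->
  continuous t -> continuous a -> continuous b ->
  continuous (fun x => dq l F G (t x) (mixcol l (a x) (b x)) (b x l 0 - a x l 0)).
Proof.
move=> cF cG dF ct ca cb.
apply: (continuous_compT (dq_continuous cF cG dF)
  (f := fun x => (t x, mixcol l (a x) (b x), b x l 0 - a x l 0))).
apply: continuous_pair; last by cont.
by apply: continuous_pair => //; exact: continuous_mixcol.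
Qed.

Lemma joint_Ck_partials (T : topologicalType) n k (F : T -> 'cV[R]_n -> R) :
  joint_Ck k.+1 F -> exists G : 'I_n -> T -> 'cV[R]_n -> R, forall j, joint_Ck k (G j) /\
    forall t x, is_derive x (delta_mx j 0) (F t) (G j t x).
Proof.
move=> [_ dF]; exists (fun j => s2val (cid2 (dF j))) => j.
by case: cid2.
Qed.

(** The chain rule follows from [hadamard] divided by the step [h]: each coefficient tends to a
    partial derivative of [F], by continuity of the completed quotients. *)
Lemma joint_Ck_comp (T : topologicalType) m n k (F : T -> 'cV[R]_m -> R)
    (U : T -> 'cV[R]_n -> 'cV[R]_m) :
  joint_Ck k F -> (forall i, joint_Ck k (fun t x => U t x i 0)) -> joint_Ck k (fun t x => F t (U t x)).
Proof.
have contU k' (U' : T -> 'cV[R]_n -> 'cV[R]_m) : (forall i, joint_Ck k' (fun t x => U' t x i 0)) ->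
    continuous (fun q : T * 'cV[R]_n => U' q.1 q.2).
  by move=> JU; apply/continuous_mxP => i c; rewrite ord1; exact: joint_Ck_continuous (JU i).
elim: k F => [|k IH] F JF JU; have cU := contU _ _ JU; have cF := joint_Ck_continuous JF.
  by split=> //; apply: (continuous_app2 cF); cont.
split=> [|j]; first by apply: (continuous_app2 cF); cont.
have [G HG] := joint_Ck_partials JF.
have {}JU i : exists2 dU, (forall t x, is_derive x (delta_mx j 0) (fun x => U t x i 0) (dU t x))
    & joint_Ck k (dU : T -> 'cV[R]_n -> R) /\ joint_Ck k (fun t x => U t x i 0).
  have [_ /(_ j)[dU HdU JdU]] := JU i; exists dU => //; split=> //.
  exact: joint_Ck_le (leqnSn _) (JU i).
pose dU i := s2val (cid2 (JU i)).
have HdU i t x : is_derive x (delta_mx j 0) (fun x => U t x i 0) (dU i t x).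
  by rewrite /dU; case: cid2 => /=.
have JdU i : joint_Ck k (dU i) by rewrite /dU; case: cid2 => /= ? _ [].
have JU' i : joint_Ck k (fun t x => U t x i 0) by have [? _ []] := JU i.
exists (fun t x => \sum_l G l t (U t x) * dU l t x); last first.
  apply: joint_Ck_sum => l; apply: joint_Ck_mul => //.
  by apply: IH => //; case: (HG l).
move=> t x; apply/is_deriveP.
pose y h := U t (h *: delta_mx j 0 + x).
have cy : continuous y.
  rewrite /y; apply: (continuous_app2 (F := U) cU); first by cont.
  by cont.
have : (\sum_l dq l F (G l) t (mixcol l (U t x) (y h)) (y h l 0 - U t x l 0) *
   (h^-1 *: (y h l 0 - U t x l 0))) @[h --> (0:R)^'] --> \sum_l G l t (U t x) * dU l t x.
  apply: cvg_big => [|l _]; first exact: add_continuous.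
  apply: cvgM; last by have /is_deriveP := HdU l t x; exact.
  have [/joint_Ck_continuous cG dG] := HG l.
  have c : continuous (fun h => dq l F (G l) t (mixcol l (U t x) (y h)) (y h l 0 - U t x l 0)).
    by apply: (continuous_dq_mixcol (t := fun=> t)); cont.
  have y0 : y 0 = U t x by rewrite /y scale0r add0r.
  have := c 0; rewrite /continuous_at /= y0 mixcol_id subrr.
  rewrite (_ : dq l F (G l) t (U t x) 0 = G l t (U t x)) => [{}c|]; last by rewrite /dq eqxx.
  by apply: cvg_trans c; apply: cvg_app; exact: cvg_within.
apply: cvg_trans; apply: near_eq_cvg; near=> h.
rewrite (hadamard F G) scaler_sumr; apply: eq_bigr => l _.
by rewrite scalerAr.
Unshelve. all: by end_near. Qed.

End JointCk.

(** * Comparison principles *)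

Section Norms.
Variables (R : realType) (n : nat) (N : 'cV[R]_n -> R).
Hypothesis hN : is_norm N.

Lemma is_norm0 : N 0 = 0.
Proof. by have := norm_scale hN 0 0; rewrite scale0r normr0 mul0r. Qed.

Lemma is_normN x : N (- x) = N x.
Proof. by rewrite -scaleN1r (norm_scale hN) normrN1 mul1r. Qed.

Lemma is_norm_ge0 x : 0 <= N x.
Proof.
have := norm_triangle hN x (- x); rewrite subrr is_norm0 is_normN => H.
lra.
Qed.

Lemma is_norm_distC x y : N (x - y) = N (y - x).
Proof. by rewrite -is_normN opprB. Qed.

Lemma is_normB x y : N (x - y) <= N x + N y.
Proof. by rewrite -(is_normN y); exact: norm_triangle. Qed.

Lemma is_norm_lerB x y : N x - N y <= N (x - y).
Proof. by rewrite lerBlDr -{1}(subrK y x); exact: norm_triangle. Qed.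

Lemma is_norm_dist x y : `|N x - N y| <= N (x - y).
Proof.
by rewrite ler_norml is_norm_lerB andbT lerNl opprB is_norm_distC is_norm_lerB.
Qed.

Lemma is_norm_sum (I : Type) (r : seq I) (F : I -> 'cV[R]_n) :
  N (\sum_(i <- r) F i) <= \sum_(i <- r) N (F i).
Proof.
elim: r => [|i r IH]; first by rewrite !big_nil is_norm0.
by rewrite !big_cons (le_trans (norm_triangle hN _ _))// lerD2l.
Qed.

Lemma is_norm_upper : exists2 C, 0 < C & forall x, N x <= C * `|x|.
Proof.
exists (1 + \sum_(i < n) N (delta_mx i 0)).
  by rewrite ltr_pwDl// sumr_ge0// => i _; exact: is_norm_ge0.
move=> x; have {1}-> : x = \sum_i x i 0 *: delta_mx i 0.
  by rewrite {1}(matrix_sum_delta x); apply: eq_bigr => i _; rewrite big_ord1.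
rewrite (le_trans (is_norm_sum _ _))// mulrDl mul1r ler_wpDl// mulr_suml.
apply: ler_sum => i _; rewrite (norm_scale hN) mulrC ler_wpM2l//.
  exact: is_norm_ge0.
exact: coord_le_norm.
Qed.

Lemma is_norm_continuous : continuous N.
Proof.
have [C C0 HC] := is_norm_upper.
move=> x; apply/(@cvgrPdist_lt _ _ _ (nbhs (x : 'cV[R]_n)) (nbhs_filter x)) => e e0.
have /cvgrPdist_lt/(_ (e / C)) : y @[y --> x] --> x by exact: cvg_id.
rewrite divr_gt0// => /(_ isT); apply: filterS => y xy.
apply: (le_lt_trans (is_norm_dist _ _)); apply: (le_lt_trans (HC _)).
by rewrite mulrC -ltr_pdivlMr.
Qed.

(** [N] attains a positive minimum on the compact unit sphere of the library norm. The sphere is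
    transposed to row vectors, to which [bounded_closed_compact] applies. *)
Lemma is_norm_lower : exists2 C, 0 < C & forall x, `|x| <= C * N x.
Proof.
have [C C0 HC] := is_norm_upper.
pose S := [set v : 'rV[R]_n | `|v^T| = 1].
have ctr : continuous (fun v : 'rV[R]_n => (v^T : 'cV[R]_n)).
  apply/continuous_mxP => i j; under eq_fun do rewrite mxE.
  exact: coord_continuous.
have ntr (v : 'rV[R]_n) : `|v^T| = `|v|.
  apply/eqP; rewrite eq_le; apply/andP; split; apply/mx_norm_leP => // i j.
    by rewrite mxE; exact: coord_le_norm.
  by have := coord_le_norm v^T j i; rewrite mxE.
have cS : compact S.
  apply: bounded_closed_compact.
    exists 1; split=> // M M1 v; rewrite /S /= ntr => ->; exact: ltW.
  rewrite (_ : S = (fun v : 'rV[R]_n => `|v^T|) @^-1` [set 1])//.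
  apply: closed_comp => [v _|]; last exact: closed_eq.
  by apply: continuous_norm.
have [S0|S0] := pselect (S !=set0); last first.
  exists 1 => // x; have [->|x0] := eqVneq x 0; first by rewrite normr0 is_norm0 mulr0.
  exfalso; apply: S0; exists ((`|x|^-1 *: x)^T) => /=.
  by rewrite /S/= trmxK normrZ normfV normr_id mulVf// normr_eq0.
have cNS : {within S, continuous (fun v : 'rV[R]_n => N v^T)}.
  apply: continuous_subspaceT; apply: (continuous_compT (g := N)) => //.
  exact: is_norm_continuous.
have [v Sv Hv] := compact_EVT_min S0 cS cNS.
have Nv : 0 < N v^T.
  rewrite lt_def is_norm_ge0 andbT; apply/eqP => /(norm_eq0 hN) v0.
  by move: Sv; rewrite inE /S /= v0 normr0 => /eqP; rewrite eq_sym oner_eq0.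
exists (N v^T)^-1; first by rewrite invr_gt0.
move=> x; have [->|x0] := eqVneq x 0; first by rewrite normr0 is_norm0 mulr0.
have xp : 0 < `|x| by rewrite normr_gt0.
have := Hv (`|x|^-1 *: x)^T; rewrite trmxK (norm_scale hN) normfV normr_id.
rewrite inE /S/= trmxK normrZ normfV normr_id mulVf ?gt_eqF// => /(_ erefl) H.
by rewrite mulrC ler_pdivlMr// mulrC -ler_pdivlMr// mulrC.
Qed.

(* A comparison principle for an arbitrary norm: at the first time where
   [N u = phi], the left difference quotients give [dphi <= N du]. *)
Lemma first_crossing (u du : R -> 'cV[R]_n) (phi dphi : R -> R) (a b : R) :
  continuous u -> continuous phi ->
  (forall s, a < s <= b -> is_derive s 1 u (du s)) ->
  (forall s, a < s <= b -> is_derive s 1 phi (dphi s)) ->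
  N (u a) < phi a ->
  (forall s, a < s <= b -> N (u s) = phi s -> N (du s) < dphi s) ->
  forall s, a <= s <= b -> N (u s) < phi s.
Proof.
move=> cu cphi du_ dphi_ Na H s1 /andP[as1 s1b]; rewrite ltNge; apply/negP => gs1.
have cN := is_norm_continuous.
pose g s := phi s - N (u s).
have cg : continuous g.
  by apply: continuous_add => //; apply: continuous_opp; exact: (continuous_compT (g := N)).
pose S := [set s | a <= s <= s1 /\ g s <= 0].
have S1 : S s1 by rewrite /S /= as1 lexx subr_le0.
have Slb : lbound S a by move=> s [/andP[]].
have hS : has_inf S by split; [exists s1|exists a].
pose c := inf S.
have ac : a <= c by apply: lb_le_inf => //; exists s1.
have cs1 : c <= s1 by apply: ge_inf => //; exists a.
have gc0 : g c <= 0.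
  rewrite leNgt; apply/negP => gc.
  have [e /= e0 He] := (cvgr_gt (g c) (cg c) _ gc : \forall s \near c, 0 < g s).
  have [s [/andP[as_ ss1] gs] sc] := inf_adherent e0 hS.
  have cs : c <= s by apply: ge_inf; [exists a|rewrite /S /= as_ ss1].
  have Hs : `|c - s| < e by rewrite distrC ger0_norm ?subr_ge0// ltrBlDl.
  by have := He s Hs; rewrite /= ltNge gs.
have {}ac : a < c.
  rewrite lt_def ac andbT; apply/eqP => ca; move: gc0; rewrite ca.
  by rewrite leNgt subr_gt0 Na.
have gpos s : a <= s < c -> 0 < g s.
  move=> /andP[as_ sc]; rewrite ltNge; apply/negP => gs.
  have : c <= s by apply: ge_inf; [exists a|rewrite /S /= as_ gs (le_trans (ltW sc))].
  by rewrite leNgt sc.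
have cb : a < c <= b by rewrite ac (le_trans cs1).
(* A strictly negative [g c] would make [g] negative just before [c], against [gpos]; so the barrier
   is touched exactly. *)
have gc : N (u c) = phi c.
  apply/eqP; rewrite eq_sym -subr_eq0 eq_le gc0 /= leNgt; apply/negP => gc.
  have [e /= e0 He] := (cvgr_lt (g c) (cg c) _ gc : \forall s \near c, g s < 0).
  pose h := Num.min (e / 2) ((c - a) / 2).
  have h0 : 0 < h by rewrite lt_min !divr_gt0// subr_gt0.
  have hc : h < c - a.
    by rewrite gt_min; apply/orP; right; rewrite ltr_pdivrMr// mulrDr mulr1 ltrDl subr_gt0.
  have he : h < e by rewrite gt_min; apply/orP; left; rewrite ltr_pdivrMr// mulrDr mulr1 ltrDl.
  have := He (c - h); rewrite /= opprB addrC subrK gtr0_norm// => /(_ he).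
  rewrite ltNge ltW// gpos// gtrDl oppr_lt0 h0 andbT.
  by rewrite lerBrDr -lerBrDl ltW.
have := H c cb gc; apply/negP; rewrite -leNgt leNgt; apply/negP => Hc.
have /is_deriveP Du := du_ c cb; have /is_deriveP Dphi := dphi_ c cb.
have : (h^-1 *: (phi (h *: (1 : R) + c) - phi c) - N (h^-1 *: (u (h *: (1:R) + c) - u c)))
   @[h --> (0:R)^'] --> dphi c - N (du c).
  by apply: cvgB Dphi _; apply: (cvg_comp _ _ Du); exact: cN.
move/cvgr_gt => /(_ 0); rewrite subr_gt0 => /(_ Hc) [e /= e0 He].
pose h := Num.min (e / 2) ((c - a) / 2).
have h0 : 0 < h by rewrite lt_min !divr_gt0// subr_gt0.
have hc : h < c - a.
  by rewrite gt_min; apply/orP; right; rewrite ltr_pdivrMr// mulrDr mulr1 ltrDl subr_gt0.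
have he : h < e by rewrite gt_min; apply/orP; left; rewrite ltr_pdivrMr// mulrDr mulr1 ltrDl.
have := He (- h); rewrite /= sub0r opprK gtr0_norm// => /(_ he).
rewrite oppr_eq0 gt_eqF// => /(_ isT); rewrite [_ *: 1]mulr1 addrC.
rewrite (norm_scale hN) invrN normrN gtr0_norm ?invr_gt0//.
rewrite scaleNr -scalerN opprB => Hq.
have {Hq} : 0 < h^-1 * ((phi c - phi (- h + c)) - N (u (- h + c) - u c)).
  by rewrite mulrBr addrC; move: Hq; rewrite addrC.
rewrite pmulr_rgt0 ?invr_gt0// -gc.
rewrite subr_gt0 is_norm_distC ltNge => /negP; apply.
apply: le_trans (is_norm_lerB _ _); rewrite lerD2l lerN2.
rewrite -subr_ge0 ltW//; apply: gpos.
by rewrite gtrDr oppr_lt0 h0 andbT addrC lerBrDr -lerBrDl ltW.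
Qed.

End Norms.

(** * Mean value and Gronwall inequalities for an arbitrary norm *)

Section Estimates.
Variable R : realType.

(** [first_crossing] needs strict inequalities; the comparison lemmas raise the barrier by [d] times
    a positive quantity and let [d] tend to 0 through this lemma. *)
Lemma le_of_le_mul (a b c : R) : (forall d, 0 < d -> a <= b + d * c) -> a <= b.
Proof.
move=> H; apply/ler_addgt0Pr => e e0.
have c1 : 0 < 1 + `|c| by rewrite ltr_pwDl.
have := H (e / (1 + `|c|)); rewrite divr_gt0// => /(_ isT) /le_trans; apply.
rewrite lerD2l (le_trans (ler_norm _))// normrM gtr0_norm ?divr_gt0//.
by rewrite mulrAC ler_pdivrMr// ler_pM2l// lerDr.
Qed.

Lemma normr_is_norm n : is_norm (fun x : 'cV[R]_n => `|x|).
Proof. by split; [exact: normr0_eq0|exact: normrZ|exact: ler_normD]. Qed.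

Lemma is_derive_exp_affine (c l a s : R) :
  is_derive s 1 (fun s => c * expR (l * (s - a))) (l * (c * expR (l * (s - a)))).
Proof.
have -> : (fun s => c * expR (l * (s - a))) = c \*: (fun s => expR (l * s + - (l * a))).
  by apply/funext => r; rewrite mulrBr.
have := is_deriveZ c (@is_derive_reparam R _ expR _ l (- (l * a)) s (is_derive_expR _)).
by congr is_derive; rewrite -mulrBr [LHS]mulrCA.
Qed.

Lemma is_deriveS (n : nat) (u : R -> 'cV[R]_n) (s : R) du (b : R) :
  is_derive (b - s) 1 u du -> is_derive s 1 (fun s => u (b - s)) (- du).
Proof.
move=> H; have := @is_derive_reparam R _ u du (-1) b s; rewrite mulN1r addrC => /(_ H).
rewrite scaleN1r; congr is_derive; apply/funext => r; by rewrite mulN1r addrC.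
Qed.

Section WithNorm.
Variables (n : nat) (N : 'cV[R]_n -> R).
Hypothesis hN : is_norm N.

Lemma mean_value_ineq (u du : R -> 'cV[R]_n) (phi dphi : R -> R) (a b : R) :
  continuous u -> continuous phi ->
  (forall s, a < s <= b -> is_derive s 1 u (du s)) ->
  (forall s, a < s <= b -> is_derive s 1 phi (dphi s)) ->
  N (u a) <= phi a ->
  (forall s, a < s <= b -> N (du s) <= dphi s) ->
  forall s, a <= s <= b -> N (u s) <= phi s.
Proof.
move=> cu cphi du_ dphi_ ua H s sab.
apply: (@le_of_le_mul _ _ (1 + (s - a))) => d d0.
(* Both the initial value and the slope of the barrier are raised by [d], so that both hypotheses
   become strict. *)
pose psi r := phi r + d * (1 + (r - a)).
have dl (r : R) : is_derive r 1 (fun r => d * (1 + (r - a))) d.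
  have -> : (fun r => d * (1 + (r - a))) = (fun r => d * r + d * (1 - a)).
    by apply/funext => x; ring.
  have := @is_derive_reparam R _ id 1 d (d * (1 - a)) r (is_derive_id _ _).
  by rewrite [_ *: _]mulr1.
apply/ltW/(@first_crossing R n N hN u du psi (fun r => dphi r + d) a b) => //.
- apply: continuous_add => //.
  by move=> r; exact: is_derive_continuous (dl r).
- by move=> r /dphi_ Hr; exact: (is_deriveD Hr (dl r)).
- by rewrite /psi subrr addr0 mulr1 ltr_pwDr.
- by move=> r rab _; rewrite (le_lt_trans (H r rab))// ltrDl.
Qed.

(** The rate [L + 1] absorbs the constant [e] without a division by [L]: a barrier psi growing at
    that rate from above [c + e] satisfies psi' = L psi + psi > L psi + e. *)
Lemma gronwall (u du : R -> 'cV[R]_n) (L e c a b : R) :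
  0 <= L -> 0 <= e ->
  continuous u ->
  (forall s, a < s <= b -> is_derive s 1 u (du s)) ->
  N (u a) <= c ->
  (forall s, a < s <= b -> N (du s) <= L * N (u s) + e) ->
  forall s, a <= s <= b -> N (u s) <= (c + e) * expR ((L + 1) * (s - a)).
Proof.
move=> L0 e0 cu du_ ua H s sab.
apply: (@le_of_le_mul _ _ (expR ((L + 1) * (s - a)))) => d d0.
rewrite -mulrDl.
pose psi r := (c + e + d) * expR ((L + 1) * (r - a)).
have c0 : 0 <= c by rewrite (le_trans _ ua)// is_norm_ge0.
apply/ltW/(@first_crossing R n N hN u du psi (fun r => (L + 1) * psi r) a b) => //.
- by move=> r; exact: is_derive_continuous (is_derive_exp_affine _ _ _ _).
- by move=> r _; exact: is_derive_exp_affine.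
- by rewrite /psi subrr mulr0 expR0 mulr1 -addrA (le_lt_trans ua)// ltrDl ltr_wpDl.
move=> r rab Er; rewrite (le_lt_trans (H r rab))// Er mulrDl mul1r ltrD2l.
have /andP[ar _] := rab.
have E1 : 1 <= expR ((L + 1) * (r - a)).
  by rewrite -expR0 ler_expR; apply: mulr_ge0; [rewrite addr_ge0|rewrite subr_ge0 ltW].
rewrite (@lt_le_trans _ _ (c + e + d))//; first by rewrite addrAC ltrDr ltr_wpDl.
by rewrite /psi ler_peMr// !addr_ge0// ltW.
Qed.

Lemma gronwall_sym (u du : R -> 'cV[R]_n) (L e c T : R) :
  0 <= L -> 0 <= e ->
  (forall s : R, is_derive s 1 u (du s)) ->
  N (u 0) <= c ->
  (forall s, `|s| <= T -> N (du s) <= L * N (u s) + e) ->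
  forall s, `|s| <= T -> N (u s) <= (c + e) * expR ((L + 1) * `|s|).
Proof.
move=> L0 e0 du_ u0 H s sT.
have T0 : 0 <= T by exact: le_trans sT.
have [s0|s0] := leP 0 s.
  rewrite ger0_norm// -[X in _ * expR (_ * X)](subr0 s).
  apply: (@gronwall u du L e c 0 T) => //; first by move=> r; exact: is_derive_continuous (du_ r).
    by move=> r /andP[r0 rT]; apply: H; rewrite ger0_norm// ltW.
  by rewrite s0 -(ger0_norm s0).
rewrite ltr0_norm// -[X in _ * expR (_ * X)](subr0 (- s)) -[in leLHS](opprK s).
have dv (r : R) : is_derive r 1 (fun r => u (- r)) (- du (- r)).
  by have := @is_deriveS n u r (du (- r)) 0; rewrite sub0r => /(_ (du_ _)); under eq_fun do rewrite sub0r.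
apply: (@gronwall (fun r => u (- r)) (fun r => - du (- r)) L e c 0 T) => //.
- by move=> r; exact: is_derive_continuous (dv r).
- by rewrite oppr0.
- by move=> r /andP[r0 rT]; rewrite is_normN//; apply: H; rewrite normrN ger0_norm// ltW.
- by rewrite oppr_ge0 (ltW s0) -(ltr0_norm s0).
Qed.

Lemma mean_value_sym (u du : R -> 'cV[R]_n) (phi dphi : R -> R) (T : R) :
  (forall s : R, is_derive s 1 u (du s)) -> (forall s : R, is_derive s 1 phi (dphi s)) ->
  N (u 0) <= phi 0 ->
  (forall s, `|s| <= T -> N (du s) <= dphi `|s|) ->
  forall s, `|s| <= T -> N (u s) <= phi `|s|.
Proof.
move=> du_ dphi_ u0 H s sT.
have T0 : 0 <= T by exact: le_trans sT.
have cphi : continuous phi by move=> r; exact: is_derive_continuous (dphi_ r).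
have [s0|s0] := leP 0 s.
  rewrite ger0_norm//.
  apply: (@mean_value_ineq u du phi dphi 0 T) => //.
    by move=> r; exact: is_derive_continuous (du_ r).
    by move=> r /andP[r0 rT]; rewrite -{2}(gtr0_norm r0); apply: H; rewrite gtr0_norm.
  by rewrite s0 -(ger0_norm s0).
rewrite ltr0_norm// -[in leLHS](opprK s).
have dv (r : R) : is_derive r 1 (fun r => u (- r)) (- du (- r)).
  by have := @is_deriveS n u r (du (- r)) 0; rewrite sub0r => /(_ (du_ _)); under eq_fun do rewrite sub0r.
apply: (@mean_value_ineq (fun r => u (- r)) (fun r => - du (- r)) phi dphi 0 T) => //.
- by move=> r; exact: is_derive_continuous (dv r).
- by rewrite oppr0.
- move=> r /andP[r0 rT]; rewrite is_normN// -{2}(gtr0_norm r0) -normrN.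
  by apply: H; rewrite normrN gtr0_norm.
- by rewrite oppr_ge0 (ltW s0) -(ltr0_norm s0).
Qed.

End WithNorm.
End Estimates.

(** * Ordinary differential equations *)

Section Primitive.
Variable R : realType.

(** The integral starts at -1, so that the derivative at 0 is two-sided. *)
Lemma right_primitive (g : R -> R) : continuous g ->
  exists2 G : R -> R, G 0 = 0 & forall s : R, -1 < s -> is_derive s 1 G (g s).
Proof.
move=> cg.
pose P x := \int[lebesgue_measure]_(t in `[-1, x]) g t.
exists (fun x => P x - P 0); first by rewrite subrr.
move=> s s1.
have [Ps dP] : derivable P s 1 /\ P^`()%classic s = g s.
  apply: (@continuous_FTC1_closed R g (-1) s (s + 1)) => //; [by rewrite ltrDl| |exact: cg].
  apply: continuous_compact_integrable; first exact: segment_compact.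
  exact: continuous_subspaceT.
have H : is_derive s 1 P (g s) by apply: DeriveDef => //; rewrite -derive1E.
by have := is_deriveB H (is_derive_cst (P 0) s 1); rewrite subr0.
Qed.

(** A right primitive of [g] is glued to the reflection of a right primitive of the reflected
    function. Both have derivative [g] on ]-1, 1[ and vanish at 0, so they agree there. *)
Lemma primitive (g : R -> R) : continuous g ->
  exists2 G : R -> R, G 0 = 0 & forall s : R, is_derive s 1 G (g s).
Proof.
move=> cg.
have [P P0 dP] := right_primitive cg.
have [Q Q0 dQ] : exists2 G : R -> R, G 0 = 0 & forall s : R, -1 < s -> is_derive s 1 G (g (- s)).
  apply: (@right_primitive (fun s => g (- s))).
  by apply: (continuous_compT cg (f := fun s => - s)); cont.
have dQ' (s : R) : s < 1 -> is_derive s 1 (fun s => - Q (- s)) (g s).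
  move=> s1; pose z : R := -1 * s + 0.
  have zE : z = - s by rewrite /z addr0 mulN1r.
  have H : is_derive z 1 Q (g s).
    by rewrite zE -[X in g X](opprK s); apply: dQ; rewrite ltrN2.
  have := is_deriveN (is_derive_reparam H); rewrite scaleN1r opprK.
  congr is_derive; apply/funext => r; change (- Q (-1 * r + 0) = - Q (- r)).
  by rewrite addr0 mulN1r.
have PQ s : -1 < s < 1 -> P s = - Q (- s).
  move=> /andP[s1 s2]; pose D r := P r - - Q (- r).
  have dD (r : R) : -1 < r < 1 -> is_derive r 1 D 0.
    move=> /andP[r1 r2]; rewrite -(subrr (g r)).
    exact: (is_deriveB (dP r r1) (dQ' r r2)).
  have cD (r : R) : -1 < r < 1 -> {for r, continuous D} by move=> /dD Dr; exact: is_derive_continuous Dr.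
  apply/eqP; rewrite -subr_eq0 -/(D s).
  have D0 : D 0 = 0 by rewrite /D oppr0 P0 Q0 oppr0 subrr.
  rewrite -[D s]subr0 -[X in _ - X]D0; have [s0|s0] := leP 0 s.
    have [|||c _ ->] := @MVT_segment R D (fun=> 0) 0 s => //; last by rewrite mul0r.
      move=> x; rewrite in_itv/= => /andP[x0 xs].
      by apply: dD; rewrite (lt_trans _ x0)//= (lt_trans xs).
    apply: continuous_in_subspaceT => x; rewrite inE/= in_itv/= => /andP[x0 xs].
    by apply: cD; rewrite (lt_le_trans _ x0)//= (le_lt_trans xs).
  rewrite -oppr_eq0 opprB.
  have [|||c _ ->] := @MVT_segment R D (fun=> 0) s 0 => //; last by rewrite mul0r.
  - exact: ltW.
  - move=> x; rewrite in_itv/= => /andP[xs x0].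
    by apply: dD; rewrite (lt_trans s1)//= (lt_trans x0).
  apply: continuous_in_subspaceT => x; rewrite inE/= in_itv/= => /andP[xs x0].
  by apply: cD; rewrite (lt_le_trans s1)//= (le_lt_trans x0).
exists (fun s => if 0 <= s then P s else - Q (- s)); first by rewrite lexx.
move=> s; have [s1|s1] := leP 1 s.
  apply: (near_eq_is_derive _ (dP s _)); last by rewrite (lt_le_trans _ s1)// ltrN10.
  have : \forall y \near s, 0 < y by apply: lt_nbhsr; rewrite (lt_le_trans _ s1).
  by apply: filterS => y y0; rewrite ltW.
have [s2|s2] := leP s (-1).
  apply: (near_eq_is_derive _ (dQ' s s1)).
  have : \forall y \near s, y < 0 by apply: lt_nbhsl; rewrite (le_lt_trans s2)// ltrN10.
  by apply: filterS => y y0; rewrite leNgt y0.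
apply: (near_eq_is_derive _ (dP s s2)).
have : \forall y \near s, -1 < y < 1.
  near=> y; apply/andP; split; near: y; [exact: lt_nbhsr|exact: lt_nbhsl].
by apply: filterS => y /PQ ->; case: ifP.
Unshelve. all: by end_near. Qed.

Lemma primitive_vec n (g : R -> 'cV[R]_n) : continuous g ->
  exists2 G : R -> 'cV[R]_n, G 0 = 0 & forall s : R, is_derive s 1 G (g s).
Proof.
move=> cg.
have H i : exists2 G : R -> R, G 0 = 0 & forall s : R, is_derive s 1 G (g s i 0).
  by apply: primitive; cont.
pose G i := s2val (cid2 (H i)).
have G0 i : G i 0 = 0 by rewrite /G; case: cid2.
have dG i (s : R) : is_derive s 1 (G i) (g s i 0) by rewrite /G; case: cid2.
exists (fun s => \col_i G i s); first by apply/matrixP => i j; rewrite !mxE.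
move=> s; apply/is_derive_mxP => i j; rewrite ord1.
by have := dG i s; congr is_derive; apply/funext => r; rewrite mxE.
Qed.

End Primitive.

(** * Sequences with geometrically small steps *)

Section Geometric.
Variable R : realType.

Lemma geometric_step (n : nat) (u : nat -> 'cV[R]_n) (c : R) :
  (forall k, `|u k.+1 - u k| <= c * 2^-1 ^+ k) ->
  forall k m, `|u (k + m)%N - u k| <= 2 * c * 2^-1 ^+ k.
Proof.
move=> H k m; have c0 : 0 <= c by have := le_trans (normr_ge0 _) (H 0); rewrite expr0 mulr1.
have p0 j : 0 <= 2^-1 ^+ j :> R by rewrite exprn_ge0// invr_ge0.
(* The right-hand side is the exact partial sum of the geometric series, for which the induction
   closes. *)
suff : `|u (k + m)%N - u k| <= 2 * c * 2^-1 ^+ k - 2 * c * 2^-1 ^+ (k + m).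
  by move=> /le_trans; apply; rewrite gerBl !mulr_ge0.
elim: m => [|m IH]; first by rewrite addn0 !subrr normr0.
rewrite -(subrKA (u (k + m)%N)) (le_trans (ler_normD _ _))//.
have := lerD (H (k + m)%N) IH; rewrite addnS => /le_trans; apply.
rewrite exprS; have := p0 (k + m)%N; set x := _ ^+ (k + m); set y := _ ^+ k => _.
by rewrite le_eqVlt; apply/orP; left; apply/eqP; field.
Qed.

Lemma geometric_cvg (n : nat) (u : nat -> 'cV[R]_n) (c : R) :
  (forall k, `|u k.+1 - u k| <= c * 2^-1 ^+ k) ->
  exists l, forall k, `|l - u k| <= 2 * c * 2^-1 ^+ k.
Proof.
move=> H; have Hs := geometric_step H.
have c0 : 0 <= c by have := le_trans (normr_ge0 _) (H 0); rewrite expr0 mulr1.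
have small (e : R) : 0 < e -> exists k, 2 * c * 2^-1 ^+ k < e.
  move=> e0; have : (2 * c * (2^-1 : R) ^+ k) @[k --> \oo] --> 2 * c * 0.
    apply: cvgM; first exact: cvg_cst.
    by apply: cvg_expr; rewrite gtr0_norm ?invr_gt0// invf_lt1// ltr1n.
  rewrite mulr0 => /cvgr_lt/(_ e e0) [k _ Hk]; exists k; exact: (Hk k (leqnn k)).
have C i : cvg (u k i 0 @[k --> \oo]).
  apply: cauchy_cvg; apply: cauchy_exP => e e0; have [k Hk] := small e e0.
  exists (u k i 0); exists k => // m /= km.
  change (`|u k i 0 - u m i 0| < e).
  rewrite distrC (le_lt_trans _ Hk)// -(subnKC km).
  by apply: le_trans (Hs k (m - k)%N); have := coord_le_norm (u (k + (m - k))%N - u k) i 0; rewrite !mxE.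
exists (\col_i lim (u k i 0 @[k --> \oo])) => k.
apply/ler_addgt0Pr => e e0.
have : \forall m \near \oo, `|(\col_i lim (u k i 0 @[k --> \oo])) - u m| <= e.
  have : (u m @[m --> \oo]) --> \col_i lim (u k i 0 @[k --> \oo]).
    by apply/cvg_mxP => i j; rewrite mxE ord1; exact: C.
  by move/cvgrPdist_le; apply.
move=> [m0 _ /(_ (k + m0)%N (leq_addl _ _))] Hm.
rewrite -(subrKA (u (k + m0)%N)) (le_trans (ler_normD _ _))// addrC lerD//.
Qed.

Lemma geometric_unique (n : nat) (x : 'cV[R]_n) (c : R) :
  (forall k, `|x| <= c * 2^-1 ^+ k) -> x = 0.
Proof.
move=> H; apply/eqP; rewrite -normr_le0.
have : (c * (2^-1 : R) ^+ k) @[k --> \oo] --> c * 0.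
  apply: cvgM; first exact: cvg_cst.
  by apply: cvg_expr; rewrite gtr0_norm ?invr_gt0// invf_lt1// ltr1n.
rewrite mulr0 => Hc; apply/ler_addgt0Pr => e e0; rewrite add0r.
move/cvgr_lt : Hc => /(_ e e0)[k _ Hk]; rewrite (le_trans (H k))// ltW//.
exact: (Hk k (leqnn k)).
Qed.

End Geometric.

(** * Uniqueness and global existence for Lipschitz equations *)

Section ODE.
Variable R : realType.

Lemma bounded_on_segment (L : R -> R) (T : R) : continuous L ->
  exists2 M, 0 <= M & forall s, `|s| <= T -> L s <= M.
Proof.
move=> cL; have [T0|T0] := leP 0 T; last first.
  by exists 0 => // s /le_lt_trans/(_ T0); rewrite ltNge normr_ge0.
have [|c _ Hc] := @EVT_max R L (- T) T _ (continuous_subspaceT cL).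
  by rewrite (le_trans _ T0)// oppr_le0.
exists (Num.max 0 (L c)); first by rewrite le_max lexx.
by move=> s; rewrite ler_norml => sT; rewrite le_max Hc ?orbT// in_itv.
Qed.

Section Fixed.
Variables (n : nat) (F : R -> 'cV[R]_n -> 'cV[R]_n) (L : R -> R).
Hypothesis cF : continuous (fun q : R * 'cV[R]_n => F q.1 q.2).
Hypothesis cL : continuous L.
Hypothesis FL : forall s y y', `|F s y - F s y'| <= L s * `|y - y'|.

Lemma ode_unique (y z : R -> 'cV[R]_n) :
  (forall s : R, is_derive s 1 y (F s (y s))) ->
  (forall s : R, is_derive s 1 z (F s (z s))) -> y 0 = z 0 -> y =1 z.
Proof.
move=> dy dz yz s; have [M M0 HM] := bounded_on_segment `|s| cL.
apply/eqP; rewrite -subr_eq0 -normr_le0.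
rewrite -[leRHS](mul0r (expR ((M + 1) * `|s|))) -[X in X * _](addr0 0).
apply: (@gronwall_sym R n _ (@normr_is_norm R n) (y - z)
  (fun s => F s (y s) - F s (z s)) M 0 0 `|s|) => //.
- by rewrite [X in `|X|](_ : _ = 0) ?normr0//; apply/eqP; rewrite subr_eq0 yz.
- by move=> r rs; rewrite addr0 (le_trans (FL _ _ _))// ler_wpM2r// HM.
Qed.

Lemma ode_unique_half_line (y z : R -> 'cV[R]_n) :
  continuous y -> continuous z ->
  (forall s : R, 0 < s -> is_derive s 1 y (F s (y s))) ->
  (forall s : R, 0 < s -> is_derive s 1 z (F s (z s))) -> y 0 = z 0 ->
  forall s, 0 <= s -> y s = z s.
Proof.
move=> cy cz dy dz yz s s0; have [M M0 HM] := bounded_on_segment `|s| cL.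
apply/eqP; rewrite -subr_eq0 -normr_le0.
rewrite -[leRHS](mul0r (expR ((M + 1) * (s - 0)))) -[X in X * _](addr0 0).
apply: (@gronwall R n _ (@normr_is_norm R n) (y - z)
  (fun s => F s (y s) - F s (z s)) M 0 0 0 s) => //; last by rewrite s0 lexx.
- by apply: continuous_add => //; exact: continuous_opp.
- by move=> r /andP[r0 _]; apply: is_deriveB; [exact: dy|exact: dz].
- by rewrite [X in `|X|](_ : _ = 0) ?normr0//; apply/eqP; rewrite subr_eq0 yz.
- move=> r /andP[r0 rs]; rewrite addr0 (le_trans (FL _ _ _))// ler_wpM2r// HM//.
  by rewrite !ger0_norm// ltW.
Qed.

(** Picard iteration measured with an exponential weight: a weight of rate at least twice the
    Lipschitz constant gains a factor 1/2 per iteration on any window, however long, so the solution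
    is global without continuation arguments. *)
Lemma picard (y0 : 'cV[R]_n) : exists2 y : R -> 'cV[R]_n, y 0 = y0 &
  forall s : R, is_derive s 1 y (F s (y s)).
Proof.
(* A chosen primitive vanishing at 0; the default value [g] is never met for continuous [g], by
   [HPr]. *)
pose Pr (g : R -> 'cV[R]_n) := xget g [set G | G 0 = 0 /\ forall s : R, is_derive s 1 G (g s)].
have HPr g : continuous g -> Pr g 0 = 0 /\ forall s : R, is_derive s 1 (Pr g) (g s).
  move=> cg; apply: (@xgetPex _ g [set G | G 0 = 0 /\ forall s : R, is_derive s 1 G (g s)]).
  by have [G G0 dG] := primitive_vec cg; exists G.
have cFy y : continuous y -> continuous (fun s => F s (y s)).
  by move=> cy; apply: (continuous_app2 cF) => //; cont.
pose step (y : R -> 'cV[R]_n) (s : R) := y0 + Pr (fun s => F s (y s)) s.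
have step0 y : continuous y -> step y 0 = y0.
  by move=> /cFy/HPr[P0 _]; rewrite /step P0 addr0.
have dstep y (s : R) : continuous y -> is_derive s 1 (step y) (F s (y s)).
  move=> /cFy/HPr[_ /(_ s) dP].
  by have := is_deriveD (is_derive_cst y0 s 1) dP; rewrite add0r.
pose it k := iter k step (cst y0).
have cit k : continuous (it k).
  elim: k => [|k IH]; first exact: cst_continuous.
  by move=> s; exact: is_derive_continuous (dstep _ _ IH).
have it0 k : it k 0 = y0 by case: k => // k; rewrite /it iterS step0//; exact: cit.
have dit k (s : R) : is_derive s 1 (it k.+1) (F s (it k s)) by exact: dstep.
have key T : exists c, forall k s, `|s| <= T -> `|it k.+1 s - it k s| <= c * 2^-1 ^+ k.
  have [M M0 HM] := bounded_on_segment T cL.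
  have [B B0 HB] := bounded_on_segment T (continuous_norm (cFy _ (@cst_continuous _ _ y0))).
  (* [M <= l / 2] yields the factor 1/2 at each iteration, and [1 <= l] settles the first one. *)
  pose l := 2 * M + 1; pose phi k (s : R) := B * 2^-1 ^+ k * expR (l * (s - 0)).
  have l0 : 0 <= l by rewrite addr_ge0// mulr_ge0.
  have p0 j : 0 <= 2^-1 ^+ j :> R by rewrite exprn_ge0// invr_ge0.
  have H k s : `|s| <= T -> `|it k.+1 s - it k s| <= phi k `|s|.
    elim: k s => [|k IH] s sT.
      apply: (@mean_value_sym R n _ (@normr_is_norm R n) (it 1 - it 0)
        (fun s => F s y0) (phi 0) (fun s => l * phi 0 s) T) => //.
      - move=> r; have := is_deriveB (dit 0 r) (is_derive_cst y0 r 1).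
        by rewrite subr0.
      - by move=> r; exact: is_derive_exp_affine.
      - rewrite [X in `|X|](_ : _ = 0) ?normr0; last by apply/eqP; rewrite subr_eq0 !it0.
        by rewrite /phi !mulr_ge0// expR_ge0.
      - move=> r rT; rewrite (le_trans (HB r rT))// /phi expr0 mulr1 subr0 mulrCA ler_peMr//.
        have : 1 <= expR (l * `|r|) by rewrite -expR0 ler_expR mulr_ge0.
        move=> E1; rewrite (le_trans E1)// ler_peMl ?expR_ge0// /l lerDr mulr_ge0//.
    apply: (@mean_value_sym R n _ (@normr_is_norm R n) (it k.+2 - it k.+1)
        (fun s => F s (it k.+1 s) - F s (it k s)) (phi k.+1) (fun s => l * phi k.+1 s) T) => //.
    - by move=> r; exact: is_derive_exp_affine.
    - rewrite [X in `|X|](_ : _ = 0) ?normr0; last by apply/eqP; rewrite subr_eq0 !it0.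
      by rewrite /phi !mulr_ge0// expR_ge0.
    - move=> r rT; rewrite (le_trans (FL _ _ _))//.
      apply: (le_trans (ler_wpM2r (normr_ge0 _) (HM r rT))).
      apply: (le_trans (ler_wpM2l M0 (IH r rT))).
      rewrite /phi exprS; set x := 2^-1 ^+ k; set e := expR _.
      have -> : l * (B * (2^-1 * x) * e) = (l / 2) * (B * x * e) by ring.
      rewrite ler_wpM2r ?mulr_ge0 ?expR_ge0 ?p0//.
      by rewrite /l; lra.
  exists (B * expR (l * T)) => k s sT; rewrite (le_trans (H k s sT))//.
  by rewrite /phi subr0 mulrAC ler_wpM2r// ler_wpM2l// ler_expR ler_wpM2l.
(* The constant in [key] depends on the window [T]. Uniqueness of limits lets one limit satisfy the
   estimates of all windows at once. *)
have lims s : exists y, forall T, `|s| <= T -> forall c,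
    (forall k s, `|s| <= T -> `|it k.+1 s - it k s| <= c * 2^-1 ^+ k) ->
    forall k, `|y - it k s| <= 2 * c * 2^-1 ^+ k.
  have [c Hc] := key `|s|.
  have [y Hy] := geometric_cvg (fun k => Hc k s (lexx _)).
  exists y => T sT c' Hc'.
  have [y' Hy'] := geometric_cvg (fun k => Hc' k s sT).
  suff -> : y = y' by [].
  apply/eqP; rewrite -subr_eq0; apply/eqP.
  apply: (@geometric_unique _ _ _ (2 * c + 2 * c')) => k.
  rewrite -(subrKA (it k s)) (le_trans (ler_normD _ _))// mulrDl lerD//.
  by rewrite distrC.
pose y s := sval (cid (lims s)).
have Hy T : exists2 c, 0 <= c & forall k s, `|s| <= T -> `|y s - it k s| <= c * 2^-1 ^+ k.
  have [c Hc] := key T; exists (2 * `|c|); first by rewrite mulr_ge0.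
  move=> k s sT; rewrite /y; case: cid => /= z Hz.
  apply: (Hz T sT) => {}k r rT; apply: (le_trans (Hc _ _ rT)).
  by rewrite ler_wpM2r ?ler_norm// exprn_ge0// invr_ge0.
have cy : continuous y.
  move=> s0; apply/cvgrPdist_le => e e0.
  have [c c0 Hc] := Hy (`|s0| + 1).
  have [k Hk] : exists k, c * (2^-1 : R) ^+ k < e / 3.
    have : (c * (2^-1 : R) ^+ k) @[k --> \oo] --> c * 0.
      apply: cvgM; first exact: cvg_cst.
      by apply: cvg_expr; rewrite gtr0_norm ?invr_gt0// invf_lt1// ltr1n.
    rewrite mulr0 => /cvgr_lt/(_ (e / 3)); rewrite divr_gt0// => /(_ isT)[k _ Hk].
    by exists k; exact: (Hk k (leqnn k)).
  have e3 : 0 < e / 3 by rewrite divr_gt0.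
  have := cit k s0; move/cvgrPdist_le => /(_ _ e3) Hs.
  have Hn : \forall s \near s0, `|s0 - s| <= 1.
    by have /cvgrPdist_le := @cvg_id _ (nbhs s0); apply.
  apply: filterS2 Hs Hn => s s2 ss0.
  have s1 : `|s| <= `|s0| + 1.
    by rewrite -lerBlDl (le_trans (lerB_dist _ _))// distrC.
  rewrite -(subrKA (it k s0)) (le_trans (ler_normD _ _))//.
  rewrite -(subrKA (it k s) (it k s0)) .
  have -> : e = e / 3 + (e / 3 + e / 3) by field.
  apply: lerD; first by rewrite (le_trans (Hc k _ _))// ?lerDl// ltW.
  rewrite (le_trans (ler_normD _ _))// lerD//.
  by rewrite distrC (le_trans (Hc k _ _))// ltW.
have [G0 dG] := HPr _ (cFy _ cy); set G := Pr _ in G0 dG.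
(* [G] is the primitive of F along the limit. The mean value inequality shows that the iterates also
   converge to [y0 + G], so no limit is exchanged with a derivative. *)
have yE s : y s = y0 + G s.
  apply/eqP; rewrite -subr_eq0; apply/eqP.
  have [c c0 Hc] := Hy `|s|; have [M M0 HM] := bounded_on_segment `|s| cL.
  apply: (@geometric_unique _ _ _ (c + M * c * `|s|)) => k.
  have dI (r : R) : is_derive r 1 (fun r => it k.+1 r - (y0 + G r)) (F r (it k r) - F r (y r)).
    rewrite -[X in _ - X]add0r.
    exact: (is_deriveB (dit k r) (is_deriveD (is_derive_cst y0 r 1) (dG r))).
  have dphi (r : R) : is_derive r 1 (fun r => M * c * 2^-1 ^+ k * r + 0) (M * c * 2^-1 ^+ k).
    have := @is_derive_reparam R _ id 1 (M * c * 2^-1 ^+ k) 0 r (is_derive_id _ _).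
    by rewrite [_ *: _]mulr1.
  have := @mean_value_sym R n _ (@normr_is_norm R n) _ _ _ _ `|s| dI dphi _ _ s (lexx _).
  rewrite it0 G0 addr0 subrr normr0 mulr0 addr0 lexx => /(_ isT) H.
  have {}H : `|it k.+1 s - (y0 + G s)| <= M * c * 2^-1 ^+ k * `|s|.
    rewrite -[leRHS]addr0; apply: H => r rs; rewrite (le_trans (FL _ _ _))//.
    apply: (le_trans (ler_wpM2r (normr_ge0 _) (HM r rs))).
    by rewrite -mulrA ler_wpM2l// distrC; exact: Hc.
  rewrite -(subrKA (it k.+1 s)) (le_trans (ler_normD _ _))// mulrDl lerD//.
    rewrite (le_trans (Hc k.+1 s (lexx _)))// ler_wpM2l// exprS ler_piMl ?exprn_ge0 ?invr_ge0//.
    by rewrite invf_le1// ler1n.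
  by rewrite mulrAC.
exists y; first by rewrite yE G0 addr0.
move=> s; have := is_deriveD (is_derive_cst y0 s 1) (dG s); rewrite add0r.
by congr is_derive; apply/funext => r; rewrite yE.
Qed.
End Fixed.
End ODE.

(** * Continuous dependence on parameters *)

Section ODEParameters.
Variable R : realType.

(** The fields of [p] and [p0] are compared only along the fixed trajectory of [p0], where [tube]
    makes them uniformly close; the rest of the difference is Lipschitz in the state, and Gronwall
    applies. *)
Lemma ode_param_continuous (P : topologicalType) n (F : P -> R -> 'cV[R]_n -> 'cV[R]_n)
    (L : P -> R -> R) (w0 : P -> 'cV[R]_n) (Y : P -> R -> 'cV[R]_n) :
  continuous (fun q : P * R * 'cV[R]_n => F q.1.1 q.1.2 q.2) ->
  continuous (fun q : P * R => L q.1 q.2) ->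
  (forall p s y y', `|F p s y - F p s y'| <= L p s * `|y - y'|) ->
  continuous w0 -> (forall p, Y p 0 = w0 p) ->
  (forall p (s : R), is_derive s 1 (Y p) (F p s (Y p s))) ->
  continuous (fun q : P * R => Y q.1 q.2).
Proof.
move=> cF cL FL cw Y0 dY [p0 s0].
have cY p : continuous (Y p) by move=> s; exact: is_derive_continuous (dY p s).
pose T := `|s0| + 1.
have [M M0 HM] : exists2 M, 0 <= M & forall s, `|s| <= T -> L p0 s <= M.
  by apply: bounded_on_segment; apply: (continuous_app2 cL); cont.
have HL : \forall p \near p0, forall s, - T <= s <= T -> L p s < M + 1.
  apply: tube => s sT.
  have := cL (p0, s); move/cvgr_lt; apply => /=.
  by rewrite (le_lt_trans (HM s _)) ?ler_norml// ltrDl.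
apply/cvgrPdist_le => e e0 /=.
pose E := expR ((M + 1 + 1) * T).
have E0 : 0 < E by exact: expR_gt0.
have M1 : 0 <= M + 1 by rewrite addr_ge0.
(* Gronwall with initial error [d] and field error [d] gives at most [(d + d) * E = e / 2]. *)
pose d := e / (4 * E).
have d0 : 0 < d by rewrite divr_gt0// mulr_gt0.
have HF : \forall p \near p0, forall s, - T <= s <= T ->
    `|F p s (Y p0 s) - F p0 s (Y p0 s)| < d.
  apply: tube => s sT.
  have : continuous (fun q : P * R => `|F q.1 q.2 (Y p0 q.2) - F p0 q.2 (Y p0 q.2)|).
    have cc : continuous (fun q : P * R => Y p0 q.2) by apply: continuous_compT (cY p0) _; cont.
    apply: continuous_norm; apply: continuous_add; last apply: continuous_opp.
      by apply: (continuous_compT cF (f := fun q : P * R => (q.1, q.2, Y p0 q.2))); cont.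
    by apply: (continuous_compT cF (f := fun q : P * R => (p0, q.2, Y p0 q.2))); cont.
  by move/(_ (p0, s))/cvgr_lt; apply; rewrite /= subrr normr0.
have Hw : \forall p \near p0, `|w0 p0 - w0 p| <= d.
  by have := cw p0; move/cvgrPdist_le; apply.
have Hs : \forall s \near s0, `|Y p0 s0 - Y p0 s| <= e / 2.
  by have := cY p0 s0; move/cvgrPdist_le; apply; rewrite divr_gt0.
have Hn : \forall s \near s0, `|s0 - s| <= 1.
  by have /cvgrPdist_le := @cvg_id _ (nbhs s0); apply.
pose A1 p := forall s, - T <= s <= T -> L p s < M + 1.
pose A2 p := forall s, - T <= s <= T -> `|F p s (Y p0 s) - F p0 s (Y p0 s)| < d.
pose A3 p := `|w0 p0 - w0 p| <= d.
have Hp : nbhs p0 (A1 `&` (A2 `&` A3)) by apply: filterI => //; exact: filterI.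
have Hr : nbhs s0 [set s | `|Y p0 s0 - Y p0 s| <= e / 2 /\ `|s0 - s| <= 1] by exact: filterI.
exists (A1 `&` (A2 `&` A3), [set s | `|Y p0 s0 - Y p0 s| <= e / 2 /\ `|s0 - s| <= 1]) => //=.
move=> [p s] /= [[HLp [HFp Hwp]] [Hsp Hns]].
have s1 : `|s| <= T by rewrite -lerBlDl (le_trans (lerB_dist _ _))// distrC.
rewrite -(subrKA (Y p0 s)) (le_trans (ler_normD _ _))// [leRHS]splitr lerD//.
have /le_trans : `|Y p0 s - Y p s| <= (d + d) * expR ((M + 1 + 1) * `|s|).
  rewrite distrC.
  apply: (@gronwall_sym R n _ (@normr_is_norm R n) (Y p - Y p0)
    (fun s => F p s (Y p s) - F p0 s (Y p0 s)) (M + 1) d d T) => //; first exact: ltW.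
    rewrite [X in `|X|](_ : _ = w0 p - w0 p0); last by rewrite -!Y0.
    by rewrite distrC.
  move=> r rT; rewrite -(subrKA (F p r (Y p0 r))) (le_trans (ler_normD _ _))// lerD//.
    rewrite (le_trans (FL _ _ _ _))// ler_wpM2r// ltW// HLp//.
    by rewrite -ler_norml.
  by rewrite ltW// HFp// -ler_norml.
apply; apply: (@le_trans _ _ ((d + d) * E)).
  by rewrite ler_wpM2l ?addr_ge0 ?(ltW d0)// ler_expR ler_wpM2l// addr_ge0.
rewrite /d le_eqVlt; apply/orP; left; apply/eqP; field.
by rewrite gt_eqF.
Qed.

Lemma mulmx_norm_le m n (B : 'M[R]_(m, n)) (x : 'cV[R]_n) :
  `|B *m x| <= (\sum_i \sum_l `|B i l|) * `|x|.
Proof.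
have S0 (i : 'I_m) : 0 <= \sum_l `|B i l| by rewrite sumr_ge0.
apply/mx_norm_leP; first by rewrite mulr_ge0// sumr_ge0.
move=> i c; rewrite !mxE (le_trans (ler_norm_sum _ _ _))//.
apply: (@le_trans _ _ ((\sum_l `|B i l|) * `|x|)).
  rewrite mulr_suml; apply: ler_sum => l _; rewrite normrM ler_wpM2l//.
  exact: coord_le_norm.
by rewrite ler_wpM2r// (bigD1 i)//= lerDl sumr_ge0.
Qed.

Lemma affine_lipschitz m (B : 'M[R]_m) (b y y' : 'cV[R]_m) :
  `|(B *m y + b) - (B *m y' + b)| <= (\sum_i \sum_l `|B i l|) * `|y - y'|.
Proof. by rewrite opprD addrACA subrr addr0 -mulmxBr; exact: mulmx_norm_le. Qed.

Lemma continuous_lip (X : topologicalType) m (B : X -> 'M[R]_m) : continuous B ->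
  continuous (fun x => \sum_i \sum_l `|B x i l|).
Proof. by move=> cB; do 2 (apply: continuous_sum => ?); cont. Qed.

Lemma linear_ode (P : topologicalType) m (B : P -> R -> 'M[R]_m) (b : P -> R -> 'cV[R]_m)
    (w : P -> 'cV[R]_m) :
  continuous (fun q : P * R => B q.1 q.2) -> continuous (fun q : P * R => b q.1 q.2) ->
  continuous w ->
  exists U : P -> R -> 'cV[R]_m, [/\ forall p, U p 0 = w p,
    forall p (s : R), is_derive s 1 (U p) (B p s *m U p s + b p s) &
    continuous (fun q : P * R => U q.1 q.2)].
Proof.
move=> cB cb cw; pose L p s := \sum_i \sum_l `|B p s i l|.
pose F p s y := B p s *m y + b p s.
have cF : continuous (fun q : P * R * 'cV[R]_m => F q.1.1 q.1.2 q.2).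
  apply: continuous_add; last by apply: (continuous_app2 cb); cont.
  by apply: continuous_mulmx; [apply: (continuous_app2 cB); cont|cont].
have cL : continuous (fun q : P * R => L q.1 q.2) by exact: continuous_lip.
have FL p s y y' : `|F p s y - F p s y'| <= L p s * `|y - y'|.
  exact: affine_lipschitz.
have H p : exists2 y : R -> 'cV[R]_m, y 0 = w p & forall s : R, is_derive s 1 y (F p s (y s)).
  apply: (@picard R m (F p) (L p)) => //.
    by apply: (continuous_compT cF (f := fun q : R * 'cV[R]_m => (p, q.1, q.2))); cont.
  by apply: (continuous_app2 cL); cont.
pose U p := s2val (cid2 (H p)).
have U0 p : U p 0 = w p by rewrite /U; case: cid2.
have dU p (s : R) : is_derive s 1 (U p) (F p s (U p s)) by rewrite /U; case: cid2.
by exists U; split=> //; exact: (ode_param_continuous cF cL FL cw U0 dU).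
Qed.

Lemma linear_ode_unique m (B : R -> 'M[R]_m) (b y z : R -> 'cV[R]_m) :
  continuous B -> continuous b -> (forall s : R, is_derive s 1 y (B s *m y s + b s)) ->
  (forall s : R, is_derive s 1 z (B s *m z s + b s)) -> y 0 = z 0 -> y =1 z.
Proof.
move=> cB cb; apply: (@ode_unique R m (fun s y => B s *m y + b s) _ (continuous_lip cB)).
by move=> *; exact: affine_lipschitz.
Qed.

(* The difference quotients solve a linear equation whose coefficients remain
   continuous at [h = 0]; so their limit exists, by continuous dependence on the
   parameter [h]. *)
Lemma ode_partial (T : topologicalType) m n (W : T -> 'cV[R]_n -> R -> 'cV[R]_m)
    (j : 'I_n) (B : T * 'cV[R]_n * R -> R -> 'M[R]_m)
    (b : T * 'cV[R]_n * R -> R -> 'cV[R]_m) (w : T * 'cV[R]_n * R -> 'cV[R]_m) :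
  continuous (fun q => B q.1 q.2) -> continuous (fun q => b q.1 q.2) -> continuous w ->
  (forall t x h, h != 0 ->
    h^-1 *: (W t (x + h *: delta_mx j 0) 0 - W t x 0) = w (t, x, h)) ->
  (forall t x h (s : R), h != 0 ->
    is_derive s 1 (fun s => h^-1 *: (W t (x + h *: delta_mx j 0) s - W t x s))
      (B (t, x, h) s *m (h^-1 *: (W t (x + h *: delta_mx j 0) s - W t x s)) + b (t, x, h) s)) ->
  exists U : T -> 'cV[R]_n -> R -> 'cV[R]_m,
    [/\ forall t x, U t x 0 = w (t, x, 0),
        forall t x (s : R), is_derive s 1 (U t x) (B (t, x, 0) s *m U t x s + b (t, x, 0) s) &
        forall t s x i, is_derive x (delta_mx j 0) (fun x => W t x s i 0) (U t x s i 0)].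
Proof.
move=> cB cb cw W0 dW; have [U [U0 dU cU]] := linear_ode cB cb cw.
exists (fun t x s => U (t, x, 0) s); split=> // t s x i.
apply/is_deriveP.
have : continuous (fun h => U (t, x, h) s i 0).
  by apply: continuous_coord; apply: (continuous_app2 cU); cont.
move=> /(_ 0) c; have {c} : U (t, x, h) s i 0 @[h --> (0 : R)^'] --> U (t, x, 0) s i 0.
  by apply: cvg_trans c; apply: cvg_app; exact: cvg_within.
apply: cvg_trans; apply: near_eq_cvg; near=> h.
have h0 : h != 0 by near: h; exact: nbhs_dnbhs_neq.
(* For nonzero [h] uniqueness identifies [U] with the difference quotient; [U] itself is also
   defined and continuous at [h = 0]. *)
have E : U (t, x, h) =1 (fun s => h^-1 *: (W t (x + h *: delta_mx j 0) s - W t x s)).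
  apply: (@linear_ode_unique m (B (t, x, h)) (b (t, x, h))).
  - by apply: (continuous_app2 cB); cont.
  - by apply: (continuous_app2 cb); cont.
  - exact: dU.
  - by move=> r; exact: dW.
  - by rewrite U0 W0.
by rewrite E !mxE [x + _]addrC.
Unshelve. all: by end_near. Qed.

End ODEParameters.

(** * Smooth dependence on initial values *)

Section SmoothDependence.
Variable R : realType.

Lemma joint_Ck_vec_continuous (T : topologicalType) m n k (U : T -> 'cV[R]_n -> 'cV[R]_m) :
  (forall i, joint_Ck k (fun t x => U t x i 0)) -> continuous (fun q => U q.1 q.2).
Proof.
by move=> JU; apply/continuous_mxP => i c; rewrite ord1; exact: joint_Ck_continuous (JU i).
Qed.

Lemma continuous_vec (X : topologicalType) m (f : 'I_m -> X -> R) :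
  (forall i, continuous (f i)) -> continuous (fun x => \col_i f i x).
Proof.
by move=> cf; apply/continuous_mxP => i c; under eq_fun do rewrite mxE; exact: cf.
Qed.

Lemma is_derive_mulmx m n (V : normedModType R) (x v : V) (B : 'M[R]_(m, n))
   (f : V -> 'cV[R]_n) (df : 'cV[R]_n) :
  is_derive x v f df -> is_derive x v (fun y => B *m f y) (B *m df).
Proof.
move=> /is_derive_mxP H; apply/is_derive_mxP => i j.
have := is_derive_sum (fun k => is_deriveZ (B i k) (H k j)).
by congr is_derive; [apply/funext => y; rewrite fct_sumE mxE; apply: eq_bigr|rewrite mxE; apply: eq_bigr].
Qed.

(** A derivative of [W] in [x] solves the equation with the same matrix [B] and forcing dB W + db.
    This forcing is of class k once [W] is, so the induction hypothesis is used twice: for [W] and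
    for its derivative. *)
Lemma linear_ode_joint_Ck (T : topologicalType) m n k (B : T * R -> 'cV[R]_n -> 'M[R]_m)
    (b : T * R -> 'cV[R]_n -> 'cV[R]_m) (w0 : T -> 'cV[R]_n -> 'cV[R]_m)
    (W : T -> 'cV[R]_n -> R -> 'cV[R]_m) :
  (forall i l, joint_Ck k (fun q x => B q x i l)) -> (forall i, joint_Ck k (fun q x => b q x i 0)) ->
  (forall i, joint_Ck k (fun t x => w0 t x i 0)) -> (forall t x, W t x 0 = w0 t x) ->
  (forall t x (s : R), is_derive s 1 (W t x) (B (t, s) x *m W t x s + b (t, s) x)) ->
  forall i, joint_Ck k (fun q x => W q.1 x q.2 i 0).
Proof.
elim: k b w0 W => [|k IH] b w0 W JB Jb Jw W0 dW.
  have cB : continuous (fun q => B q.1 q.2).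
    by apply/continuous_mxP => i c; exact: joint_Ck_continuous (JB i c).
  have cb := joint_Ck_vec_continuous Jb; have cw := joint_Ck_vec_continuous Jw.
  have H := @ode_param_continuous R (T * 'cV[R]_n)%type m
    (fun p s y => B (p.1, s) p.2 *m y + b (p.1, s) p.2)
    (fun p s => \sum_i \sum_l `|B (p.1, s) p.2 i l|) (fun p => w0 p.1 p.2)
    (fun p => W p.1 p.2).
  move=> i; split=> //.
  have {}H : continuous (fun q : T * 'cV[R]_n * R => W q.1.1 q.1.2 q.2).
    apply: H => //.
    - apply: continuous_add; last by apply: (continuous_app2 cb); cont.
      by apply: continuous_mulmx; [apply: (continuous_app2 cB); cont|cont].
    - by apply: continuous_lip; apply: (continuous_app2 cB); cont.
    - by move=> p s y y'; exact: (affine_lipschitz (B (p.1, s) p.2) (b (p.1, s) p.2)).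

  apply: continuous_coord.
  apply: (continuous_compT H (f := fun q : T * R * 'cV[R]_n => (q.1.1, q.2, q.1.2))).
  by cont.
have JBk i l : joint_Ck k (fun q x => B q x i l) by exact: joint_Ck_le (leqnSn _) (JB i l).
have Jbk i : joint_Ck k (fun q x => b q x i 0) by exact: joint_Ck_le (leqnSn _) (Jb i).
have Jwk i : joint_Ck k (fun t x => w0 t x i 0) by exact: joint_Ck_le (leqnSn _) (Jw i).
have JW := IH b w0 W JBk Jbk Jwk W0 dW.
have cW : continuous (fun q : T * R * 'cV[R]_n => W q.1.1 q.2 q.1.2).
  exact: (joint_Ck_vec_continuous JW).
have cB : continuous (fun q => B q.1 q.2).
  by apply/continuous_mxP => i c; exact: joint_Ck_continuous (JB i c).
have cb := joint_Ck_vec_continuous Jb; have cw := joint_Ck_vec_continuous Jw.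
suff main j : exists U : T -> 'cV[R]_n -> R -> 'cV[R]_m,
    (forall i, joint_Ck k (fun q x => U q.1 x q.2 i 0)) /\
    forall t s x i, is_derive x (delta_mx j 0) (fun x => W t x s i 0) (U t x s i 0).
  move=> i; split=> [|j]; first exact: joint_Ck_continuous (JW i).
  have [U [JU dU]] := main j.
  by exists (fun q x => U q.1 x q.2 i 0) => // -[t s] x; exact: dU.
have HB i l := (JB i l).2 j; have Hb i := (Jb i).2 j; have Hw i := (Jw i).2 j.
pose dB i l := s2val (cid2 (HB i l)); pose db i := s2val (cid2 (Hb i)).
pose dw i := s2val (cid2 (Hw i)).
have dBP i l : forall q x, is_derive x (delta_mx j 0) (fun x => B q x i l) (dB i l q x).
  by rewrite /dB; case: cid2.
have JdB i l : joint_Ck k (dB i l) by rewrite /dB; case: cid2.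
have dbP i : forall q x, is_derive x (delta_mx j 0) (fun x => b q x i 0) (db i q x).
  by rewrite /db; case: cid2.
have Jdb i : joint_Ck k (db i) by rewrite /db; case: cid2.
have dwP i : forall t x, is_derive x (delta_mx j 0) (fun x => w0 t x i 0) (dw i t x).
  by rewrite /dw; case: cid2.
have Jdw i : joint_Ck k (dw i) by rewrite /dw; case: cid2.
pose Bh (p : T * 'cV[R]_n * R) s := B (p.1.1, s) (p.1.2 + p.2 *: delta_mx j 0).
(* The product difference is split with [B] at the shifted point and [W] at the base point, so the
   unknown quotient of [W] occurs only in the linear term. *)
pose bh (p : T * 'cV[R]_n * R) s : 'cV[R]_m := \col_i
  (\sum_l dq j (fun q x => B q x i l) (dB i l) (p.1.1, s) p.1.2 p.2 * W p.1.1 p.1.2 s l 0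
   + dq j (fun q x => b q x i 0) (db i) (p.1.1, s) p.1.2 p.2).
pose wh (p : T * 'cV[R]_n * R) : 'cV[R]_m :=
  \col_i dq j (fun t x => w0 t x i 0) (dw i) p.1.1 p.1.2 p.2.
have [|||||U [U0 dU UW]] := @ode_partial R T m n W j Bh bh wh.
- by apply: (continuous_app2 cB); cont.
- apply: continuous_vec => i; apply: continuous_add.
    apply: continuous_sum => l; apply: continuous_mul.
      apply: (continuous_compT (dq_continuous (joint_Ck_continuous (JB i l)) (joint_Ck_continuous (JdB i l)) (dBP i l))
        (f := fun q : T * 'cV[R]_n * R * R => (q.1.1.1, q.2, q.1.1.2, q.1.2))).
      by cont.
    apply: continuous_coord.
    apply: (continuous_compT cW (f := fun q : T * 'cV[R]_n * R * R => (q.1.1.1, q.2, q.1.1.2))).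
    by cont.
  apply: (continuous_compT (dq_continuous (joint_Ck_continuous (Jb i)) (joint_Ck_continuous (Jdb i)) (dbP i))
    (f := fun q : T * 'cV[R]_n * R * R => (q.1.1.1, q.2, q.1.1.2, q.1.2))).
  by cont.
- apply: continuous_vec => i.
  exact: (dq_continuous (joint_Ck_continuous (Jw i)) (joint_Ck_continuous (Jdw i)) (dwP i)).
- move=> t x h h0; apply/matrixP => i c; rewrite ord1 !mxE /dq (negbTE h0) !W0.
  by [].
- move=> t x h s h0.
  have := is_deriveZ h^-1 (is_deriveB (dW t (x + h *: delta_mx j 0) s) (dW t x s)).
  congr is_derive; apply/matrixP => i c; rewrite ord1 !mxE /= /dq (negbTE h0) /=.
  rewrite addrA -big_split /= opprD addrACA mulrDr; congr (_ + _).
  rewrite -sumrB mulr_sumr; apply: eq_bigr => l _; rewrite /Bh /= !mxE.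
  by ring.
exists U; split=> //.
apply: (IH (fun q x => \col_i (\sum_l dB i l q x * W q.1 x q.2 l 0 + db i q x))
  (fun t x => \col_i dw i t x) U) => //.
- move=> i; under eq_fun do under eq_fun do rewrite mxE.
  apply: joint_Ck_add => //; apply: joint_Ck_sum => l; exact: joint_Ck_mul.
- by move=> i; under eq_fun do under eq_fun do rewrite mxE; exact: Jdw.
- by move=> t x; rewrite U0; apply/matrixP => i c; rewrite !mxE /dq eqxx.
- move=> t x s; have := dU t x s; rewrite /Bh /= scale0r addr0.
  congr is_derive; congr (_ + _); apply/matrixP => i c.
  by rewrite !mxE /dq eqxx.
Qed.

(** By [hadamard], difference quotients of the flow solve a linear equation whose matrix [Bh] is
    continuous and becomes the variational matrix at [h = 0]. If the flow is of class k, so is that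
    matrix, and [linear_ode_joint_Ck] supplies the next order. *)
Lemma flow_joint_Ck (T : topologicalType) n k (F : T * R -> 'cV[R]_n -> 'cV[R]_n) (L : R)
    (Y : T -> 'cV[R]_n -> R -> 'cV[R]_n) :
  (forall i, joint_Ck k (fun q x => F q x i 0)) ->
  (forall q y y', `|F q y - F q y'| <= L * `|y - y'|) ->
  (forall t x, Y t x 0 = x) ->
  (forall t x (s : R), is_derive s 1 (Y t x) (F (t, s) (Y t x s))) ->
  forall i, joint_Ck k (fun q x => Y q.1 x q.2 i 0).
Proof.
move=> + FL Y0 dY; elim: k => [|k IH] JF; have cF := joint_Ck_vec_continuous JF.
  have H : continuous (fun q : T * 'cV[R]_n * R => Y q.1.1 q.1.2 q.2).
    apply: (@ode_param_continuous R (T * 'cV[R]_n)%type n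
      (fun p s y => F (p.1, s) y) (fun _ _ => L) (fun p => p.2) (fun p => Y p.1 p.2)) => //.
    - by apply: (continuous_app2 cF); cont.
    - by cont.
    - by cont.
  move=> i; split=> //; apply: continuous_coord.
  apply: (continuous_compT H (f := fun q : T * R * 'cV[R]_n => (q.1.1, q.2, q.1.2))).
  by cont.
have JY := IH (fun i => joint_Ck_le (leqnSn _) (JF i)).
have cY : continuous (fun q : T * R * 'cV[R]_n => Y q.1.1 q.2 q.1.2).
  exact: (joint_Ck_vec_continuous JY).
suff main j : exists U : T -> 'cV[R]_n -> R -> 'cV[R]_n,
    (forall i, joint_Ck k (fun q x => U q.1 x q.2 i 0)) /\
    forall t s x i, is_derive x (delta_mx j 0) (fun x => Y t x s i 0) (U t x s i 0).
  move=> i; split=> [|j]; first exact: joint_Ck_continuous (JY i).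
  have [U [JU dU]] := main j.
  by exists (fun q x => U q.1 x q.2 i 0) => // -[t s] x; exact: dU.
have HF i := joint_Ck_partials (JF i).
pose G i := sval (cid (HF i)).
have JG i l : joint_Ck k (G i l) by rewrite /G; case: cid => /= g /(_ l)[].
have dG i l q x : is_derive x (delta_mx l 0) (fun x => F q x i 0) (G i l q x).
  by rewrite /G; case: cid => /= g /(_ l)[].
pose Yh (p : T * 'cV[R]_n * R) s := Y p.1.1 (p.1.2 + p.2 *: delta_mx j 0) s.
have cYs : continuous (fun q : T * 'cV[R]_n * R * R => Y q.1.1.1 q.1.1.2 q.2).
  apply: (continuous_compT cY (f := fun q : T * 'cV[R]_n * R * R => (q.1.1.1, q.2, q.1.1.2))).
  by cont.
have cYh : continuous (fun q : T * 'cV[R]_n * R * R => Yh q.1 q.2).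
  apply: (continuous_compT cY (f := fun q : T * 'cV[R]_n * R * R =>
    (q.1.1.1, q.2, q.1.1.2 + q.1.2 *: delta_mx j 0))).
  by cont.
pose Bh (p : T * 'cV[R]_n * R) s : 'M[R]_n := \matrix_(i, l)
  dq l (fun q x => F q x i 0) (G i l) (p.1.1, s)
    (mixcol l (Y p.1.1 p.1.2 s) (Yh p s)) (Yh p s l 0 - Y p.1.1 p.1.2 s l 0).
have [|||||U [U0 dU UY]] := @ode_partial R T n n Y j Bh (fun _ _ => 0) (fun=> delta_mx j 0).
- apply/continuous_mxP => i l; under eq_fun do rewrite mxE.
  apply: (continuous_dq_mixcol (joint_Ck_continuous (JF i)) (joint_Ck_continuous (JG i l)) (dG i l)) => //.
  by cont.
- by cont.
- by cont.
- by move=> t x h h0; rewrite !Y0 addrC addKr scalerA mulVf// scale1r.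
- move=> t x h s h0.
  have := is_deriveZ h^-1 (is_deriveB (dY t (x + h *: delta_mx j 0) s) (dY t x s)).
  congr is_derive; apply/matrixP => i c; rewrite ord1 addr0 !mxE.
  rewrite (hadamard (fun q x => F q x i 0) (G i)) [LHS]mulr_sumr.
  apply: eq_bigr => l _; rewrite !mxE /Yh /=.
  by rewrite mulrCA.
exists U; split=> //.
apply: (@linear_ode_joint_Ck T n n k (fun q x => \matrix_(i, l) G i l q (Y q.1 x q.2))
   (fun _ _ => 0) (fun _ _ => delta_mx j 0) U) => //.
- move=> i l; under eq_fun do under eq_fun do rewrite mxE.
  by apply: joint_Ck_comp.
- by move=> i; exact: joint_Ck_cst.
- by move=> i; exact: joint_Ck_cst.
- move=> t x s; have := dU t x s.
  congr is_derive; congr (_ *m _ + _); apply/matrixP => i l; rewrite !mxE /Yh /=.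
  by rewrite scale0r addr0 mixcol_id subrr /dq eqxx.
Qed.

End SmoothDependence.

(** * Flows and their inverses *)

Section Flow.
Variable R : realType.

Lemma flow_family (T : topologicalType) n k (F : T * R -> 'cV[R]_n -> 'cV[R]_n) (L : R) :
  (forall i, joint_Ck k (fun q x => F q x i 0)) ->
  (forall q y y', `|F q y - F q y'| <= L * `|y - y'|) ->
  exists Y : T -> 'cV[R]_n -> R -> 'cV[R]_n,
  [/\ forall t x, Y t x 0 = x,
      forall t x (s : R), is_derive s 1 (Y t x) (F (t, s) (Y t x s)) &
      forall i, joint_Ck k (fun q x => Y q.1 x q.2 i 0)].
Proof.
move=> JF FL; have cF := joint_Ck_vec_continuous JF.
have H t x : exists2 y : R -> 'cV[R]_n, y 0 = x & forall s : R, is_derive s 1 y (F (t, s) (y s)).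
  apply: (@picard R n (fun s => F (t, s)) (fun=> L)) => //.
    by apply: (continuous_app2 cF); cont.
  by cont.
pose Y t x := s2val (cid2 (H t x)).
have Y0 t x : Y t x 0 = x by rewrite /Y; case: cid2.
have dY t x (s : R) : is_derive s 1 (Y t x) (F (t, s) (Y t x s)) by rewrite /Y; case: cid2.
by exists Y; split=> //; exact: flow_joint_Ck JF FL Y0 dY.
Qed.

(* [Z t] follows the flow backward from time [t] to time 0; it is the value at
   time [t] of a solution of an equation that depends on the parameter [t]. *)
Lemma flow_exists n k (F : R -> 'cV[R]_n -> 'cV[R]_n) (L : R) :
  (forall i, joint_Ck k (fun t x => F t x i 0)) ->
  (forall t y y', `|F t y - F t y'| <= L * `|y - y'|) ->
  exists Y Z : R -> 'cV[R]_n -> 'cV[R]_n,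
  [/\ forall x, Y 0 x = x,
      forall x (t : R), is_derive t 1 (Y ^~ x) (F t (Y t x)),
      forall t, cancel (Y t) (Z t) /\ cancel (Z t) (Y t),
      forall i, joint_Ck k (fun t x => Y t x i 0) &
      forall i, joint_Ck k (fun t x => Z t x i 0)].
Proof.
move=> JF FL.
have [Y [Y0 dY JY]] := @flow_family R n k (fun q => F q.2) L
  (fun i => joint_Ck_reparam (continuous_snd (@continuous_id (R * R)%type)) (JF i))
  (fun q y y' => FL q.2 y y').
have [U [U0 dU JU]] : exists Y : R -> 'cV[R]_n -> R -> 'cV[R]_n,
  [/\ forall t x, Y t x 0 = x,
      forall t x (s : R), is_derive s 1 (Y t x) (- F (t - s) (Y t x s)) &
      forall i, joint_Ck k (fun q x => Y q.1 x q.2 i 0)].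
  apply: (@flow_family R n k (fun q y => - F (q.1 - q.2) y) L).
    move=> i; under eq_fun do under eq_fun do rewrite mxE.
    apply: joint_Ck_opp.
    have cphi : continuous (fun q : R * R => q.1 - q.2) by cont.
    exact: (joint_Ck_reparam cphi (JF i)).
  by move=> q y y'; rewrite -opprD normrN; exact: FL.
have cL : continuous (fun _ : R => L) by cont.
exists (fun t x => Y 0 x t), (fun t x => U t x t); split=> //.
- move=> t; split=> x.
    have E : U t (Y 0 x t) =1 (fun s => Y 0 x (t - s)).
      apply: (@ode_unique R n (fun s y => - F (t - s) y) _ cL) => //.
      - by move=> s y y'; rewrite -opprD normrN; exact: FL.
      - by move=> s; apply: is_deriveS; exact: dY.
      - by rewrite U0 subr0.
    by rewrite E subrr Y0.
  have E : (fun s => U t x (t - s)) =1 Y 0 (U t x t).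
    apply: (@ode_unique R n (fun s y => F s y) _ cL) => //.
    - move=> s; have := is_deriveS (dU t x (t - s)).
      by rewrite opprK opprB addrC subrK.
    - by rewrite subr0 Y0.
  by rewrite -E subrr U0.
- have cphi : continuous (fun t : R => (0 : R, t)) by cont.
  by move=> i; exact: (joint_Ck_reparam cphi (JY i)).
- have cphi : continuous (fun t : R => (t, t)) by cont.
  by move=> i; exact: (joint_Ck_reparam cphi (JU i)).
Qed.

End Flow.

(** * Translation between [joint_Ck] and the smoothness notions of the statement *)

Section Interface.
Variable R : realType.

Lemma max0_continuous : continuous (fun t : R => Num.max t 0).
Proof.
have -> : (fun t : R => Num.max t 0) = (fun t => (t + `|t|) * 2^-1).
  by apply/funext => t; rewrite maxr_absE addr0 subr0.
by cont.
Qed.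

Lemma continuous_compT_within (X Y Z : topologicalType) (A : set Y) (f : Y -> Z) (g : X -> Y) :
  {within A, continuous f} -> continuous g -> (forall x, A (g x)) ->
  continuous (fun x => f (g x)).
Proof.
move=> /subspace_continuousP cf cg Ag x; apply: cvg_comp (cf _ (Ag x)).
move=> B HB; have H : nbhs x (fun z => A (g z) -> B (g z)) by exact: (cg x _ HB).
exact: (filterS (fun z h => h (Ag z)) H).
Qed.

Lemma joint_Ck_partials_vec n k (F : R -> 'cV[R]_n -> 'cV[R]_n) (js : seq 'I_n) :
  (forall i, joint_Ck k (fun t x => F t x i 0)) -> (size js <= k)%N ->
  forall i, joint_Ck (k - size js) (fun t x => partials js (F t) x i 0).
Proof.
move=> JF; elim: js => [_|j js IH]; first by rewrite subn0.
move=> sk; have {}IH := IH (ltnW sk).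
have kE : (k - size js = (k - (size js).+1).+1)%N by rewrite subnS prednK// subn_gt0.
rewrite kE in IH; move=> i; rewrite /= .
have [G HG] : exists G : 'I_n -> R -> 'cV[R]_n -> R, forall i, joint_Ck (k - (size js).+1) (G i) /\
    forall t x, is_derive x (delta_mx j 0) (fun x => partials js (F t) x i 0) (G i t x).
  have H l : exists G : R -> 'cV[R]_n -> R, joint_Ck (k - (size js).+1) G /\
    forall t x, is_derive x (delta_mx j 0) (fun x => partials js (F t) x l 0) (G t x).
    by have [_ /(_ j)[G dG JG]] := IH l; exists G.
  by exists (fun l => sval (cid (H l))) => l; case: cid.
have -> : (fun t x => 'D_(delta_mx j 0) (partials js (F t)) x i 0) = G i.
  apply/funext => t; apply/funext => x.
  have /is_derive_mxP : forall l c, is_derive x (delta_mx j 0)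
    (fun x => partials js (F t) x l c) ((\col_l G l t x : 'cV[R]_n) l c).
    by move=> l c; rewrite mxE ord1; have [_] := HG l; apply.
  by move=> [_ ->]; rewrite mxE.
by have [] := HG i.
Qed.

Lemma joint_Ck_derivable_vec n k (F : R -> 'cV[R]_n -> 'cV[R]_n) (js : seq 'I_n) :
  (forall i, joint_Ck k (fun t x => F t x i 0)) -> (size js < k)%N ->
  forall t j x, derivable (partials js (F t)) x (delta_mx j 0).
Proof.
move=> JF sk t j x; apply/derivable_mxP => i c; rewrite ord1.
have := joint_Ck_partials_vec JF (ltnW sk) i.
rewrite (_ : (k - size js = (k - (size js).+1).+1)%N); last by rewrite subnS prednK// subn_gt0.
by move=> [_ /(_ j)[G dG _]]; have [] := dG t x.
Qed.

Lemma joint_Ck_jointly_continuous_partials n k (F : R -> 'cV[R]_n -> 'cV[R]_n) :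
  (forall i, joint_Ck k (fun t x => F t x i 0)) -> jointly_continuous_partials k F.
Proof.
move=> JF js sk; apply: continuous_subspaceT.
exact: (joint_Ck_vec_continuous (joint_Ck_partials_vec JF sk)).
Qed.

Lemma joint_Ck_class_C n k (F : R -> 'cV[R]_n -> 'cV[R]_n) t :
  (forall i, joint_Ck k (fun t x => F t x i 0)) -> class_C k (F t).
Proof.
move=> JF; split=> js sk; first by move=> j x; exact: joint_Ck_derivable_vec JF sk t j x.
have c := joint_Ck_vec_continuous (joint_Ck_partials_vec JF sk).
by apply: (continuous_compT c (f := fun x => (t, x))); cont.
Qed.

Lemma jointly_continuous_extend n (F : R -> 'cV[R]_n -> 'cV[R]_n) :
  jointly_continuous F ->
  continuous (fun q : R * 'cV[R]_n => F (Num.max q.1 0) q.2).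
Proof.
move=> cF.
have cm : continuous (fun q : R * 'cV[R]_n => (Num.max q.1 0, q.2)).
  apply: continuous_pair; last by cont.
  exact: (continuous_compT max0_continuous (continuous_fst (@continuous_id _))).
apply: (continuous_compT_within cF cm).
by move=> q /=; rewrite le_max lexx orbT.
Qed.

Lemma class_C_joint_Ck n k (F : R -> 'cV[R]_n -> 'cV[R]_n) :
  (forall t, 0 <= t -> class_C k (F t)) -> jointly_continuous_partials k F ->
  forall i, joint_Ck k (fun (t : R) x => F (Num.max t 0) x i 0).
Proof.
move=> CF JF.
(* The induction runs over all partial derivatives at once, with [l] orders of smoothness still to
   be unrolled. *)
have H l js : (l + size js <= k)%N ->
  forall i, joint_Ck l (fun (t : R) x => partials js (F (Num.max t 0)) x i 0).
  elim: l js => [|l IH] js lk i.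
    split=> //; apply: continuous_coord.
    exact: (jointly_continuous_extend (JF js lk)).
  split=> [|j].
    apply: continuous_coord.
    apply: (jointly_continuous_extend (JF js _)).
    by rewrite (leq_trans _ lk)// leq_addl.
  exists (fun (t : R) x => partials (j :: js) (F (Num.max t 0)) x i 0).
    move=> t x /=.
    have m0 : 0 <= Num.max t 0 by rewrite le_max lexx orbT.
    have sk : (size js < k)%N by rewrite (leq_trans _ lk)// addSn ltnS leq_addl.
    have := (CF _ m0).1 js sk j x => /derivableP/is_derive_mxP; exact.
  by apply: IH; rewrite /= addnS -addSn.
by move=> i; apply: (H k [::] _ i); rewrite addn0.
Qed.

End Interface.

(** * A slow cutoff *)

Section ScalarComposition.
Variable R : realType.

Lemma is_derive_curve (V W : normedModType R) (f : V -> W) x v df :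
  is_derive x v f df <-> is_derive (0 : R) 1 (fun h => f (h *: v + x)) df.
Proof.
split=> /is_deriveP H; apply/is_deriveP; apply: cvg_trans H; apply: near_eq_cvg;
  near=> h; by rewrite scale0r add0r addr0 [h *: 1]mulr1.
Unshelve. all: by end_near. Qed.

Lemma is_derive_comp1 (V : normedModType R) (f : V -> R) (g : R -> R) x v df dg :
  is_derive x v f df -> is_derive (f x) 1 g dg ->
  is_derive x v (fun y => g (f y)) (dg * df).
Proof.
move=> /is_derive_curve df_ dg_; apply/is_derive_curve.
apply: (@is_derive1_comp R g (fun h => f (h *: v + x))) => //.
by rewrite scale0r add0r.
Qed.

Lemma joint_Ck_inv (T : topologicalType) n k (F : T -> 'cV[R]_n -> R) :
  (forall t x, F t x != 0) -> joint_Ck k F -> joint_Ck k (fun t x => (F t x)^-1).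
Proof.
move=> F0; elim: k => [|k IH] JF; have cF := joint_Ck_continuous JF.
  by split=> // q; apply: cvgV => //; exact: cF.
split=> [q|j]; first by apply: cvgV => //; exact: cF.
have JFk := joint_Ck_le (leqnSn _) JF; have [F' dF JF'] := JF.2 j.
exists (fun t x => - ((F t x)^-1 * (F t x)^-1) * F' t x).
  move=> t x; apply: (is_derive_comp1 (dF t x)).
  have := @is_deriveV R id (F t x) 1 1 (F0 t x) (is_derive_id _ _).
  by rewrite [_ *: 1]mulr1 expr2 invfM.
by apply: joint_Ck_mul => //; apply: joint_Ck_opp; apply: joint_Ck_mul; exact: IH.
Qed.

Lemma joint_Ck_ln (T : topologicalType) n k (F : T -> 'cV[R]_n -> R) :
  (forall t x, 0 < F t x) -> joint_Ck k F -> joint_Ck k (fun t x => ln (F t x)).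
Proof.
move=> F0 JF; have cF := joint_Ck_continuous JF.
have c : continuous (fun q : T * 'cV[R]_n => ln (F q.1 q.2)).
  move=> q; apply: (@continuous_comp _ _ _ (fun q : T * 'cV[R]_n => F q.1 q.2) (@ln R)).
    exact: cF.
  by apply: continuous_ln.
case: k JF => [|k] JF; split=> // j.
have [F' dF JF'] := JF.2 j.
exists (fun t x => (F t x)^-1 * F' t x).
  by move=> t x; apply: (is_derive_comp1 (dF t x)); exact: is_derive1_ln.
apply: joint_Ck_mul => //; apply: joint_Ck_inv; first by move=> t x; rewrite gt_eqF.
exact: joint_Ck_le (leqnSn _) JF.
Qed.

(** The truncated power, of class C^(m-1) for positive [m]: finite smoothness is enough for the
    cutoff, so no exponential bump is required. *)
Definition pospow (m : nat) (v : R) : R := Num.max v 0 ^+ m.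

Lemma continuous_pospow m : continuous (pospow m).
Proof.
apply: (continuous_compT (g := fun v : R => v ^+ m)); last exact: max0_continuous.
exact: exprn_continuous.
Qed.

Lemma is_derive_pospow m (v : R) :
  is_derive v 1 (pospow m.+2) (m.+2%:R * pospow m.+1 v).
Proof.
have [v0|v0|->] := ltgtP v 0.
- rewrite /pospow (max_r (ltW v0)) expr0n mulr0.
  apply: (near_eq_is_derive _ (is_derive_cst 0 v 1)).
  have : \forall y \near v, y < 0 by exact: lt_nbhsl.
  by apply: filterS => y y0; rewrite /pospow (max_r (ltW y0)) expr0n.
- rewrite /pospow (max_l (ltW v0)).
  have := @is_deriveX _ _ id m.+2 v 1 1 (is_derive_id _ _).
  rewrite [_ *: 1]mulr1 => H; apply: (near_eq_is_derive _ H).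
  have : \forall y \near v, 0 < y by exact: lt_nbhsr.
  by apply: filterS => y y0; rewrite exprfctE /pospow (max_l (ltW y0)).
(* At the junction point 0 the difference quotient itself is the continuous function
   [pospow m.+1]. *)
apply/is_derive1_caratheodory; exists (pospow m.+1); split.
- move=> z; rewrite subr0 /pospow maxxx expr0n subr0.
  have [z0|z0] := leP z 0; first by rewrite !expr0n mul0r.
  by rewrite exprSr.
- exact: continuous_pospow.
- by rewrite /pospow maxxx expr0n mulr0.
Qed.

Lemma joint_Ck_pospow (T : topologicalType) n k m (F : T -> 'cV[R]_n -> R) :
  (k < m)%N -> joint_Ck k F -> joint_Ck k (fun t x => pospow m (F t x)).
Proof.
elim: k m => [|k IH] m km JF; have cF := joint_Ck_continuous JF;
  have c := continuous_compT (@continuous_pospow m) cF; first by split.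
split=> // j; case: m km c => [|[|m]]// km _.
have [F' dF JF'] := JF.2 j.
exists (fun t x => m.+2%:R * pospow m.+1 (F t x) * F' t x).
  by move=> t x; apply: (is_derive_comp1 (dF t x)); exact: is_derive_pospow.
apply: joint_Ck_mul => //; apply: joint_Ck_mul; first exact: joint_Ck_cst.
by apply: IH => //; exact: joint_Ck_le (leqnSn _) JF.
Qed.

Lemma pospow_lipschitz m (a b : R) : a <= 1 -> b <= 1 ->
  `|pospow m a - pospow m b| <= m%:R * `|a - b|.
Proof.
move=> a1 b1; rewrite /pospow.
have m1 (x : R) : x <= 1 -> 0 <= Num.max x 0 <= 1.
  by move=> x1; rewrite le_max lexx orbT /= ge_max x1 ler01.
have H : `|Num.max a 0 - Num.max b 0| <= `|a - b|.
  rewrite !maxr_absE !addr0 !subr0.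
  have -> : (a + `|a|) / 2 - (b + `|b|) / 2 = ((a - b) + (`|a| - `|b|)) / 2 by field.
  rewrite normrM (gtr0_norm (_ : 0 < 2^-1 :> R)) ?invr_gt0// ler_pdivrMr// mulrDr mulr1.
  by rewrite (le_trans (ler_normD _ _))// lerD2l; exact: ler_dist_dist.
apply: (@le_trans _ _ (m%:R * `|Num.max a 0 - Num.max b 0|)); last by rewrite ler_wpM2l.
have := m1 _ b1; have := m1 _ a1.
move: (Num.max a 0) (Num.max b 0) => x y /andP[x0 x1] /andP[y0 y1].
elim: m => [|m IH]; first by rewrite !expr0 subrr normr0 mul0r.
have -> : x ^+ m.+1 - y ^+ m.+1 = x * (x ^+ m - y ^+ m) + (x - y) * y ^+ m.
  by rewrite !exprS; ring.
have -> : m.+1%:R * `|x - y| = m%:R * `|x - y| + `|x - y|.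
  by rewrite -addn1 natrD mulrDl mul1r.
rewrite (le_trans (ler_normD _ _))// lerD// normrM.
  by rewrite (le_trans _ IH)// ler_piMl// ger0_norm.
by rewrite ler_piMr// ger0_norm ?exprn_ge0// exprn_ile1.
Qed.

(** Composing the truncated power with itself flattens both ends of the step, at 0 and at 1. *)
Definition step_down (m : nat) (v : R) : R := pospow m (1 - pospow m v).

Lemma step_down_ge0 m v : 0 <= step_down m v.
Proof. by rewrite exprn_ge0// le_max lexx orbT. Qed.

Lemma step_down_le1 m v : step_down m v <= 1.
Proof.
rewrite exprn_ile1// ?le_max ?lexx ?orbT// ge_max ler01 andbT gerBl.
by rewrite exprn_ge0// le_max lexx orbT.
Qed.

Lemma step_down1 m v : v <= 0 -> step_down m.+1 v = 1.
Proof.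
move=> v0; rewrite /step_down /pospow (max_r v0) expr0n subr0.
by rewrite (max_l ler01) expr1n.
Qed.

Lemma step_down0 m v : 1 <= v -> step_down m.+1 v = 0.
Proof.
move=> v1; rewrite /step_down /pospow (max_l (le_trans ler01 v1)).
by rewrite max_r ?expr0n// subr_le0 exprn_ege1.
Qed.

(** Each of the two truncated powers contributes a factor m + 1, but only for arguments at most 1;
    larger arguments are replaced by 1, where the step already vanishes. *)
Lemma step_down_lipschitz m v w :
  `|step_down m.+1 v - step_down m.+1 w| <= m.+1%:R ^+ 2 * `|v - w|.
Proof.
have ge0 (u : R) : 0 <= pospow m.+1 u by rewrite exprn_ge0// le_max lexx orbT.
have H (a b : R) : a <= 1 -> b <= 1 ->
    `|step_down m.+1 a - step_down m.+1 b| <= m.+1%:R ^+ 2 * `|a - b|.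
  move=> a1 b1; apply: le_trans (pospow_lipschitz _ _ _) _; rewrite ?gerBl ?ge0//.
  rewrite expr2 -mulrA ler_wpM2l// distrC (le_trans _ (pospow_lipschitz _ a1 b1))//.
  by rewrite le_eqVlt; apply/orP; left; apply/eqP; congr (`| _ |); ring.
wlog vw : v w / v <= w.
  move=> W; have [|/ltW] := leP v w; first exact: W.
  by move=> /W; rewrite distrC [X in _ <= _ * X]distrC.
have [w1|w1] := leP w 1; first by apply: H => //; exact: le_trans w1.
rewrite (step_down0 _ (ltW w1)); have [v1|v1] := leP v 1; last first.
  by rewrite (step_down0 _ (ltW v1)) subrr normr0 mulr_ge0// exprn_ge0.
rewrite -(step_down0 m (lexx 1)) (le_trans (H _ _ v1 (lexx _)))// ler_wpM2l ?exprn_ge0//.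
by rewrite distrC [leRHS]distrC !ger0_norm ?subr_ge0// lerD2r ltW.
Qed.

End ScalarComposition.

(** * The cutoff on R^n *)

Section Cutoff.
Variables (R : realType) (n : nat).

(** A smooth stand-in for the size of [x], since [N] need not be differentiable. The summand 1 keeps
    the logarithm defined at the origin. *)
Definition sqsum (x : 'cV[R]_n) : R := 1 + \sum_i x i 0 * x i 0.

Lemma sqsum_ge1 x : 1 <= sqsum x.
Proof. by rewrite lerDl sumr_ge0// => i _; rewrite -expr2 sqr_ge0. Qed.

Lemma sqsum_gt0 x : 0 < sqsum x.
Proof. exact: lt_le_trans (sqsum_ge1 x). Qed.

Lemma sqr_norm_le (x : 'cV[R]_n) : `|x| ^+ 2 <= \sum_i x i 0 * x i 0.
Proof.
have S0 : 0 <= \sum_i x i 0 * x i 0 by rewrite sumr_ge0// => i _; rewrite -expr2 sqr_ge0.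
rewrite -(sqr_sqrtr S0) ler_pXn2r ?nnegrE ?sqrtr_ge0//.
apply/mx_norm_leP; first exact: sqrtr_ge0.
move=> i j; rewrite ord1 -sqrtr_sqr ler_wsqrtr// (bigD1 i)//= -expr2 lerDl.
by rewrite sumr_ge0// => l _; rewrite -expr2 sqr_ge0.
Qed.

Lemma joint_Ck_lnsqsum (T : topologicalType) k : joint_Ck k (fun (_ : T) (x : 'cV[R]_n) => ln (sqsum x)).
Proof.
apply: joint_Ck_ln; first by move=> _ x; exact: sqsum_gt0.
apply: joint_Ck_add; first exact: joint_Ck_cst.
by apply: joint_Ck_sum => i; apply: joint_Ck_mul; exact: joint_Ck_coord.
Qed.

(* The logarithm makes the slope at [y] of order [1 / |y|]. *)
Lemma lnsqsum_slope (x y : 'cV[R]_n) :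
  ln (sqsum x) - ln (sqsum y) <= 4 * n%:R * `|x - y| / (1 + `|y|).
Proof.
set d := `|x - y|; set Y := `|y|.
have d0 : 0 <= d by exact: normr_ge0.
have Y0 : 0 <= Y by exact: normr_ge0.
have Y1 : 0 < 1 + Y by rewrite ltr_pwDl.
(* Chosen so that [sqsum x <= sqsum y * (1 + a) ^+ 2]; then the logarithms differ by at most 2 ln(1
   + a) <= 2a. *)
pose a := 2 * n%:R * d / (1 + Y).
have a0 : 0 <= a by rewrite divr_ge0// ?mulr_ge0// ltW.
have -> : 4 * n%:R * d / (1 + Y) = 2 * a by rewrite /a; field; rewrite gt_eqF.
have qy : (1 + Y) ^+ 2 / 2 <= sqsum y.
  rewrite ler_pdivrMr// (@le_trans _ _ ((1 + Y ^+ 2) * 2))//; last first.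
    by rewrite ler_wpM2r// lerD2l; exact: sqr_norm_le.
  by have := sqr_ge0 (1 - Y); nra.
have S : sqsum x <= sqsum y + 2 * n%:R * d * Y + n%:R * d ^+ 2.
  rewrite /sqsum -!addrA lerD2l addrA.
  have -> : \sum_i y i 0 * y i 0 + 2 * n%:R * d * Y + n%:R * d ^+ 2 =
      \sum_(i < n) (y i 0 * y i 0 + (2 * d * Y + d ^+ 2)).
    by rewrite big_split /= sumr_const card_ord -mulr_natl; ring.
  apply: ler_sum => i _.
  have -> : x i 0 = y i 0 + (x - y) i 0 by rewrite !mxE; ring.
  set e := (x - y) i 0; have ed : `|e| <= d by exact: coord_le_norm.
  have yY : `|y i 0| <= Y by exact: coord_le_norm.
  have -> : (y i 0 + e) * (y i 0 + e) = y i 0 * y i 0 + (2 * (e * y i 0) + e ^+ 2) by ring.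
  rewrite lerD2l lerD//.
    rewrite -mulrA ler_wpM2l// (le_trans (ler_norm _))// normrM ler_pM//.
  by rewrite -real_normK ?num_real// ler_pXn2r ?nnegrE.
have Sa : sqsum x <= sqsum y * (1 + a) ^+ 2.
  apply: (le_trans S); rewrite -addrA.
  have -> : sqsum y * (1 + a) ^+ 2 = sqsum y + sqsum y * (2 * a + a ^+ 2) by ring.
  rewrite lerD2l (@le_trans _ _ ((1 + Y) ^+ 2 / 2 * (2 * a + a ^+ 2)))//; last first.
    by apply: ler_wpM2r qy; apply: addr_ge0; [exact: mulr_ge0|exact: exprn_ge0].
  have -> : (1 + Y) ^+ 2 / 2 * (2 * a + a ^+ 2) =
      2 * n%:R * d * (1 + Y) + 2 * n%:R ^+ 2 * d ^+ 2.
    by rewrite /a; field; rewrite gt_eqF.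
  have n2 : (n%:R : R) <= 2 * n%:R ^+ 2.
    rewrite -natrX -natrM ler_nat; case: (n) => // m.
    by rewrite expnS expn1 mulnA; apply: leq_pmull.
  apply: lerD; first by rewrite ler_wpM2l ?mulr_ge0// lerDr.
  by rewrite ler_wpM2r// exprn_ge0.
have a1 : 0 < 1 + a by rewrite ltr_pwDl.
rewrite lerBlDr.
have : ln (sqsum x) <= ln (sqsum y * (1 + a) ^+ 2).
  by rewrite ler_ln// ?posrE ?sqsum_gt0// mulr_gt0 ?exprn_gt0 ?sqsum_gt0.
move=> /le_trans; apply; rewrite lnM ?posrE ?sqsum_gt0 ?exprn_gt0// addrC lerD2r.
rewrite lnXn// -[leLHS]mulr_natl; apply: ler_wpM2l => //.
by apply: le_ln1Dx; rewrite (lt_le_trans _ a0)// ltrN10.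
Qed.

(* The weight [c0 + c1 * N x] is the growth of the vector field to be cut off. *)
Lemma cutoff (N : 'cV[R]_n -> R) (m : nat) (rho c0 c1 e : R) : is_norm N ->
  0 <= c0 -> 0 <= c1 -> 0 < e ->
  exists (chi : 'cV[R]_n -> R) (r : R),
  [/\ forall T : topologicalType, joint_Ck m (fun (_ : T) x => chi x),
      forall x, 0 <= chi x <= 1,
      forall x, N x <= rho -> chi x = 1,
      forall x, r < N x -> chi x = 0 &
      forall x y, N x <= N y -> `|chi x - chi y| * (c0 + c1 * N x) <= e * N (x - y)].
Proof.
move=> hN c00 c10 e0.
have [C C0 HC] := is_norm_upper hN; have [C' C'0 HC'] := is_norm_lower hN.
pose D := (m.+1%:R : R) ^+ 2 * (4 * n%:R * ((c0 + c1 * C) * C')).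
have D0 : 0 <= D.
  by rewrite !mulr_ge0// ?exprn_ge0// ?addr_ge0// ?mulr_ge0// ltW.
(* [D] collects the Lipschitz constant of the step, the slope of the logarithm and the comparison of
   norms; thus [d * D <= e]. *)
pose d := e / (1 + D).
have D1 : 0 < 1 + D by rewrite ltr_pwDl.
have d0 : 0 < d by rewrite divr_gt0.
(* An upper bound of [ln (sqsum x)] on the ball [N x <= rho], so that [v] is nonpositive there. *)
pose b := ln (1 + n%:R * (C' * rho) ^+ 2).
pose v x := d * (ln (sqsum x) - b).
(* [v x >= 1] once [sqsum x >= expR (b + d^-1)]. This follows from 1 + |x|^2 >= |x|, and [C]
   converts [N x] into |x|. *)
exists (fun x => step_down m.+1 (v x)), (C * expR (b + d^-1)).
split.
- move=> T; apply: joint_Ck_pospow => //; apply: joint_Ck_add; first exact: joint_Ck_cst.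
  apply: joint_Ck_opp; apply: joint_Ck_pospow => //; apply: joint_Ck_mul; first exact: joint_Ck_cst.
  by apply: joint_Ck_add; [exact: joint_Ck_lnsqsum|exact: joint_Ck_cst].
- by move=> x; rewrite step_down_ge0 step_down_le1.
- move=> x xr; apply: step_down1; rewrite /v pmulr_rle0// subr_le0.
  have S : sqsum x <= 1 + n%:R * (C' * rho) ^+ 2.
    rewrite lerD2l -[X in X%:R](card_ord n) mulr_natl -sumr_const ler_sum// => i _.
    rewrite -expr2 -real_normK ?num_real// lerXn2r ?nnegrE//.
      by rewrite (le_trans (normr_ge0 x))// (le_trans (HC' x))// ler_wpM2l// ltW.
    by rewrite (le_trans (coord_le_norm x i 0))// (le_trans (HC' x))// ler_wpM2l// ltW.
  by rewrite ler_ln ?posrE ?sqsum_gt0// (lt_le_trans (sqsum_gt0 x)).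
- move=> x xr; apply: step_down0; rewrite /v mulrC -ler_pdivrMr// div1r lerBrDl.
  rewrite -ler_expR lnK ?posrE ?sqsum_gt0//.
  have xE : expR (b + d^-1) <= `|x|.
    by rewrite -(ler_pM2l C0) (le_trans (ltW xr))// HC.
  rewrite (le_trans xE)// (@le_trans _ _ (1 + `|x| ^+ 2))//.
    by have := sqr_ge0 (`|x| - 1); have := normr_ge0 x; nra.
  by rewrite lerD2l sqr_norm_le.
- move=> x y xy.
  (* The slope estimate may be based at either point, hence holds with the smaller norm; as
     [N x <= N y], the weight at [x] is bounded by a multiple of [1 + mn]. *)
  pose mn := Num.min `|x| `|y|.
  have mn0 : 0 <= mn by rewrite le_min !normr_ge0.
  have mn1 : 0 < 1 + mn by rewrite ltr_pwDl.
  have H1 : c0 + c1 * N x <= (c0 + c1 * C) * (1 + mn).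
    have Nm : N x <= C * mn by rewrite /mn minr_pMr ?(ltW C0)// le_min HC (le_trans xy).
    rewrite mulrDr mulr1 -addrA lerD2l.
    rewrite (@le_trans _ _ (c1 * (C * mn)))// ?ler_wpM2l//.
    by rewrite mulrDl mulrA addrA lerDr addr_ge0 ?mulr_ge0// ltW.
  have H2 : `|v x - v y| <= d * (4 * n%:R * `|x - y| / (1 + mn)).
    have S z w : ln (sqsum z) - ln (sqsum w) <= 4 * n%:R * `|z - w| / (1 + Num.min `|z| `|w|).
      apply: (le_trans (lnsqsum_slope z w)); rewrite ler_wpM2l ?mulr_ge0//.
      have p1 : 0 < 1 + `|w| by rewrite ltr_pwDl.
      have p2 : 0 < 1 + Num.min `|z| `|w| by rewrite ltr_pwDl// le_min !normr_ge0.
      by rewrite lef_pV2// lerD2l ge_min lexx orbT.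
    have -> : v x - v y = d * (ln (sqsum x) - ln (sqsum y)) by rewrite /v; ring.
    rewrite normrM (gtr0_norm d0) ler_wpM2l ?(ltW d0)// ler_norml S andbT lerNl opprB.
    by have := S y x; rewrite distrC minC.
  apply: (le_trans (ler_wpM2r _ (step_down_lipschitz _ _ _))).
    by rewrite addr_ge0// mulr_ge0// is_norm_ge0.
  apply: (@le_trans _ _ ((m.+1%:R ^+ 2 * (d * (4 * n%:R * `|x - y| / (1 + mn)))) *
    ((c0 + c1 * C) * (1 + mn)))).
    apply: ler_pM => //.
      by rewrite addr_ge0// mulr_ge0// is_norm_ge0.
    by rewrite ler_wpM2l// exprn_ge0.
  have -> : (m.+1%:R ^+ 2 * (d * (4 * n%:R * `|x - y| / (1 + mn)))) *
    ((c0 + c1 * C) * (1 + mn)) = d * (m.+1%:R ^+ 2 * (4 * n%:R * ((c0 + c1 * C) * `|x - y|))).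
    by field; rewrite gt_eqF.
  apply: (@le_trans _ _ (d * (D * N (x - y)))).
    rewrite ler_wpM2l ?(ltW d0)// /D -!mulrA ler_wpM2l ?exprn_ge0//.
    do 3 (apply: ler_wpM2l => //).
    apply: ler_wpM2l; last exact: HC'.
    by rewrite addr_ge0// mulr_ge0// ltW.
  rewrite mulrA ler_wpM2r ?is_norm_ge0// /d -mulrA ler_piMr ?(ltW e0)//.
  by rewrite mulrC ler_pdivrMr// mul1r lerDr.
Qed.

End Cutoff.

(** * Stability of perturbed linear systems *)

Section HalfLine.
Variable R : realType.

(** The constant extension to negative times generally has a corner at 0, so only continuity is kept
    there. *)
Lemma has_deriv_Rplus_extend n (x : R -> 'cV[R]_n) (v : R -> 'cV[R]_n) :
  (forall t, 0 <= t -> has_deriv_Rplus x t (v t)) ->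
  continuous (fun t : R => x (Num.max t 0)) /\
  forall t : R, 0 < t -> is_derive t 1 (fun t : R => x (Num.max t 0)) (v t).
Proof.
move=> dx; split=> [t|t t0].
  have [t0|t0] := ltP t 0.
    apply: (@cvg_trans _ (cst (x 0) @ nbhs t)); last first.
      by rewrite (max_r (ltW t0)); exact: cvg_cst.
    apply: near_eq_cvg; have : \forall y \near t, y < 0 by exact: lt_nbhsl.
    by apply: filterS => y y0; rewrite (max_r (ltW y0)).
  rewrite /continuous_at (max_l t0); apply/cvgrPdist_le => e e0.
  have /cvgrPdist_le/(_ _ ltr01) [d /= d0 Hd] := dx t t0.
  pose c := `|v t| + 1.
  have c0 : 0 < c by rewrite ltr_wpDl.
  have nt (r : R) : 0 < r -> \forall u \near t, `|t - u| < r.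
    by have /cvgrPdist_lt := @cvg_id _ (nbhs t); exact.
  have ce : 0 < c^-1 * e by rewrite mulr_gt0// invr_gt0.
  apply: filterS2 (nt d d0) (nt _ ce) => u ud ue.
  set h := Num.max u 0 - t.
  have hu : `|h| <= `|u - t|.
    rewrite /h; have [u0|u0] := leP u 0 => //.
    rewrite sub0r normrN ger0_norm// distrC ger0_norm ?subr_ge0 ?(le_trans u0)//.
    by rewrite lerDl oppr_ge0.
  have -> : Num.max u 0 = t + h by rewrite /h addrC subrK.
  have [->|h0] := eqVneq h 0; first by rewrite addr0 subrr normr0 ltW.
  have th : 0 <= t + h by rewrite /h addrC subrK le_max lexx orbT.
  have hd : `|0 - h| < d.
    by rewrite sub0r normrN (le_lt_trans hu)// distrC.
  have := Hd h hd h0 th => H.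
  have {}H : `|h^-1 *: (x (t + h) - x t)| <= c.
    rewrite -[X in `|X|](subrK (v t)) (le_trans (ler_normD _ _))// addrC lerD2l.
    by rewrite distrC.
  move: H; rewrite normrZ normfV mulrC ler_pdivrMr ?normr_gt0// distrC => /le_trans; apply.
  by rewrite -ler_pdivlMl// (le_trans hu)// distrC ltW.
apply/is_deriveP; have /cvgrPdist_le H := dx t (ltW t0).
apply/cvgrPdist_le => e e0; have [d /= d0 Hd] := H e e0.
exists (Num.min d t) => /=; first by rewrite lt_min d0 t0.
move=> h /=; rewrite sub0r normrN lt_min => /andP[hd ht] h0.
have th : 0 < h + t by rewrite -ltrBlDr sub0r; move: ht; rewrite ltr_norml => /andP[].
rewrite [h *: 1]mulr1 (max_l (ltW th)) (max_l (ltW t0)) addrC [h + t]addrC addrC.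
by apply: Hd => //=; [rewrite sub0r normrN|rewrite addrC ltW].
Qed.

Lemma has_deriv_Rplus_restrict n (x y : R -> 'cV[R]_n) (t : R) v :
  (forall s, 0 <= s -> x s = y s) -> 0 <= t -> is_derive t 1 y v -> has_deriv_Rplus x t v.
Proof.
move=> xy t0 /is_deriveP/cvgrPdist_le H; apply/cvgrPdist_le => e e0.
have [d /= d0 Hd] := H e e0; exists d => // h /= hd h0 th.
have := Hd h hd h0; rewrite [h *: 1]mulr1 addrC [h + t]addrC addrC.
by rewrite -!xy.
Qed.

End HalfLine.

Section Stability.
Variables (R : realType) (n : nat).

Lemma continuous_trmx (X : topologicalType) m p (A : X -> 'M[R]_(m, p)) :
  continuous A -> continuous (fun x => (A x)^T).
Proof.
move=> cA; apply/continuous_mxP => i j.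
have -> : (fun x => (A x)^T i j) = (fun x => A x j i) by apply/funext => x; rewrite mxE.
exact: continuous_coord.
Qed.

(* The rows of [Z] solve the adjoint equation [w' = - A^T w]. *)
Lemma adjoint_exists (A : R -> 'M[R]_n) : continuous A ->
  exists Z : R -> 'M[R]_n, [/\ Z 0 = 1%:M, continuous Z &
    forall (y : R -> 'cV[R]_n) g (t : R), is_derive t 1 y (A t *m y t + g) ->
      is_derive t 1 (fun s => Z s *m y s) (Z t *m g)].
Proof.
move=> cA.
have H i : exists2 w : R -> 'cV[R]_n, w 0 = delta_mx i 0 &
    forall s : R, is_derive s 1 w ((- (A s)^T) *m w s).
  apply: (@picard R n (fun s w => (- (A s)^T) *m w) (fun s => \sum_i \sum_l `|(- (A s)^T) i l|)).
  - apply: continuous_mulmx; last by cont.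
    apply: continuous_opp; apply: continuous_trmx; apply: (continuous_compT cA).
    by cont.
  - by apply: continuous_lip; apply: continuous_opp; exact: continuous_trmx.
  - by move=> s y y'; rewrite -mulmxBr; exact: mulmx_norm_le.
pose W i := s2val (cid2 (H i)).
have W0 i : W i 0 = delta_mx i 0 by rewrite /W; case: cid2.
have dW i (s : R) : is_derive s 1 (W i) ((- (A s)^T) *m W i s) by rewrite /W; case: cid2.
exists (fun s => \matrix_(i, k) W i s k 0); split.
- by apply/matrixP => i j; rewrite !mxE W0 mxE eqxx andbT eq_sym.
- apply/continuous_mxP => i j; under eq_fun do rewrite mxE; apply: continuous_coord.
  by move=> s; exact: is_derive_continuous (dW i s).
move=> y g t /is_derive_mxP dy; apply/is_derive_mxP => i j; rewrite ord1.
have dWi := (is_derive_mxP _ _ _ _).1 (dW i t).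
have := is_derive_sum (fun k => is_deriveM (dWi k 0) (dy k 0)).
congr is_derive.
  by apply/funext => s; rewrite fct_sumE mxE; apply: eq_bigr => k _; rewrite mxE.
rewrite big_split /= !mxE; under [X in X + _ = _]eq_bigr do rewrite mxE scalerDr.
rewrite big_split /= addrAC; under [RHS]eq_bigr do rewrite mxE.
rewrite -[RHS]add0r; congr (_ + _).
rewrite -[RHS](subrr (\sum_k W i t k 0 * (A t *m y t) k 0)); congr (_ + _).
rewrite -sumrN.
transitivity (\sum_k \sum_l - (W i t l 0 * A t l k * y t k 0)).
  apply: eq_bigr => k _; rewrite mxE [_ *: _]mulr_sumr.
  by apply: eq_bigr => l _; rewrite !mxE; ring.
rewrite exchange_big; apply: eq_bigr => l _; rewrite mxE mulr_sumr -sumrN.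
by apply: eq_bigr => k _; rewrite mulrA.
Qed.

Lemma is_derive_const_mx (f : R -> R) (t df : R) :
  is_derive t 1 f df -> is_derive t 1 (fun s => const_mx (f s) : 'cV[R]_1) (const_mx df).
Proof.
move=> H; apply/is_derive_mxP => i j; rewrite mxE.
by move: H; congr is_derive; apply/funext => s; rewrite mxE.
Qed.

Lemma norm_const_mx1 (a : R) : `|const_mx a : 'cV[R]_1| = `|a|.
Proof.
apply/eqP; rewrite eq_le; apply/andP; split.
  by apply/mx_norm_leP => // i j; rewrite mxE.
by have := coord_le_norm (const_mx a : 'cV[R]_1) 0 0; rewrite mxE.
Qed.

Lemma first_crossing_real (p dp phi dphi : R -> R) (a b : R) :
  (forall s : R, is_derive s 1 p (dp s)) -> (forall s : R, is_derive s 1 phi (dphi s)) ->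
  `|p a| < phi a ->
  (forall s, a < s <= b -> `|p s| = phi s -> `|dp s| < dphi s) ->
  forall s, a <= s <= b -> `|p s| < phi s.
Proof.
move=> dp_ dphi_ pa H s sab; rewrite -norm_const_mx1.
apply: (@first_crossing R 1 _ (@normr_is_norm R 1) (fun s => const_mx (p s))
  (fun s => const_mx (dp s)) phi dphi a b) => //.
- by move=> r; exact: is_derive_continuous (is_derive_const_mx (dp_ r)).
- by move=> r; exact: is_derive_continuous (dphi_ r).
- by move=> r _; exact: is_derive_const_mx.
- by rewrite norm_const_mx1.
- by move=> r rab; rewrite !norm_const_mx1; exact: H.
Qed.
End Stability.

(** * Exponential estimates under Lipschitz and bounded perturbations *)

Section LinearStability.
Variables (R : realType) (n : nat) (N : 'cV[R]_n -> R).
Hypothesis hN : is_norm N.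
Variables (A : R -> 'M[R]_n) (Phi : R -> R -> 'M[R]_n) (K alpha : R).
Hypothesis cA : continuous A.
Hypothesis Phi_id : forall s, 0 <= s -> Phi s s = 1%:M.
Hypothesis cPhi : forall s (v : 'cV[R]_n), 0 <= s -> continuous (fun u : R => Phi (Num.max u 0) s *m v).
Hypothesis dPhi : forall s (v : 'cV[R]_n) (t : R), 0 <= s -> 0 < t ->
  is_derive t 1 (fun u : R => Phi (Num.max u 0) s *m v) (A t *m (Phi t s *m v)).
Hypothesis K0 : 0 <= K.
Hypothesis stable : forall t s (v : 'cV[R]_n), 0 <= s -> s <= t ->
  N (Phi t s *m v) <= K * expR (- alpha * (t - s)) * N v.

(** The adjoint property makes [Z u *m Phi u r] constant in [u], so [Z] inverts [Phi u 0]. The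
    factorisation gives access to derivatives in the second argument of [Phi], as variation of
    constants requires. *)
Lemma transition_factor : exists Z : R -> 'M[R]_n,
  [/\ continuous Z,
      forall (y : R -> 'cV[R]_n) g (t : R), is_derive t 1 y (A t *m y t + g) ->
        is_derive t 1 (fun s => Z s *m y s) (Z t *m g) &
      forall t s, 0 <= t -> 0 <= s -> Phi t s = Phi t 0 *m Z s].
Proof.
have [Z [Z0 cZ dZ]] := adjoint_exists cA; exists Z; split=> // t s t0 s0.
have ZPhi r u : 0 <= r -> 0 <= u -> Z u *m Phi u r = Z r.
  move=> r0 u0; have H (v : 'cV[R]_n) : Z u *m (Phi u r *m v) = Z r *m v.
    pose w (u : R) := Z u *m (Phi (Num.max u 0) r *m v).
    have cw : continuous w by apply: continuous_mulmx => //; exact: cPhi.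
    have dw (a : R) : 0 < a -> is_derive a 1 w 0.
      move=> a0; rewrite -(mulmx0 _ (Z a)); apply: dZ.
      by rewrite addr0 (max_l (ltW a0)); exact: dPhi.
    have wE a : 0 <= a -> w a = w 0.
      apply: (@ode_unique_half_line R n (fun _ _ => 0) (fun=> 0) _ _ w (cst (w 0))) => //.
      - exact: cst_continuous.
      - by move=> *; rewrite subrr normr0 mul0r.
      - exact: cst_continuous.
    have := wE u u0; rewrite -(wE r r0) /w (max_l u0) (max_l r0) Phi_id// mul1mx.
    exact.
  apply/matrixP => i j; have := H (delta_mx j 0).
  by rewrite mulmxA -!colE => /matrixP/(_ i 0); rewrite ![col _ _ _ _]mxE.
have PZ u : 0 <= u -> Phi u 0 *m Z u = 1%:M.
  move=> u0; apply: mulmx1C; rewrite ZPhi//.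
by rewrite -(ZPhi s t s0 t0) mulmxA PZ// mul1mx.
Qed.

(* Variation of constants, then comparison of [K N(y s) + psi t - psi s] with
   the explicit solution of the resulting scalar inequality. *)
Lemma stability (gam mu : R) (y g : R -> 'cV[R]_n) (s t : R) :
  0 <= gam -> 0 <= mu -> K * gam < alpha ->
  continuous y -> (forall u : R, 0 < u -> is_derive u 1 y (A u *m y u + g u)) ->
  (forall u, 0 < u -> N (g u) <= gam * N (y u) + mu) -> 0 <= s -> s <= t ->
  N (y t) <= K * expR (- (alpha - K * gam) * (t - s)) * N (y s) + K * mu / (alpha - K * gam).
Proof.
move=> gam0 mu0 Kg cy dy Ng s0 st.
have cN := is_norm_continuous hN.
have [Z [cZ dZ PhiZ]] := transition_factor.
pose b := alpha - K * gam; have b0 : 0 < b by rewrite subr_gt0.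
(* The integrand in the variation-of-constants bound, multiplied by the growing exponential; [psi]
   is its primitive. *)
pose h u := K * expR (alpha * (u - s)) * (gam * N (y u) + mu).
have cexp : continuous (fun u : R => expR (alpha * (u - s))).
  have -> : (fun u : R => expR (alpha * (u - s))) = (fun u => 1 * expR (alpha * (u - s))).
    by apply/funext => u; rewrite mul1r.
  by move=> u; exact: is_derive_continuous (is_derive_exp_affine 1 alpha s u).
have ch : continuous h.
  apply: continuous_mul; first by apply: continuous_mul => //; cont.
  apply: continuous_add; last by cont.
  by apply: continuous_mul; [cont|exact: (continuous_compT cN cy)].
have [psi psi0 dpsi] := primitive ch.
have voc r : s <= r -> expR (alpha * (r - s)) * N (y r) <= K * N (y s) + (psi r - psi s).
  move=> sr; have r0 : 0 <= r by exact: le_trans sr.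
  (* For nonnegative [u] this is [Phi r u *m y u], whose derivative keeps only the perturbation
     term. *)
  pose w (u : R) := Phi r 0 *m (Z u *m y u).
  have dw (u : R) : 0 < u -> is_derive u 1 w (Phi r 0 *m (Z u *m g u)).
    by move=> u0; apply: is_derive_mulmx; apply: dZ; exact: dy.
  have cw : continuous w by apply: continuous_mulmx; [cont|exact: continuous_mulmx].
  have wE u : 0 <= u -> w u = Phi r u *m y u by move=> u0; rewrite /w mulmxA -PhiZ.
  have e0 : 0 < expR (- alpha * (r - s)) by exact: expR_gt0.
  have H : N (w r - w s) <= expR (- alpha * (r - s)) * (psi r - psi s).
    apply: (@mean_value_ineq R n N hN (w - cst (w s)) (fun u => Phi r 0 *m (Z u *m g u))
      (fun u => expR (- alpha * (r - s)) * (psi u - psi s))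
      (fun u => expR (- alpha * (r - s)) * h u) s r) => //.
    - by apply: continuous_add => //; apply: continuous_opp; exact: cst_continuous.
    - apply: continuous_mul; first by cont.
      apply: continuous_add; last by cont.
      by move=> u; exact: is_derive_continuous (dpsi u).
    - move=> u /andP[su _]; rewrite -[X in is_derive _ _ _ X]subr0.
      by apply: is_deriveB; apply: dw; exact: le_lt_trans su.
    - move=> u _; have := is_deriveZ (expR (- alpha * (r - s)))
        (is_deriveB (dpsi u) (is_derive_cst (psi s) u 1)).
      by rewrite subr0.
    - by rewrite [X in N X](_ : _ = 0) ?is_norm0// ?subrr ?mulr0//; apply/eqP; rewrite subr_eq0.
    - move=> u /andP[su ur]; have u0 : 0 < u by exact: le_lt_trans su.
      rewrite mulmxA -PhiZ// ?(ltW u0)// (le_trans (stable _ (ltW u0) ur))//.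
      apply: (le_trans (ler_wpM2l _ (Ng u u0))); first by rewrite mulr_ge0 ?expR_ge0.
      rewrite /h.
      have -> : expR (- alpha * (r - u)) = expR (- alpha * (r - s)) * expR (alpha * (u - s)).
        by rewrite -expRD; congr expR; ring.
      by rewrite le_eqVlt; apply/orP; left; apply/eqP; ring.
    - by rewrite sr lexx.
  rewrite wE// Phi_id// mul1mx wE// in H.
  rewrite -(ler_pM2l e0) mulrA -expRD [X in expR X](_ : _ = 0) ?expR0 ?mul1r; last by ring.
  rewrite -(subrK (Phi r s *m y s) (y r)) (le_trans (norm_triangle hN _ _))// addrC mulrDr lerD//.
  by rewrite mulrA [_ * K]mulrC stable.
pose p r := K * N (y s) + (psi r - psi s).
have dp (r : R) : is_derive r 1 p (h r).
  rewrite -[X in is_derive _ _ _ X]add0r; apply: is_deriveD.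
  by have := is_deriveB (dpsi r) (is_derive_cst (psi s) r 1); rewrite subr0.
have pb : p t <= K * N (y s) * expR (K * gam * (t - s)) + K * mu / b * expR (alpha * (t - s)).
  apply: (@le_of_le_mul _ _ _ (expR ((K * gam + 1) * (t - s)))) => d d0.
  (* The first two terms solve p' = K gam p + K mu e^(alpha (r - s)), whence the denominator [b];
     the term with [d] makes the barrier strict. *)
  pose phi r := (K * N (y s) * expR (K * gam * (r - s)) + K * mu / b * expR (alpha * (r - s)))
    + d * expR ((K * gam + 1) * (r - s)).
  have dphi (r : R) : is_derive r 1 phi
     (K * gam * (K * N (y s) * expR (K * gam * (r - s))) +
      alpha * (K * mu / b * expR (alpha * (r - s))) +
      (K * gam + 1) * (d * expR ((K * gam + 1) * (r - s)))).
    by apply: is_deriveD; [apply: is_deriveD|]; exact: is_derive_exp_affine.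
  apply: (le_trans (ler_norm _)); apply/ltW.
  apply: (@first_crossing_real R p h phi _ s t dp dphi) => //; last by rewrite st lexx.
    rewrite /p /phi !subrr !mulr0 expR0 !mulr1 addr0 ger0_norm ?mulr_ge0 ?is_norm_ge0//.
    by rewrite -addrA ltrDl ltr_wpDl// divr_ge0 ?(ltW b0)// mulr_ge0.
  move=> r /andP[sr _] Er.
  have h0 : 0 <= h r by rewrite /h !mulr_ge0// ?expR_ge0// addr_ge0// mulr_ge0// is_norm_ge0.
  rewrite ger0_norm//.
  have : h r <= K * gam * phi r + K * mu * expR (alpha * (r - s)).
    rewrite -Er (@le_trans _ _ (K * gam * p r + K * mu * expR (alpha * (r - s))))//.
      have := voc r (ltW sr); rewrite -/(p r) => /(ler_wpM2l (mulr_ge0 K0 gam0)) H.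
      have -> : h r = K * gam * (expR (alpha * (r - s)) * N (y r)) + K * mu * expR (alpha * (r - s)).
        by rewrite /h; ring.
      by rewrite lerD2r.
    by rewrite lerD2r ler_wpM2l ?ler_norm// mulr_ge0.
  move=> /le_lt_trans; apply.
  rewrite /phi; set E1 := expR (K * gam * (r - s)); set E2 := expR (alpha * _).
  set E3 := expR _; have E30 : 0 < d * E3 by rewrite mulr_gt0// expR_gt0.
  have -> : alpha * (K * mu / b * E2) = K * gam * (K * mu / b * E2) + K * mu * E2.
    have -> : alpha = b + K * gam by rewrite /b subrK.
    by field; rewrite gt_eqF.
  have : K * gam * (d * E3) < (K * gam + 1) * (d * E3) by rewrite ltr_pM2r// ltrDl.
  set X := d * E3; set X2 := K * mu / b * E2; set X1 := K * N (y s) * E1; set kg := K * gam.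
  lra.
have e0 : 0 < expR (alpha * (t - s)) by exact: expR_gt0.
rewrite -(ler_pM2l e0) (le_trans (voc t st))// (le_trans pb)//.
rewrite [leRHS]mulrDr lerD//; last by rewrite mulrC.
rewrite le_eqVlt; apply/orP; left; apply/eqP.
have -> : expR (K * gam * (t - s)) =
    expR (alpha * (t - s)) * expR (- (alpha - K * gam) * (t - s)).
  by rewrite -expRD; congr expR; ring.
by ring.
Qed.
End LinearStability.

(** * The conjugacies *)

Section EventualMatching.
Variables (R : realType) (n : nat) (N : 'cV[R]_n -> R).
Hypothesis hN : is_norm N.
Implicit Types (H G Y Z F : R -> 'cV[R]_n -> 'cV[R]_n).

(** Boundedness on balls makes the notion stable under composition; for the inverse map it yields
    the uniform divergence at infinity. *)
Definition equicont_bounded H :=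
  (forall C e, 0 < e -> exists2 d, 0 < d & forall t x x', 0 <= t ->
     N x <= C -> N x' <= C -> N (x - x') < d -> N (H t x - H t x') < e) /\
  (forall C, exists C', forall t x, 0 <= t -> N x <= C -> N (H t x) <= C').

Lemma equicont_bounded_comp H G : equicont_bounded H -> equicont_bounded G -> equicont_bounded (fun t x => G t (H t x)).
Proof.
move=> [eH bH] [eG bG]; split=> [C e e0|C].
  have [C' HC'] := bH C; have [d d0 Hd] := eG C' e e0; have [d' d'0 Hd'] := eH C d d0.
  by exists d' => // t x x' t0 xC xC' xx; apply: Hd => //; [exact: HC'|exact: HC'|exact: Hd'].
have [C' HC'] := bH C; have [C'' HC''] := bG C'.
by exists C'' => t x t0 xC; apply: HC'' => //; exact: HC'.
Qed.

Lemma equicont_bounded_ext H G : (forall t x, 0 <= t -> H t x = G t x) -> equicont_bounded H -> equicont_bounded G.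
Proof.
move=> HG [eH bH]; split=> [C e e0|C].
  by have [d d0 Hd] := eH C e e0; exists d => // t x x' t0; rewrite -!HG//; exact: Hd.
by have [C' HC'] := bH C; exists C' => t x t0; rewrite -HG//; exact: HC'.
Qed.

Lemma equicont_bounded_equivalence_map H G :
  equicont_bounded H -> equicont_bounded G -> (forall t, 0 <= t -> cancel (H t) (G t) /\ cancel (G t) (H t)) ->
  (forall i, joint_Ck 0 (fun t x => H t x i 0)) -> (forall i, joint_Ck 0 (fun t x => G t x i 0)) ->
  equivalence_map N H.
Proof.
move=> [eH bH] [eG bG] HG JH JG; split.
- move=> x0 e e0; have [d d0 Hd] := eH (N x0 + 1) e e0.
  exists (Num.min d 1); first by rewrite lt_min d0 ltr01.
  move=> x; rewrite lt_min => /andP[xd x1] t t0; apply: Hd => //.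
    rewrite addrC -{1}(subrK x0 x) (le_trans (norm_triangle hN _ _))// lerD2r.
    exact: ltW.
  by rewrite lerDl.
- move=> B; have [C HC] := bG B; exists C => x Cx t t0; rewrite ltNge; apply/negP => HB.
  by have := HC t (H t x) t0 HB; rewrite (HG t t0).1 leNgt Cx.
- move=> t t0; exists (G t); have [HGt GHt] := HG t t0; split=> //.
    apply: (continuous_compT (joint_Ck_vec_continuous JH) (f := fun x => (t, x))); cont.
  apply: (continuous_compT (joint_Ck_vec_continuous JG) (f := fun x => (t, x))); cont.
- by apply: continuous_subspaceT; exact: joint_Ck_vec_continuous JH.
Qed.

(** All that the conjugacies use of a flow. The constants are shared, so that different flows can be
    compared; the rate [L + 1] is the one produced by [gronwall]. *)
Record stable_flow (L K b rho : R) F Y Z : Prop := StableFlow {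
  flow_start : forall x, Y 0 x = x;
  flow_deriv : forall x (t : R), is_derive t 1 (Y ^~ x) (F t (Y t x));
  flow_cancel : forall t, cancel (Y t) (Z t) /\ cancel (Z t) (Y t);
  field_lip : forall t y y', N (F t y - F t y') <= L * N (y - y');
  flow_lip : forall x x' s t,
    N (Y s x - Y s x') <= expR ((L + 1) * `|s - t|) * N (Y t x - Y t x');
  flow_contract : forall x x' s t, 0 <= s -> s <= t ->
    N (Y t x - Y t x') <= K * expR (- b * (t - s)) * N (Y s x - Y s x');
  flow_absorb : forall x s t, 0 <= s -> s <= t ->
    N (Y t x) <= K * expR (- b * (t - s)) * N (Y s x) + rho }.

Lemma exp_decay (b C e : R) : 0 < b -> 0 < e ->
  exists2 c, 0 <= c & forall c', c <= c' -> expR (- b * c') * C <= e.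
Proof.
move=> b0 e0; pose c := `|C| / (e * b).
have c0 : 0 <= c by rewrite divr_ge0// mulr_ge0// ltW.
exists c => // c' cc'.
have E0 : 0 < expR (b * c') by exact: expR_gt0.
rewrite mulNr expRN mulrC ler_pdivrMr// (le_trans (ler_norm _))//.
have -> : `|C| = e * (b * c) by rewrite /c; field; rewrite !gt_eqF.
rewrite ler_wpM2l ?(ltW e0)//.
apply: (@le_trans _ _ (1 + b * c')); last exact: expR_ge1Dx.
by rewrite (@le_trans _ _ (b * c'))// ?ler_pM2l// lerDr.
Qed.

Variables (L K b rho : R).
Hypotheses (L0 : 0 <= L) (K0 : 0 <= K) (b0 : 0 < b) (rho0 : 0 <= rho).
Variables (Fa Ya Za Fb Yb Zb : R -> 'cV[R]_n -> 'cV[R]_n).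
Hypothesis fa : stable_flow L K b rho Fa Ya Za.
Hypothesis fb : stable_flow L K b rho Fb Yb Zb.

Lemma bounded_difference_equicont_bounded D :
  (forall t x, 0 <= t -> N (Ya t x - Yb t x) <= D) -> equicont_bounded (fun t x => Ya t (Zb t x)).
Proof.
move=> HD; have YZ t x : Yb t (Zb t x) = x by have [_] := flow_cancel fb t; apply.
have bnd t x : 0 <= t -> N (Ya t (Zb t x)) <= D + N x.
  move=> t0; rewrite -[in leLHS](subrK x (Ya t (Zb t x))) (le_trans (norm_triangle hN _ _))//.
  by rewrite lerD2r -{2}(YZ t x); exact: HD.
split=> [C e e0|C]; last first.
  by exists (D + C) => t x t0 xC; rewrite (le_trans (bnd t x t0))// lerD2l.
have D0 : 0 <= D by rewrite (le_trans _ (HD 0 0 (lexx 0)))// is_norm_ge0.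
(* After a time [l] the contraction reduces the separation [D + D], which bounded difference allows,
   to at most [e / 2]. *)
have [l l0 Hl] := @exp_decay b (K * (D + D)) (e / 2) b0 (divr_gt0 e0 (ltr0n _ 2)).
pose E := expR ((L + 1) * l).
have E0 : 0 < E by exact: expR_gt0.
have K1 : 0 < 1 + K by rewrite ltr_pwDl.
exists (e / (2 * (1 + K) * E)); first by rewrite divr_gt0// !mulr_gt0.
move=> t x x' t0 _ _ xx.
set u := Zb t x; set u' := Zb t x'.
have small : K * (E * N (x - x')) < e / 2.
  apply: (@le_lt_trans _ _ ((1 + K) * (E * N (x - x')))).
    by rewrite ler_wpM2r ?mulr_ge0 ?is_norm_ge0 ?(ltW E0)// lerDr.
  rewrite mulrA -ltr_pdivlMl ?mulr_gt0//.
  apply: (lt_le_trans xx); rewrite le_eqVlt; apply/orP; left; apply/eqP; field.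
  by rewrite !gt_eqF.
have back s : 0 <= s -> `|s - t| <= l -> N (Yb s u - Yb s u') <= E * N (x - x').
  move=> s0 st; apply: (le_trans (flow_lip fb u u' s t)).
  rewrite !YZ ler_wpM2r ?is_norm_ge0// ler_expR ler_wpM2l// addr_ge0//.
(* When [t < l] the restart is at time 0, where both flows are the identity and [D] does not
   enter. *)
have [lt|tl] := leP l t; last first.
  apply: (le_lt_trans (flow_contract fa u u' (lexx 0) t0)).
  rewrite !(flow_start fa) -(flow_start fb u) -(flow_start fb u').
  apply: (@le_lt_trans _ _ (K * (E * N (x - x')))).
    rewrite -mulrA ler_wpM2l// (@le_trans _ _ (N (Yb 0 u - Yb 0 u')))//.
      rewrite ler_piMl ?is_norm_ge0// -expR0 ler_expR mulNr oppr_le0 mulr_ge0 ?(ltW b0)//.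
      by rewrite subr0.
    by apply: back => //; rewrite sub0r normrN ger0_norm// ltW.
  by rewrite (lt_trans small)// gtr_pMr// invf_lt1// ltr1n.
have s0 : 0 <= t - l by rewrite subr_ge0.
have st : t - l <= t by rewrite gerBl.
apply: (le_lt_trans (flow_contract fa u u' s0 st)).
rewrite subKr.
have H : N (Ya (t - l) u - Ya (t - l) u') <= D + D + E * N (x - x').
  have -> : Ya (t - l) u - Ya (t - l) u' = (Ya (t - l) u - Yb (t - l) u) -
      (Ya (t - l) u' - Yb (t - l) u') + (Yb (t - l) u - Yb (t - l) u').
    by apply/matrixP => i j; rewrite !mxE; ring.
  rewrite (le_trans (norm_triangle hN _ _))// lerD//.
    by rewrite (le_trans (is_normB hN _ _))// lerD// HD.
  by apply: back => //; rewrite addrAC subrr sub0r normrN ger0_norm.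
apply: (le_lt_trans (ler_wpM2l _ H)); first by rewrite mulr_ge0 ?expR_ge0.
rewrite mulrDr [e]splitr ler_ltD//.
  by rewrite mulrAC mulrC Hl.
apply: le_lt_trans small; rewrite -mulrA ler_wpM2l// ler_piMl ?mulr_ge0 ?is_norm_ge0 ?(ltW E0)//.
by rewrite -expR0 ler_expR mulNr oppr_le0 mulr_ge0// ltW.
Qed.

Variable r : R.
Hypothesis rho_r : rho < r.
Hypothesis agree : forall t y, N y <= r -> Fa t y = Fb t y.

(* Gronwall, forward or backward from [T0]. *)
Lemma flows_agree x y T0 T : (forall s, T0 <= s \/ T <= s -> N (Ya s x) <= r) ->
  Ya T0 x = Yb T0 y -> Ya T x = Yb T y.
Proof.
move=> small E0.
have dD (s : R) : is_derive s 1 (fun s => Ya s x - Yb s y) (Fa s (Ya s x) - Fb s (Yb s y)).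
  exact: (is_deriveB (flow_deriv fa x s) (flow_deriv fb y s)).
have D0 : N (Ya T0 x - Yb T0 y) <= 0 by rewrite E0 subrr is_norm0.
apply/eqP; rewrite -subr_eq0; apply/eqP/(norm_eq0 hN)/eqP.
rewrite eq_le is_norm_ge0// andbT.
have [T0T|TT0] := leP T0 T.
  have := @gronwall R n N hN _ _ L 0 0 T0 T L0 (lexx 0) _ (fun s _ => dD s) D0 _ T.
  rewrite addr0 mul0r T0T lexx; apply=> //.
    by move=> s; exact: is_derive_continuous (dD s).
  move=> s /andP[T0s sT]; rewrite addr0 agree; first exact: field_lip fb _ _ _.
  by apply: small; left; exact: ltW.
have dD' (s : R) := is_deriveS (dD (T0 - s)).
have := @gronwall R n N hN _ _ L 0 0 0 (T0 - T) L0 (lexx 0) _ (fun s _ => dD' s) _ _ (T0 - T).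
rewrite subr0 subKr addr0 mul0r subr_ge0 (ltW TT0) lexx; apply=> //.
  by move=> s; exact: is_derive_continuous (dD' s).
move=> s /andP[s0 sT]; rewrite addr0 is_normN// agree; first exact: field_lip fb _ _ _.
by apply: small; right; rewrite lerBrDr addrC -lerBrDr.
Qed.

(** The margin [r - rho] makes the time finite, and it depends only on [C]: this is the source of
    the uniformity in [t]. *)
Lemma absorption_time C : exists2 c, 0 <= c & forall t x, 0 <= t -> N (Ya t x) <= C ->
  forall s, t + c <= s -> N (Ya s x) <= r.
Proof.
have [c c0 Hc] := @exp_decay b (K * C) (r - rho) b0 ltac:(by rewrite subr_gt0).
exists c => // t x t0 xC s cs.
have ts : t <= s by rewrite (le_trans _ cs)// lerDl.
apply: (le_trans (flow_absorb fa x t0 ts)).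
rewrite -lerBrDr mulrAC (le_trans _ (Hc (s - t) _)) ?lerBrDl//.
by rewrite mulrC ler_wpM2l ?expR_ge0// ler_wpM2l.
Qed.

Definition eventual_time C := s2val (cid2 (absorption_time C)).

(* Pairs trajectories that eventually coincide; the time is any one after which
   the trajectory of [x] stays in the ball of radius [r]. *)
Definition matching x := Zb (eventual_time (N x)) (Ya (eventual_time (N x)) x).

Lemma eventual_timeP C : 0 <= eventual_time C /\ forall t x, 0 <= t -> N (Ya t x) <= C ->
  forall s, t + eventual_time C <= s -> N (Ya s x) <= r.
Proof. by rewrite /eventual_time; case: cid2. Qed.

Lemma matchingP x T : 0 <= T -> (forall s, T <= s -> N (Ya s x) <= r) ->
  Yb T (matching x) = Ya T x.
Proof.
move=> T0 HT; have [c0 Hc] := eventual_timeP (N x).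
symmetry; apply: (@flows_agree x (matching x) (eventual_time (N x)) T).
  move=> s [cs|/HT]//; apply: (Hc 0) => //; first by rewrite (flow_start fa).
  by rewrite add0r.
by rewrite /matching; have [_ ->] := flow_cancel fb (eventual_time (N x)).
Qed.

Lemma matching_eventually x : exists2 T, 0 <= T &
  forall s, T <= s -> N (Ya s x) <= r.
Proof.
have [c0 Hc] := eventual_timeP (N x); exists (eventual_time (N x)) => // s cs.
by apply: (Hc 0) => //; [rewrite (flow_start fa)|rewrite add0r].
Qed.

Lemma equicont_bounded_matching : equicont_bounded (fun t x => Yb t (matching (Za t x))).
Proof.
have YZ t x : Ya t (Za t x) = x by have [_] := flow_cancel fa t; apply.
(* One later time serves the whole ball of radius [C] at time [t], and there the pairing is an
   equality of trajectories. *)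
have match_at C t x : 0 <= t -> N x <= C ->
    Yb (t + eventual_time C) (matching (Za t x)) = Ya (t + eventual_time C) (Za t x).
  move=> t0 xC; have [c0 Hc] := eventual_timeP C.
  by apply: matchingP; [rewrite addr_ge0|apply: (Hc t) => //; rewrite YZ].
split=> [C e e0|C].
  pose E := expR ((L + 1) * eventual_time C).
  have E0 : 0 < E by exact: expR_gt0.
  have [c0 Hc] := eventual_timeP C.
  exists (e / (E * E)); first by rewrite divr_gt0// mulr_gt0.
  move=> t x x' t0 xC xC' xx.
  apply: (le_lt_trans (flow_lip fb _ _ t (t + eventual_time C))).
  rewrite !(match_at C)// opprD addrA subrr sub0r normrN (ger0_norm c0) -/E.
  apply: (@le_lt_trans _ _ (E * (E * N (x - x')))).
    rewrite ler_wpM2l ?(ltW E0)// (le_trans (flow_lip fa _ _ _ t))// !YZ.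
    by rewrite [t + _]addrC addrK (ger0_norm c0).
  by rewrite mulrA -ltr_pdivlMl ?mulr_gt0// mulrC.
have [c0 Hc] := eventual_timeP C.
pose E := expR ((L + 1) * eventual_time C).
have E0 : 0 < E by exact: expR_gt0.
exists (E * (r + rho) + rho) => t x t0 xC.
(* [flow_lip] only compares two trajectories; the one from 0 serves as a bounded reference. *)
have ref s : 0 <= s -> N (Yb s 0) <= rho.
  move=> s0; apply: (le_trans (flow_absorb fb 0 (lexx 0) s0)).
  by rewrite (flow_start fb) is_norm0// mulr0 add0r.
rewrite -[X in N X](subrK (Yb t 0)) (le_trans (norm_triangle hN _ _))// lerD ?ref//.
apply: (le_trans (flow_lip fb _ _ t (t + eventual_time C))).
rewrite (match_at C)// opprD addrA subrr sub0r normrN (ger0_norm c0) -/E ler_wpM2l ?(ltW E0)//.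
rewrite (le_trans (is_normB hN _ _))// lerD ?ref ?addr_ge0//.
by apply: (Hc t) => //; rewrite YZ.
Qed.

(** [eventual_time (N x)] varies with [x] without any regularity. By [matchingP] it can be replaced
    near [x0] by one fixed time, the one for radius [N x0 + 1]. *)
Lemma joint_Ck_matching k : (forall i, joint_Ck k (fun t x => Ya t x i 0)) ->
  (forall i, joint_Ck k (fun t x => Zb t x i 0)) ->
  forall i, joint_Ck k (fun (_ : R) x => matching x i 0).
Proof.
move=> JY JZ i; apply: joint_Ck_local => x0.
pose T := eventual_time (N x0 + 1); have [c0 Hc] := eventual_timeP (N x0 + 1).
exists (fun _ x => Zb T (Ya T x) i 0).
  have cT : continuous (fun _ : R => T) by cont.
  exact: (joint_Ck_comp (joint_Ck_reparam cT (JZ i)) (fun l => joint_Ck_reparam cT (JY l))).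
have : \forall x \near x0, N x < N x0 + 1.
  have := is_norm_continuous hN (x := x0) => /cvgr_lt; apply.
  by rewrite ltrDl.
apply: filterS => x xN _.
have : Yb T (matching x) = Ya T x.
  apply: matchingP => // s Ts; apply: (Hc 0) => //; last by rewrite add0r.
  by rewrite (flow_start fa) ltW.
by move=> <-; have [-> _] := flow_cancel fb T.
Qed.

End EventualMatching.

(** * Flows of perturbed linear systems *)

Section PerturbedFlow.
Variables (R : realType) (n : nat) (N : 'cV[R]_n -> R).
Hypothesis hN : is_norm N.
Variables (A : R -> 'M[R]_n) (Phi : R -> R -> 'M[R]_n) (K alpha M : R).
Hypothesis cA : continuous A.
Hypothesis Phi_id : forall s, 0 <= s -> Phi s s = 1%:M.
Hypothesis cPhi : forall s (v : 'cV[R]_n), 0 <= s ->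
  continuous (fun u : R => Phi (Num.max u 0) s *m v).
Hypothesis dPhi : forall s (v : 'cV[R]_n) (t : R), 0 <= s -> 0 < t ->
  is_derive t 1 (fun u : R => Phi (Num.max u 0) s *m v) (A t *m (Phi t s *m v)).
Hypothesis K0 : 0 <= K.
Hypothesis stable : forall t s (v : 'cV[R]_n), 0 <= s -> s <= t ->
  N (Phi t s *m v) <= K * expR (- alpha * (t - s)) * N v.
Hypothesis M0 : 0 <= M.
Hypothesis AM : forall t v, N (A t *m v) <= M * N v.

(** [stability] is used twice: on the difference of two trajectories with constant term 0 for the
    contraction, and on one trajectory with constant term [mu] for the absorption. *)
Lemma perturbed_flow_exists k (g : R -> 'cV[R]_n -> 'cV[R]_n) (gam mu : R) :
  0 <= gam -> 0 <= mu -> K * gam < alpha ->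
  (forall i, joint_Ck k (fun t y => g t y i 0)) ->
  (forall t y y', N (g t y - g t y') <= gam * N (y - y')) ->
  (forall t y, N (g t y) <= gam * N y + mu) ->
  exists Y Z, [/\ stable_flow N (M + gam) K (alpha - K * gam) (K * mu / (alpha - K * gam))
      (fun t y => A t *m y + g t y) Y Z,
    forall i, joint_Ck k (fun t x => Y t x i 0) & forall i, joint_Ck k (fun t x => Z t x i 0)].
Proof.
move=> gam0 mu0 Kgam Jg gL gB; pose F t y := A t *m y + g t y.
have JF i : joint_Ck k (fun t y => F t y i 0).
  rewrite /F; under eq_fun do under eq_fun do rewrite mxE mxE.
  apply: joint_Ck_add => //; apply: joint_Ck_sum => l; apply: joint_Ck_mul; last exact: joint_Ck_coord.
  by apply: joint_Ck_time; exact: continuous_coord.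
have FN t y y' : N (F t y - F t y') <= (M + gam) * N (y - y').
  rewrite /F opprD addrACA -mulmxBr (le_trans (norm_triangle hN _ _))// mulrDl.
  by rewrite lerD.
have [C C0 HC] := is_norm_upper hN; have [C' C'0 HC'] := is_norm_lower hN.
have FL t y y' : `|F t y - F t y'| <= (C' * (M + gam) * C) * `|y - y'|.
  rewrite (le_trans (HC' _))// -!mulrA ler_wpM2l ?(ltW C'0)// (le_trans (FN _ _ _))//.
  by rewrite ler_wpM2l// addr_ge0.
have [Y [Z [Y0 dY YZ JY JZ]]] := flow_exists JF FL.
have cY x : continuous (Y ^~ x) by move=> t; exact: is_derive_continuous (dY x t).
exists Y, Z; split=> //; split=> //.
- move=> x x' s t.
  (* Time is shifted because [gronwall_sym] is centred at 0. *)
  have dsh z (u : R) : is_derive u 1 (fun u => Y (u + t) z) (F (u + t) (Y (u + t) z)).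
    pose v : R := 1 * u + t; have vE : v = u + t by rewrite /v mul1r.
    have H : is_derive v 1 (Y ^~ z) (F (u + t) (Y (u + t) z)) by rewrite -vE; exact: dY.
    have := is_derive_reparam H; rewrite scale1r.
    by congr is_derive; apply/funext => w; rewrite mul1r.
  have := @gronwall_sym R n N hN _ _ (M + gam) 0 (N (Y t x - Y t x')) `|s - t|
    (addr_ge0 M0 gam0) (lexx _) (fun u => is_deriveB (dsh x u) (dsh x' u)) _ _ (s - t) (lexx _).
  rewrite /= addr0 mulrC.
  have -> : ((fun u => Y (u + t) x) - (fun u => Y (u + t) x')) (s - t) = Y s x - Y s x'.
    change (Y (s - t + t) x - Y (s - t + t) x' = Y s x - Y s x'); by rewrite subrK.
  apply; last by move=> u _; rewrite addr0; exact: FN.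
  change (N (Y (0 + t) x - Y (0 + t) x') <= N (Y t x - Y t x')); by rewrite add0r.
- move=> x x' s t s0 st.
  have := @stability R n N hN A Phi K alpha cA Phi_id cPhi dPhi K0 stable gam 0
    (Y ^~ x - Y ^~ x') (fun u => g u (Y u x) - g u (Y u x')) s t.
  rewrite mulr0 mul0r addr0; apply=> //.
    by apply: continuous_add => //; exact: continuous_opp.
  move=> u _; have := is_deriveB (dY x u) (dY x' u).
    by congr is_derive; rewrite /F opprD addrACA -mulmxBr.
  by move=> u _; rewrite addr0.
- move=> x s t s0 st.
  by apply: (@stability R n N hN A Phi K alpha cA Phi_id cPhi dPhi K0 stable gam mu
    (Y ^~ x) (fun u => g u (Y u x)) s t).
Qed.

End PerturbedFlow.

(** * Assembly of the equivalence *)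

Section Assembly.
Variables (R : realType) (n : nat) (N : 'cV[R]_n -> R).
Hypothesis hN : is_norm N.

(** Uniqueness on the half-line gives x(t) = Y1_t(x(0)), so the image is the [Y2]-trajectory of
    [h (x 0)]. The primed fields are the extensions to the whole line. *)
Lemma stable_flow_maps_solutions (F1 F2 F1' F2' : R -> 'cV[R]_n -> 'cV[R]_n)
    (L K b rho : R) (Y1 Z1 Y2 Z2 : R -> 'cV[R]_n -> 'cV[R]_n) (h : 'cV[R]_n -> 'cV[R]_n) :
  0 <= L ->
  stable_flow N L K b rho F1' Y1 Z1 -> stable_flow N L K b rho F2' Y2 Z2 ->
  (forall t y, 0 <= t -> F1' t y = F1 t y) -> (forall t y, 0 <= t -> F2' t y = F2 t y) ->
  maps_solutions F1 F2 (fun t x => Y2 t (h (Z1 t x))).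
Proof.
move=> L0 s1 s2 E1 E2 x solx.
have [cx dx] := has_deriv_Rplus_extend solx.
have [C C0 HC] := is_norm_upper hN; have [C' C'0 HC'] := is_norm_lower hN.
have FL t y y' : `|F1' t y - F1' t y'| <= (C' * L * C) * `|y - y'|.
  rewrite (le_trans (HC' _))// -!mulrA ler_wpM2l ?(ltW C'0)// (le_trans (field_lip s1 _ _ _))//.
  by rewrite ler_wpM2l.
have xE t : 0 <= t -> x t = Y1 t (x 0).
  move=> t0.
  have cL : continuous (fun _ : R => C' * L * C) by cont.
  rewrite -[X in x X](max_l t0).
  apply: (@ode_unique_half_line R n F1' _ cL FL (fun t : R => x (Num.max t 0)) (Y1 ^~ (x 0)) cx) => //.
  - by move=> s; exact: is_derive_continuous (flow_deriv s1 _ s).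
  - by move=> s s0; have := dx s s0; rewrite E1 ?(ltW s0)// (max_l (ltW s0)).
  - by move=> s _; exact: flow_deriv s1 _ s.
  - by rewrite maxxx (flow_start s1).
move=> t t0; apply: (@has_deriv_Rplus_restrict R n _ (Y2 ^~ (h (x 0))) t) => //.
  by move=> s s0; rewrite (xE s s0); have [-> _] := flow_cancel s1 s.
rewrite /= (xE t t0) (_ : Z1 t (Y1 t (x 0)) = x 0); last by have [-> _] := flow_cancel s1 t.
by rewrite -E2//; exact: flow_deriv s2 _ t.
Qed.

(** At a time when both trajectories have been absorbed for good, either pairing equates the same
    two values. *)
Lemma matching_cancel (L K b rho r : R) (Fa Ya Za Fb Yb Zb : R -> 'cV[R]_n -> 'cV[R]_n)
    (L0 : 0 <= L) (K0 : 0 <= K) (b0 : 0 < b) (rho_r : rho < r)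
    (fa : stable_flow N L K b rho Fa Ya Za) (fb : stable_flow N L K b rho Fb Yb Zb) :
  (forall t y, N y <= r -> Fa t y = Fb t y) ->
  cancel (matching K0 b0 Zb fa rho_r) (matching K0 b0 Za fb rho_r).
Proof.
move=> ab x; have ba t y : N y <= r -> Fb t y = Fa t y by move=> yr; rewrite ab.
set y := matching K0 b0 Zb fa rho_r x.
have [T T0 HT] := matching_eventually K0 b0 fa rho_r x.
have [T' T'0 HT'] := matching_eventually K0 b0 fb rho_r y.
pose S := Num.max T T'.
have S0 : 0 <= S by rewrite le_max T0.
have E1 : Yb S y = Ya S x.
  apply: (matchingP hN L0 K0 b0 fa fb rho_r ab S0) => s Ss; apply: HT; apply: le_trans Ss.
  by rewrite le_max lexx.
have E2 : Ya S (matching K0 b0 Za fb rho_r y) = Yb S y.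
  apply: (matchingP hN L0 K0 b0 fb fa rho_r ba S0) => s Ss; apply: HT'; apply: le_trans Ss.
  by rewrite le_max lexx orbT.
have [YZ _] := flow_cancel fa S.
by rewrite -[LHS](YZ _) E2 E1 YZ.
Qed.

Lemma matching_exists k (L K b rho r : R) (Fa Ya Za Fb Yb Zb : R -> 'cV[R]_n -> 'cV[R]_n) :
  0 <= L -> 0 <= K -> 0 < b -> 0 <= rho -> rho < r ->
  stable_flow N L K b rho Fa Ya Za -> stable_flow N L K b rho Fb Yb Zb ->
  (forall t y, N y <= r -> Fa t y = Fb t y) ->
  (forall i, joint_Ck k (fun t x => Ya t x i 0)) -> (forall i, joint_Ck k (fun t x => Za t x i 0)) ->
  (forall i, joint_Ck k (fun t x => Yb t x i 0)) -> (forall i, joint_Ck k (fun t x => Zb t x i 0)) ->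
  exists h h' : 'cV[R]_n -> 'cV[R]_n, [/\ cancel h h' /\ cancel h' h,
    equicont_bounded N (fun t x => Yb t (h (Za t x))), equicont_bounded N (fun t x => Ya t (h' (Zb t x))),
    forall i, joint_Ck k (fun (_ : R) x => h x i 0) & forall i, joint_Ck k (fun (_ : R) x => h' x i 0)].
Proof.
move=> L0 K0 b0 rho0 rho_r fa fb ab JYa JZa JYb JZb.
have ba t y : N y <= r -> Fb t y = Fa t y by move=> yr; rewrite ab.
exists (matching K0 b0 Zb fa rho_r), (matching K0 b0 Za fb rho_r); split.
- by split; [exact: (matching_cancel L0 K0 b0 rho_r fa fb ab)|exact: (matching_cancel L0 K0 b0 rho_r fb fa ba)].
- exact: (equicont_bounded_matching hN L0 K0 b0 fa fb rho_r ab).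
- exact: (equicont_bounded_matching hN L0 K0 b0 fb fa rho_r ba).
- exact: (joint_Ck_matching hN L0 K0 b0 fa fb rho_r ab).
- exact: (joint_Ck_matching hN L0 K0 b0 fb fa rho_r ba).
Qed.

(** The product difference is split so that the variation of [chi] multiplies [f] at the point of
    smaller norm, where the weight of the cutoff bounds it. *)
Lemma truncated_lipschitz (f : 'cV[R]_n -> 'cV[R]_n) (chi : 'cV[R]_n -> R) (mu gam e : R) :
  (forall y, 0 <= chi y <= 1) -> (forall y y', N (f y - f y') <= gam * N (y - y')) ->
  (forall y, N (f y) <= mu + gam * N y) ->
  (forall x y, N x <= N y -> `|chi x - chi y| * (mu + gam * N x) <= e * N (x - y)) ->
  forall y y', N (chi y *: f y - chi y' *: f y') <= (gam + e) * N (y - y').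
Proof.
move=> chi01 fL fB chiL y y'.
wlog yy : y y' / N y <= N y'.
  move=> W; have [/W//|/ltW/W] := leP (N y) (N y').
  by rewrite (is_norm_distC hN) [N (y' - y)](is_norm_distC hN).
have -> : chi y *: f y - chi y' *: f y' = chi y' *: (f y - f y') + (chi y - chi y') *: f y.
  by rewrite scalerBr scalerBl [in RHS]addrC addrA subrK.
rewrite (le_trans (norm_triangle hN _ _))// mulrDl lerD// (norm_scale hN).
  have /andP[c0 c1] := chi01 y'; rewrite ger0_norm// (le_trans _ (fL y y'))//.
  by rewrite ler_piMl// is_norm_ge0.
by rewrite (le_trans _ (chiL _ _ yy))// ler_wpM2l.
Qed.

End Assembly.

Theorem theorem5p2 (R : realType) (n r : nat) (hn : (1 <= n)%N) (hr : (1 <= r)%N)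
  (N : 'cV[R]_n -> R) (mN : 'M[R]_n -> R)
  (hN : is_norm N) (hmN : is_norm mN) (hNmN : compatible_norms N mN)
  (A : R -> 'M[R]_n) (f : R -> 'cV[R]_n -> 'cV[R]_n) (Phi : R -> R -> 'M[R]_n)
  (M K alpha gamma mu : R)
  (hA : {within Rplus, continuous A})
  (hM : 1 < M)
  (hAM : ereal_sup [set (mN (A s))%:E | s in Rplus] = M%:E)
  (hPhi : transition_matrix A Phi)
  (hK : 0 <= K) (halpha : 0 < alpha)
  (P1 : forall t s, 0 <= s -> s <= t ->
     mN (Phi t s) <= K * expR (- alpha * (t - s)))
  (P2_continuous : jointly_continuous f)
  (hgamma : 0 <= gamma)
  (P2_lipschitz : forall t (y y' : 'cV[R]_n), 0 <= t ->
     N (f t y - f t y') <= gamma * N (y - y'))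
  (hmu : 0 <= mu)
  (P3_zero : (ereal_sup [set (N (f t 0))%:E | t in Rplus] <= mu%:E)%E)
  (P3_bounded : forall x : 'cV[R]_n, exists B : R,
     forall t, 0 <= t -> N (f t x) <= B)
  (P4 : forall t, 0 <= t -> tends_to_infinity N (f t))
  (P5_derivatives : forall t, 0 <= t -> class_C r (f t))
  (P5_continuous : jointly_continuous_partials r f)
  (HN : forall (j : nat) (s t : R), (1 <= j)%N -> 0 <= s -> 0 <= t ->
     tends_to_infinity N (fun xi => Phi s t *m xi + zstar Phi f j t xi s))
  (hKgamma : K * gamma < alpha) :
  Cr_topologically_equivalent r N (linear_system A) (nonlinear_system A f).

Proof.
have AM t v : 0 <= t -> N (A t *m v) <= M * N v.
  move=> t0; rewrite (le_trans (hNmN _ _))// ler_wpM2r ?is_norm_ge0//.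
  by rewrite -lee_fin -hAM; apply: ereal_sup_ubound; exists t.
have fmu t : 0 <= t -> N (f t 0) <= mu.
  by move=> t0; rewrite -lee_fin (le_trans _ P3_zero)//; apply: ereal_sup_ubound; exists t.
have max0 (t : R) : 0 <= Num.max t 0 by rewrite le_max lexx orbT.
have M0 : 0 <= M by rewrite ltW// (lt_trans _ hM).
(* Freezing the data at negative times keeps all bounds and makes the fields continuous on the whole
   line. *)
pose A' (t : R) := A (Num.max t 0); pose f' (t : R) := f (Num.max t 0).
have cA : continuous A'.
  by apply: (continuous_compT_within hA (@max0_continuous R)) => t; exact: max0.
have AM' t v : N (A' t *m v) <= M * N v by exact: AM.
have Phi_id s : 0 <= s -> Phi s s = 1%:M by move=> /hPhi[].
have Phi_ext s (v : 'cV[R]_n) (s0 : 0 <= s) : forall t, 0 <= t ->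
    has_deriv_Rplus (fun u => Phi u s *m v) t (A t *m (Phi t s *m v)).
  move=> t t0; have [_ /(_ t t0) D] := hPhi s s0.
  have cM : continuous (fun B : 'M[R]_n => B *m v) by cont.
  have := cvg_comp _ _ D (cM _); rewrite -mulmxA; apply: cvg_trans.
  apply: near_eq_cvg; apply: nearW => u /=.
  by rewrite -scalemxAl mulmxBl.
have cPhi s (v : 'cV[R]_n) : 0 <= s -> continuous (fun u : R => Phi (Num.max u 0) s *m v).
  by move=> s0; have [] := has_deriv_Rplus_extend (Phi_ext s v s0).
have dPhi s (v : 'cV[R]_n) (t : R) : 0 <= s -> 0 < t ->
    is_derive t 1 (fun u : R => Phi (Num.max u 0) s *m v) (A' t *m (Phi t s *m v)).
  move=> s0 t0; have [_ /(_ t t0)] := has_deriv_Rplus_extend (Phi_ext s v s0).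
  by rewrite /A' (max_l (ltW t0)).
have stable t s (v : 'cV[R]_n) : 0 <= s -> s <= t ->
    N (Phi t s *m v) <= K * expR (- alpha * (t - s)) * N v.
  by move=> s0 st; rewrite (le_trans (hNmN _ _))// ler_wpM2r ?is_norm_ge0 ?P1.
have fL t y y' : N (f' t y - f' t y') <= gamma * N (y - y') by exact: P2_lipschitz.
have fB t y : N (f' t y) <= mu + gamma * N y.
  rewrite -[f' t y](subrK (f' t 0)) addrC (le_trans (norm_triangle hN _ _))//.
  by rewrite lerD ?fmu// (le_trans (fL _ _ _))// subr0.
have Jf : forall i, joint_Ck r (fun t x => f' t x i 0) by exact: class_C_joint_Ck.
(* [(1 + K) * e] is the whole spectral gap, so raising [gamma] by [e / 2] keeps [K * gam < alpha],
   also when [K = 0]. *)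
pose e := (alpha - K * gamma) / (1 + K).
pose gam := gamma + e / 2.
have K1 : 0 < 1 + K by rewrite ltr_pwDl.
have e0 : 0 < e by rewrite divr_gt0// subr_gt0.
have e2 : 0 < e / 2 by rewrite divr_gt0.
have gam0 : 0 <= gam by rewrite addr_ge0// ltW.
have Kgam : K * gam < alpha.
  have : (1 + K) * e = alpha - K * gamma by rewrite /e mulrC divfK// gt_eqF.
  rewrite /gam => He; nra.
pose b := alpha - K * gam; have b0 : 0 < b by rewrite subr_gt0.
pose rho := K * mu / b; have rho0 : 0 <= rho by rewrite divr_ge0 ?(ltW b0)// mulr_ge0.
(* The radius [rho + 1] leaves a margin over the absorbing radius [rho]; the weight is the growth
   bound [fB] of the field. *)
have [chi [R1 [Jchi chi01 chi1 chi0 chiL]]] := cutoff r (rho + 1) hN hmu hgamma e2.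
pose f1 (t : R) y := chi y *: f' t y.
have f1L t y y' : N (f1 t y - f1 t y') <= gam * N (y - y').
  exact: (truncated_lipschitz hN chi01 (fL t) (fB t) chiL).
have Jf1 i : joint_Ck r (fun t y => f1 t y i 0).
  by rewrite /f1; under eq_fun do under eq_fun do rewrite mxE; exact: joint_Ck_mul.
have gg y : gamma * N y <= gam * N y.
  by rewrite ler_wpM2r ?is_norm_ge0// lerDl ltW.
have f1f t y : N (f1 t y) <= N (f' t y).
  rewrite /f1 (norm_scale hN); have /andP[c0 c1] := chi01 y.
  by rewrite ger0_norm// ler_piMl// is_norm_ge0.
have fB' t y : N (f' t y) <= gam * N y + mu.
  by rewrite (le_trans (fB t y))// addrC lerD.
have f1B t y : N (f1 t y) <= gam * N y + mu by exact: le_trans (f1f t y) (fB' t y).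
pose S := mu + gamma * `|R1|.
have f1S t y : N (f1 t y) <= S.
  have [yR|Ry] := leP (N y) R1.
    rewrite (le_trans (f1f t y))// (le_trans (fB t y))// lerD2l ler_wpM2l//.
    by rewrite (le_trans yR)// ler_norm.
  by rewrite /f1 chi0// scale0r is_norm0// addr_ge0// mulr_ge0.
(* The perturbations 0, [f1] and [f'] obey the same bounds with [gam] and [mu], so the three flows
   share their constants. *)
have mk g := @perturbed_flow_exists R n N hN A' Phi K alpha M cA Phi_id cPhi dPhi hK stable
  M0 AM' r g gam mu gam0 hmu Kgam.
have [X [Xi [sX JX JXi]]] : exists Y Z,
    [/\ stable_flow N (M + gam) K b rho (fun t y => A' t *m y + 0) Y Z,
    forall i, joint_Ck r (fun t x => Y t x i 0) & forall i, joint_Ck r (fun t x => Z t x i 0)].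
  apply: (mk (fun _ _ => 0)).
  - by move=> i; exact: joint_Ck_cst.
  - by move=> t y y'; rewrite subrr is_norm0// mulr_ge0// is_norm_ge0.
  - by move=> t y; rewrite is_norm0// addr_ge0// mulr_ge0// is_norm_ge0.
have [Y1 [Y1i [sY1 JY1 JY1i]]] := mk f1 Jf1 f1L f1B.
have fL' t y y' : N (f' t y - f' t y') <= gam * N (y - y') by exact: le_trans (fL t y y') (gg _).
have [Y [Yi [sY JY JYi]]] := mk f' Jf fL' fB'.
have L0 : 0 <= M + gam by rewrite addr_ge0.
(* The difference starts at 0 and its perturbation [f1] is bounded by [S]; [stability] applies with
   Lipschitz part 0. *)
have bd t x : 0 <= t -> N (Y1 t x - X t x) <= K * S / alpha.
  move=> t0; have al0 : K * 0 < alpha by rewrite mulr0.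
  have S0 : 0 <= S by rewrite addr_ge0// mulr_ge0.
  have := @stability R n N hN A' Phi K alpha cA Phi_id cPhi dPhi hK stable 0 S
    (Y1 ^~ x - X ^~ x) (fun u => f1 u (Y1 u x)) 0 t (lexx _) S0 al0.
  have -> : (Y1 ^~ x - X ^~ x) 0 = 0.
    by apply/eqP; rewrite subr_eq0 (flow_start sY1) (flow_start sX).
  rewrite is_norm0// mulr0 add0r mulr0 subr0; apply=> //.
  - apply: continuous_add; last apply: continuous_opp.
      by move=> u; exact: is_derive_continuous (flow_deriv sY1 x u).
    by move=> u; exact: is_derive_continuous (flow_deriv sX x u).
  - move=> u _; have := is_deriveB (flow_deriv sY1 x u) (flow_deriv sX x u).
    by congr is_derive; rewrite addr0 addrAC -mulmxBr.
  - by move=> u _; rewrite mul0r add0r.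
have bd' t x : 0 <= t -> N (X t x - Y1 t x) <= K * S / alpha.
  by move=> t0; rewrite (is_norm_distC hN); exact: bd.
have agree t y : N y <= rho + 1 -> A' t *m y + f1 t y = A' t *m y + f' t y.
  by move=> yr; rewrite /f1 chi1// scale1r.
have rho1 : rho < rho + 1 by rewrite ltrDl.
have [h [h' [[hK1 hK2] nH nG Jh Jh']]] :=
  matching_exists hN L0 hK b0 rho0 rho1 sY1 sY agree JY1 JY1i JY JYi.
have [kX kX'] : (forall t, cancel (X t) (Xi t)) /\ (forall t, cancel (Xi t) (X t)).
  by split=> t; have [] := flow_cancel sX t.
have [kY kY'] : (forall t, cancel (Y t) (Yi t)) /\ (forall t, cancel (Yi t) (Y t)).
  by split=> t; have [] := flow_cancel sY t.
have [kY1 kY1'] : (forall t, cancel (Y1 t) (Y1i t)) /\ (forall t, cancel (Y1i t) (Y1 t)).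
  by split=> t; have [] := flow_cancel sY1 t.
pose H t x := Y t (h (Xi t x)); pose G t x := X t (h' (Yi t x)).
have HG t : cancel (H t) (G t) by move=> x; rewrite /G /H kY hK1 kX'.
have GH t : cancel (G t) (H t) by move=> x; rewrite /G /H kX hK2 kY'.
(* Inserting Y1_t^-1 o Y1_t splits H(t,.) into the bounded-difference map followed by the matching
   map. *)
have niceH : equicont_bounded N H.
  apply: (equicont_bounded_ext _ (equicont_bounded_comp (bounded_difference_equicont_bounded hN L0 hK b0 sY1 sX bd) nH)).
  by move=> t x _; rewrite kY1.
have niceG : equicont_bounded N G.
  apply: (equicont_bounded_ext _ (equicont_bounded_comp nG (bounded_difference_equicont_bounded hN L0 hK b0 sX sY1 bd'))).
  by move=> t x _; rewrite kY1.
have JH i : joint_Ck r (fun t x => H t x i 0).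
  apply: (joint_Ck_comp (JY i)) => l.
  exact: (joint_Ck_comp (F := fun (t : R) x => h x l 0) (Jh l) JXi).
have JG i : joint_Ck r (fun t x => G t x i 0).
  apply: (joint_Ck_comp (JX i)) => l.
  exact: (joint_Ck_comp (F := fun (t : R) x => h' x l 0) (Jh' l) JYi).
have J0 (F : R -> 'cV[R]_n -> 'cV[R]_n) : (forall i, joint_Ck r (fun t x => F t x i 0)) ->
    forall i, joint_Ck 0 (fun t x => F t x i 0).
  by move=> JF i; exact: joint_Ck_le (leq0n r) (JF i).
exists H, G; split.
- split.
  + by apply: (equicont_bounded_equivalence_map hN niceH niceG) => //; exact: J0.
  + apply: (stable_flow_maps_solutions hN L0 sX sY) => t y t0.
      by rewrite addr0 /A' (max_l t0).
    by rewrite /A' /f' (max_l t0).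
  + by [].
  + by apply: (equicont_bounded_equivalence_map hN niceG niceH) => //; exact: J0.
  + apply: (stable_flow_maps_solutions hN L0 sY sX) => t y t0.
      by rewrite /A' /f' (max_l t0).
    by rewrite addr0 /A' (max_l t0).
- move=> t _; exists (G t); split=> //; exact: joint_Ck_class_C.
- exact: joint_Ck_jointly_continuous_partials.
- exact: joint_Ck_jointly_continuous_partials.
Qed.
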